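(* Let $(X,0)=(X_1\times X_2,0)$ be a product of two toric curves (germs of toric singularities of dimension $1$). Then $$\operatorname{edim}(X^s,0)=\operatorname{edim}(X_1^s,0)+\operatorname{edim}(X_2^s,0),$$ and $$\operatorname{mult}(X^s,0)=\operatorname{mult}(X_1^s,0)\cdot\operatorname{mult}(X_2^s,0),$$ where $(X^s,0)$, $(X_1^s,0)$, $(X_2^s,0)$ denote the Lipschitz saturations of $(X,0)$, $(X_1,0)$, $(X_2,0)$.
   Context: $\operatorname{edim}$ denotes the embedding dimension of a germ (the dimension of its Zariski tangent space) and $\operatorname{mult}$ its multiplicity (the Hilbert–Samuel multiplicity of its local ring). **Toric singularities.** Let $\Gamma\subset\mathbb{Z}^d$ be a finitely generated semigroup (containing $0$) with generators $\gamma_1,\dots,\gamma_n$, generating $\mathbb{Z}^d$ as a group and such that the cone $\mathbb{R}_{\ge 0}\Gamma$ is strongly convex. Let $X_\Gamma\subset\mathbb{C}^n$ be the affine toric variety defined by the kernel of $\mathbb{C}[z_1,\dots,z_n]\to\mathbb{C}[t_1^{\pm1},\dots,t_d^{\pm1}]$, $z_i\mapsto t^{\gamma_i}$. A germ $(X,0)$ is a germ of toric singularity if it is isomorphic to some $(X_\Gamma,0)$. In dimension $1$, $\Gamma$ may be taken to be a numerical semigroup in $\mathbb{N}$, so a toric curve is a germ parametrized by monomials $t\mapsto(t^{\gamma_1},\dots,t^{\gamma_n})$. **Lipschitz saturation.** Let $(X,0)$ be a reduced irreducible germ of complex analytic space. Let $\overline{\mathcal{O}_{X,0}}$ be the integral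 closure of $\mathcal{O}_{X,0}$ in its field of fractions; it is the analytic algebra of the normalization $n:(\overline{X},0)\to(X,0)$. Let $I_\Delta$ be the kernel of the natural surjection $\mathcal{O}_{\overline{X}\times\overline{X},(0,0)}\to\mathcal{O}_{\overline{X}\times_X\overline{X},(0,0)}$. (If $(X,0)\subset(\mathbb{C}^k,0)$ and $n=(\eta_1,\dots,\eta_k)$, then $I_\Delta$ is generated by $\eta_i(x)-\eta_i(y)$, $i=1,\dots,k$.) For an ideal $I$, $\overline{I}$ denotes its integral closure. The Lipschitz saturation of $\mathcal{O}_{X,0}$ is $$\mathcal{O}_{X,0}^s=\{f\in\overline{\mathcal{O}_{X,0}} : f(x)-f(y)\in\overline{I_\Delta}\}.$$ It is an analytic algebra with $\mathcal{O}_{X,0}\subset\mathcal{O}_{X,0}^s\subset\overline{\mathcal{O}_{X,0}}$, and the Lipschitz saturation $(X^s,0)$ is the germ of analytic space with algebra $\mathcal{O}_{X,0}^s$. *)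

(* Defs.v *)
From HB Require Import structures.
From mathcomp Require Import all_boot all_order all_algebra.
From mathcomp Require Import boolp classical_sets reals.
From mathcomp.real_closed Require Import complex.
From mathcomp.multinomials Require Import ssrcomplements mpoly.

Set Implicit Arguments.
Unset Strict Implicit.
Unset Printing Implicit Defensive.

Import Order.TTheory GRing.Theory Num.Theory.
Local Open Scope ring_scope.
Local Open Scope classical_set_scope.

Section PowerSeries.
Context {K : numFieldType} {n : nat}.
Implicit Types f g h : 'X_{1..n} -> K.

(* Absolute convergence on the closed polydisc of polyradius (r, ..., r). *)
Definition convergent f : Prop :=
  exists r M : K, 0 < r /\
    forall N : nat, \sum_(m : 'X_{1..n < N}) `|f m| * r ^+ mdeg m <= M.

Definition ps_mul f g (m : 'X_{1..n}) : K :=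
  \sum_(k : 'X_{1..n < (mdeg m).+1, (mdeg m).+1} | m == (k.1 + k.2)%MM)
     f k.1 * g k.2.

Definition ps_one (m : 'X_{1..n}) : K := (m == 0%MM)%:R.

Lemma convergentE2 f g : convergent f -> convergent g ->
  exists r M : K, [/\ 0 < r,
    forall N : nat, \sum_(m : 'X_{1..n < N}) `|f m| * r ^+ mdeg m <= M &
    forall N : nat, \sum_(m : 'X_{1..n < N}) `|g m| * r ^+ mdeg m <= M].
Proof.
move=> [r1 [M1 [r1_gt0 H1]]] [r2 [M2 [r2_gt0 H2]]].
have M1_ge0 : 0 <= M1.
  by apply: le_trans (H1 0%N); apply: sumr_ge0 => m _; rewrite mulr_ge0 ?exprn_ge0 // ltW.
have M2_ge0 : 0 <= M2.
  by apply: le_trans (H2 0%N); apply: sumr_ge0 => m _; rewrite mulr_ge0 ?exprn_ge0 // ltW.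
have cmp : r1 >=< r2 by apply: real_comparable; rewrite gtr0_real.
exists (Num.min r1 r2), (M1 + M2).
have rmin_gt0 : 0 < Num.min r1 r2 by rewrite comparable_lt_min // r1_gt0.
have le1 : Num.min r1 r2 <= r1 by rewrite comparable_ge_min // lexx.
have le2 : Num.min r1 r2 <= r2 by rewrite comparable_ge_min // lexx orbT.
split=> // N.
- apply: le_trans (_ : M1 <= _); last by rewrite lerDl.
  apply: le_trans (H1 N); apply: ler_sum => m _.
  by rewrite ler_wpM2l // lerXn2r // nnegrE ltW.
- apply: le_trans (_ : M2 <= _); last by rewrite lerDr.
  apply: le_trans (H2 N); apply: ler_sum => m _.
  by rewrite ler_wpM2l // lerXn2r // nnegrE ltW.
Qed.

Lemma convergent0 : convergent (fun=> 0).
Proof.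
exists 1, 0; split=> // N.
by rewrite big1 // => m _; rewrite normr0 mul0r.
Qed.

Lemma convergentD f g : convergent f -> convergent g ->
  convergent (fun m => f m + g m).
Proof.
move=> cf cg; have [r [M [r_gt0 Hf Hg]]] := convergentE2 cf cg.
exists r, (M + M); split=> // N.
apply: le_trans (lerD (Hf N) (Hg N)); rewrite -big_split /=.
apply: ler_sum => m _; rewrite -mulrDl ler_wpM2r ?ler_normD //.
by rewrite exprn_ge0 // ltW.
Qed.

Lemma convergentN f : convergent f -> convergent (fun m => - f m).
Proof.
move=> [r [M [r_gt0 H]]]; exists r, M; split=> // N.
by under eq_bigr do rewrite normrN.
Qed.

Lemma convergentZ c f : convergent f -> convergent (fun m => c * f m).
Proof.
move=> [r [M [r_gt0 H]]]; exists r, (`|c| * M); split=> // N.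
under eq_bigr do rewrite normrM -mulrA.
by rewrite -mulr_sumr ler_wpM2l.
Qed.

Lemma convergent_finsupp f d : (forall m, (d <= mdeg m)%N -> f m = 0) ->
  convergent f.
Proof.
move=> fd; exists 1, (\sum_(m : 'X_{1..n < d}) `|f m|); split=> // N.
under eq_bigr do rewrite expr1n mulr1.
pose e := maxn N d.
have le_sum a b : (a <= b)%N ->
    \sum_(m : 'X_{1..n < a}) `|f m| <= \sum_(m : 'X_{1..n < b}) `|f m|.
  move=> ab.
  rewrite (big_sub_widen ('X_{1..n < a} : subFinType _) ('X_{1..n < b} : subFinType _) xpredT
    (fun m => `|f m|)) /=; last by move=> x /leq_trans; apply.
  by rewrite [leRHS](bigID (fun m : 'X_{1..n < b} => (mdeg m < a)%N)) /= lerDl sumr_ge0.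
apply: le_trans (le_sum _ e (leq_maxl _ _)) _.
rewrite (bigID (fun m : 'X_{1..n < e} => (mdeg m < d)%N)) /=.
rewrite [X in _ + X]big1 ?addr0; last first.
  by move=> m; rewrite -leqNgt => /fd ->; rewrite normr0.
rewrite [leRHS](big_sub_widen ('X_{1..n < d} : subFinType _) ('X_{1..n < e} : subFinType _) xpredT
  (fun m => `|f m|)) //= => x /leq_trans; apply; exact: leq_maxr.
Qed.

Lemma convergent1 : convergent ps_one.
Proof.
apply: (@convergent_finsupp _ 1) => m; rewrite lt0n mdeg_eq0 /ps_one.
by case: eqP.
Qed.

Definition trunc N f : {mpoly K[n]} := \sum_(m : 'X_{1..n < N}) f m *: 'X_[m].

Lemma coef_trunc N f m : (mdeg m < N)%N -> (trunc N f)@_m = f m.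
Proof. exact: mcoeff_mpoly. Qed.

Lemma ps_mul_mpoly (p q : {mpoly K[n]}) f g m :
  (forall k, (mdeg k <= mdeg m)%N -> p@_k = f k) ->
  (forall k, (mdeg k <= mdeg m)%N -> q@_k = g k) ->
  ps_mul f g m = (p * q)@_m.
Proof.
move=> pf qg; rewrite mcoeffM; apply: eq_bigr => -[k1 k2] _ /=.
by rewrite pf ?qg // -ltnS bmdeg.
Qed.

Lemma ps_mul_trunc N f g m : (mdeg m < N)%N ->
  ps_mul f g m = (trunc N f * trunc N g)@_m.
Proof.
by move=> mN; apply: ps_mul_mpoly => k km; rewrite coef_trunc // (leq_ltn_trans km).
Qed.

Lemma ps_mulE N f g m : (mdeg m < N)%N ->
  ps_mul f g m = \sum_(k : 'X_{1..n < N, N} | m == (k.1 + k.2)%MM) f k.1 * g k.2.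
Proof.
move=> mN; rewrite (ps_mul_trunc f g mN).
rewrite -[(_ * _)@_m]/((mpoly_mul _ _)@_m) (mcoeff_poly_mul _ _ mN).
by apply: eq_bigr => -[k1 k2] _ /=; rewrite !coef_trunc ?bmdeg.
Qed.

Lemma convergentM f g : convergent f -> convergent g -> convergent (ps_mul f g).
Proof.
move=> cf cg; have [r [M [r_gt0 Hf Hg]]] := convergentE2 cf cg.
have r_ge0 := ltW r_gt0.
have t_ge0 h m : 0 <= `|h m| * r ^+ mdeg m by rewrite mulr_ge0 ?exprn_ge0.
exists r, (M * M); split=> // N.
pose a (k : 'X_{1..n < N, N}) :=
  (`|f k.1| * r ^+ mdeg k.1) * (`|g k.2| * r ^+ mdeg k.2).
have a_ge0 k : 0 <= a k by rewrite mulr_ge0.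
apply: (@le_trans _ _ (\sum_k a k)); last first.
  rewrite -(pair_big xpredT xpredT (fun i j : 'X_{1..n < N} =>
     (`|f i| * r ^+ mdeg i) * (`|g j| * r ^+ mdeg j))) /=.
  by rewrite -big_distrlr /=; apply: ler_pM; rewrite ?Hf ?Hg //; apply: sumr_ge0 => i _; exact: t_ge0.
apply: (@le_trans _ _
  (\sum_(m : 'X_{1..n < N}) \sum_(k | bmnm m == (bmnm k.1 + bmnm k.2)%MM) a k)).
  apply: ler_sum => m _; rewrite (@ps_mulE N) ?bmdeg //.
  apply: (le_trans (ler_wpM2r _ (ler_norm_sum _ _ _))); first by rewrite exprn_ge0.
  rewrite mulr_suml; apply: ler_sum => k /eqP ->.
  by rewrite /a mdegD exprD normrM mulrACA.
rewrite (exchange_big_dep xpredT) //=; apply: ler_sum => k _.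
have [kN|Nk] := ltnP (mdeg (k.1 + k.2)%MM) N.
  by rewrite (big_pred1 (BMultinom kN)).
rewrite big_pred0 // => m; apply/eqP => E.
by move: (bmdeg m); rewrite E ltnNge Nk.
Qed.

Lemma ps_mulA f g h : ps_mul f (ps_mul g h) = ps_mul (ps_mul f g) h.
Proof.
apply/funext => m; pose N := (mdeg m).+1; pose T := trunc N.
rewrite (@ps_mul_mpoly (T f) (T g * T h)); last 2 first.
- by move=> k km; rewrite coef_trunc.
- by move=> k km; rewrite (@ps_mul_trunc N).
rewrite mulrA (@ps_mul_mpoly (T f * T g) (T h)) //.
- by move=> k km; rewrite (@ps_mul_trunc N).
- by move=> k km; rewrite coef_trunc.
Qed.

Lemma ps_mulC f g : ps_mul f g = ps_mul g f.
Proof.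
apply/funext => m; rewrite !(@ps_mul_trunc (mdeg m).+1) //.
by rewrite mulrC.
Qed.

Lemma ps_mul1 f : ps_mul ps_one f = f.
Proof.
apply/funext => m; rewrite (@ps_mul_mpoly 1 (trunc (mdeg m).+1 f)).
- by rewrite mul1r coef_trunc.
- by move=> k _; rewrite mcoeff1.
- by move=> k km; rewrite coef_trunc.
Qed.

Lemma ps_mulDl f g h :
  ps_mul (fun m => f m + g m) h = (fun m => ps_mul f h m + ps_mul g h m).
Proof.
by apply/funext => m; rewrite -big_split; apply: eq_bigr => k _; rewrite mulrDl.
Qed.

Lemma ps_mulZl c f g :
  (fun m => c * ps_mul f g m) = ps_mul (fun m => c * f m) g.
Proof.
by apply/funext => m; rewrite mulr_sumr; apply: eq_bigr => k _; rewrite mulrA.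
Qed.

End PowerSeries.

(* The local ring K{z_1, ..., z_n} of convergent power series. *)
Record cvps (K : numFieldType) (n : nat) :=
  CVPS { cvcoef :> 'X_{1..n} -> K; _ : convergent cvcoef }.

Section CvpsAlgebra.
Context {K : numFieldType} {n : nat}.
Local Notation S := (cvps K n).
Implicit Types f g h : S.

Lemma cvpsP f : convergent f. Proof. by case: f. Qed.

Lemma cvps_inj f g : f =1 g -> f = g.
Proof.
case: f g => [f cf] [g cg] /= /funext fg; rewrite fg in cf *.
by rewrite (Prop_irrelevance cf cg).
Qed.

HB.instance Definition _ := gen_eqMixin S.
HB.instance Definition _ := gen_choiceMixin S.

Definition cvps_zero : S := CVPS convergent0.
Definition cvps_one : S := CVPS convergent1.
Definition cvps_opp f : S := CVPS (convergentN (cvpsP f)).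
Definition cvps_add f g : S := CVPS (convergentD (cvpsP f) (cvpsP g)).
Definition cvps_mul f g : S := CVPS (convergentM (cvpsP f) (cvpsP g)).
Definition cvps_scale (c : K) f : S := CVPS (convergentZ c (cvpsP f)).

Fact cvps_addA : associative cvps_add.
Proof. by move=> f g h; apply: cvps_inj => m /=; rewrite addrA. Qed.
Fact cvps_addC : commutative cvps_add.
Proof. by move=> f g; apply: cvps_inj => m /=; rewrite addrC. Qed.
Fact cvps_add0 : left_id cvps_zero cvps_add.
Proof. by move=> f; apply: cvps_inj => m /=; rewrite add0r. Qed.
Fact cvps_addN : left_inverse cvps_zero cvps_opp cvps_add.
Proof. by move=> f; apply: cvps_inj => m /=; rewrite addNr. Qed.

HB.instance Definition _ :=
  GRing.isZmodule.Build S cvps_addA cvps_addC cvps_add0 cvps_addN.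

Fact cvps_mulA : associative cvps_mul.
Proof. by move=> f g h; apply: cvps_inj => m /=; rewrite ps_mulA. Qed.
Fact cvps_mulC : commutative cvps_mul.
Proof. by move=> f g; apply: cvps_inj => m /=; rewrite ps_mulC. Qed.
Fact cvps_mul1 : left_id cvps_one cvps_mul.
Proof. by move=> f; apply: cvps_inj => m /=; rewrite ps_mul1. Qed.
Fact cvps_mulDl : left_distributive cvps_mul +%R.
Proof. by move=> f g h; apply: cvps_inj => m /=; rewrite ps_mulDl. Qed.
Fact cvps_1neq0 : cvps_one != 0.
Proof.
apply/eqP => /(congr1 (fun f : S => f 0%MM)) /eqP.
by rewrite /= /ps_one eqxx oner_eq0.
Qed.

HB.instance Definition _ := GRing.Zmodule_isComNzRing.Build S
  cvps_mulA cvps_mulC cvps_mul1 cvps_mulDl cvps_1neq0.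

Fact cvps_scaleA a b f : cvps_scale a (cvps_scale b f) = cvps_scale (a * b) f.
Proof. by apply: cvps_inj => m /=; rewrite mulrA. Qed.
Fact cvps_scale1 : left_id 1 cvps_scale.
Proof. by move=> f; apply: cvps_inj => m /=; rewrite mul1r. Qed.
Fact cvps_scaleDr : right_distributive cvps_scale +%R.
Proof. by move=> a f g; apply: cvps_inj => m /=; rewrite mulrDr. Qed.
Fact cvps_scaleDl f : {morph cvps_scale^~ f : a b / a + b}.
Proof. by move=> a b; apply: cvps_inj => m /=; rewrite mulrDl. Qed.

HB.instance Definition _ := GRing.Zmodule_isLmodule.Build K S
  cvps_scaleA cvps_scale1 cvps_scaleDr cvps_scaleDl.

Fact cvps_scaleAl (a : K) f g : a *: (f * g) = (a *: f) * g.
Proof. by apply: cvps_inj => m /=; rewrite -ps_mulZl. Qed.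

HB.instance Definition _ := GRing.Lmodule_isLalgebra.Build K S cvps_scaleAl.
HB.instance Definition _ := GRing.Lalgebra_isComAlgebra.Build K S.

Fact convergent_mpoly (p : {mpoly K[n]}) : convergent (fun m => p@_m).
Proof.
apply: (@convergent_finsupp _ _ _ (msize p)) => m pm.
by apply/eqP; rewrite mcoeff_eq0; apply: contraTN pm => /msize_mdeg_lt; rewrite -ltnNge.
Qed.

Definition cvps_of_mpoly (p : {mpoly K[n]}) : S := CVPS (convergent_mpoly p).

End CvpsAlgebra.

Section Blocks.
Context {K : numFieldType} {n1 n2 : nat}.

Definition mnml (m : 'X_{1..n1 + n2}) : 'X_{1..n1} :=
  [multinom m (lshift n2 i) | i < n1].
Definition mnmr (m : 'X_{1..n1 + n2}) : 'X_{1..n2} :=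
  [multinom m (rshift n1 i) | i < n2].

Lemma mdeg_split m : mdeg m = (mdeg (mnml m) + mdeg (mnmr m))%N.
Proof.
rewrite !mdegE big_split_ord /=; congr (_ + _)%N.
  by apply: eq_bigr => i _; rewrite mnmE.
by apply: eq_bigr => i _; rewrite mnmE.
Qed.

Lemma mnm_split_inj m m' : mnml m = mnml m' -> mnmr m = mnmr m' -> m = m'.
Proof.
move=> /mnmP el /mnmP er; apply/mnmP => i; rewrite -(splitK i).
by case: (split i) => j; [move: (el j) | move: (er j)]; rewrite !mnmE.
Qed.

(* f(z_1, ..., z_n1) and g(z_(n1+1), ..., z_(n1+n2)), seen as series in all
   n1 + n2 variables. *)
Definition ps_inl (f : 'X_{1..n1} -> K) (m : 'X_{1..n1 + n2}) : K :=
  if mnmr m == 0%MM then f (mnml m) else 0.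
Definition ps_inr (g : 'X_{1..n2} -> K) (m : 'X_{1..n1 + n2}) : K :=
  if mnml m == 0%MM then g (mnmr m) else 0.

Let widen_bound N n (p : 'X_{1..n1 + n2} -> 'X_{1..n}) (z : pred 'X_{1..n1 + n2})
    (F : 'X_{1..n} -> K) :
  (forall m, 0 <= F m) ->
  (forall m, (mdeg (p m) <= mdeg m)%N) ->
  {in z &, injective p} ->
  \sum_(m : 'X_{1..(n1 + n2) < N} | z m) F (p m) <= \sum_(m : 'X_{1..n < N}) F m.
Proof.
move=> F_ge0 deg_p inj_p.
have pN (m : 'X_{1..(n1 + n2) < N}) : (mdeg (p m) < N)%N.
  exact: leq_ltn_trans (deg_p m) (bmdeg m).
pose q (m : 'X_{1..(n1 + n2) < N}) : 'X_{1..n < N} := BMultinom (pN m).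
rewrite (partition_big q xpredT) //=.
apply: ler_sum => k _.
have [[m /andP[zm /eqP mk]]|none] := pselect (exists m : 'X_{1..(n1 + n2) < N},
    z m && (q m == k)).
  rewrite (big_pred1 m) => [|m' /=]; first by rewrite -mk.
  apply/andP/eqP => [[zm' /eqP m'k]|->]; last by rewrite zm mk eqxx.
  by apply: val_inj; apply: inj_p => //; move: mk; rewrite -m'k => -[].
by rewrite big_pred0 // => m; apply/negP => zm; apply: none; exists m.
Qed.

Fact convergent_inl f : convergent f -> convergent (ps_inl f).
Proof.
move=> [r [M [r_gt0 H]]]; exists r, M; split=> // N; apply: le_trans (H N).
rewrite (bigID (fun m : 'X_{1..(n1 + n2) < N} => mnmr m == 0%MM)) /=.
rewrite [X in _ + X]big1 ?addr0; last first.
  by move=> m /negbTE m0; rewrite /ps_inl m0 normr0 mul0r.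
under eq_bigr => m m0 do
  rewrite /ps_inl m0 mdeg_split (eqP m0) mdeg0 addn0.
apply: (@widen_bound N _ mnml (fun m => mnmr m == 0%MM)
  (fun k => `|f k| * r ^+ mdeg k)).
- by move=> m; rewrite mulr_ge0 ?exprn_ge0 // ltW.
- by move=> m; rewrite [leqRHS]mdeg_split leq_addr.
- by move=> m m' /eqP e /eqP e' el; apply: mnm_split_inj; rewrite ?e ?e'.
Qed.

Fact convergent_inr g : convergent g -> convergent (ps_inr g).
Proof.
move=> [r [M [r_gt0 H]]]; exists r, M; split=> // N; apply: le_trans (H N).
rewrite (bigID (fun m : 'X_{1..(n1 + n2) < N} => mnml m == 0%MM)) /=.
rewrite [X in _ + X]big1 ?addr0; last first.
  by move=> m /negbTE m0; rewrite /ps_inr m0 normr0 mul0r.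
under eq_bigr => m m0 do
  rewrite /ps_inr m0 mdeg_split (eqP m0) mdeg0 add0n.
apply: (@widen_bound N _ mnmr (fun m => mnml m == 0%MM)
  (fun k => `|g k| * r ^+ mdeg k)).
- by move=> m; rewrite mulr_ge0 ?exprn_ge0 // ltW.
- by move=> m; rewrite [leqRHS]mdeg_split leq_addl.
- by move=> m m' /eqP e /eqP e' el; apply: mnm_split_inj; rewrite ?e ?e'.
Qed.

Definition cvps_inl (f : cvps K n1) : cvps K (n1 + n2) :=
  CVPS (convergent_inl (cvpsP f)).
Definition cvps_inr (g : cvps K n2) : cvps K (n1 + n2) :=
  CVPS (convergent_inr (cvpsP g)).

End Blocks.

Section CommutativeAlgebra.
Context {T : comNzRingType}.
Implicit Types G I : set T.

Definition ideal_span G : set T :=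
  [set x | exists (k : nat) (a g : 'I_k -> T),
     (forall i, G (g i)) /\ x = \sum_i a i * g i].

Fixpoint ideal_exp I (k : nat) : set T :=
  if k is k'.+1 then ideal_span [set x * y | x in I & y in ideal_exp I k']
  else setT.

(* h satisfies h^k + a_1 h^(k-1) + ... + a_k = 0 with a_i in I^i. *)
Definition integral_closure I : set T :=
  [set h | exists (k : nat) (a : nat -> T),
     [/\ (0 < k)%N,
         forall i, (1 <= i <= k)%N -> ideal_exp I i (a i) &
         h ^+ k + \sum_(1 <= i < k.+1) a i * h ^+ (k - i) = 0]].

Definition nonunits : set T := [set x | ~ exists y, x * y = 1].

End CommutativeAlgebra.

Definition kernel (U V : nmodType) (f : U -> V) : set U := [set u | f u = 0].

Definition has_quot_dim (K : fieldType) (V : lmodType K) (U W : set V) (d : nat)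
    : Prop :=
  exists b : 'I_d -> V, (forall i, U (b i)) /\
    forall x, U x -> exists! c : {ffun 'I_d -> K}, W (x - \sum_i c i *: b i).

(* A germ of complex analytic space is represented by its local algebra, a
   quotient of some C{z_1, ..., z_n}; morphisms of germs correspond
   contravariantly to morphisms of C-algebras. *)
Section Germs.
Context {R : realType}.
Local Notation C := R[i].
Local Notation "C{ n }" := (cvps C n) (at level 0, n at level 99).

(* The Zariski tangent space is the dual of m / m^2. *)
Definition has_edim (A : comAlgType C) (d : nat) : Prop :=
  has_quot_dim (nonunits : set A) (ideal_exp nonunits 2) d.

(* p is the Hilbert-Samuel polynomial k |-> length (A / m^k); lengths are
   dimensions over C, the residue field. The degree of p is dim A. *)
Definition has_mult (A : comAlgType C) (e : nat) : Prop :=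
  exists p : {poly rat},
    (exists k0 : nat, forall k : nat, (k0 <= k)%N ->
       exists2 h : nat, has_quot_dim [set: A] (ideal_exp nonunits k) h
                      & p.[k%:R] = h%:R) /\
    e%:R = ((size p).-1)`!%:R * lead_coef p.

(* Y x Z, with Y in (C^n1, 0) and Z in (C^n2, 0), is the subspace of
   (C^(n1 + n2), 0) defined by the equations of Y in the first n1 variables
   and those of Z in the last n2; p1 and p2 are dual to the projections. *)
Definition germ_product (B1 B2 P : comAlgType C)
    (p1 : {lrmorphism B1 -> P}) (p2 : {lrmorphism B2 -> P}) : Prop :=
  exists (n1 n2 : nat) (phi1 : {lrmorphism C{n1} -> B1})
    (phi2 : {lrmorphism C{n2} -> B2}) (phi : {lrmorphism C{n1 + n2} -> P}),
    [/\ range phi1 = setT /\ range phi2 = setT,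
        range phi = setT,
        forall f, phi (cvps_inl f) = p1 (phi1 f),
        forall g, phi (cvps_inr g) = p2 (phi2 g) &
        kernel phi = ideal_span ((cvps_inl @` kernel phi1) `|`
                                 (cvps_inr @` kernel phi2))].

(* nu identifies B with the integral closure of the domain A in its field of
   fractions F. *)
Definition is_normalization (A B : comAlgType C) (nu : {lrmorphism A -> B})
    : Prop :=
  exists (F : fieldType) (j : {rmorphism B -> F}),
    [/\ injective nu, injective j,
        forall z : F, exists a b : A, b != 0 /\ z = j (nu a) / j (nu b) &
        forall z : F, integralOver (j \o nu) z <-> range j z].

(* Y x_X Z is the subspace of Y x Z on which the pullbacks of every function
   a on X agree; in an embedding of X the coordinates a = z_i suffice. Here P is
   the algebra of Y x Z and q is dual to the inclusion of Y x_X Z. *)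
Definition germ_fiber_product (A B1 B2 P Q : comAlgType C)
    (g1 : {lrmorphism A -> B1}) (g2 : {lrmorphism A -> B2})
    (p1 : {lrmorphism B1 -> P}) (p2 : {lrmorphism B2 -> P})
    (q : {lrmorphism P -> Q}) : Prop :=
  [/\ germ_product p1 p2, range q = setT &
      kernel q = ideal_span (range (fun a : A => p1 (g1 a) - p2 (g2 a)))].

(* With nu : A -> B dual to the normalization Xbar -> X and P, Q the algebras of
   Xbar x Xbar and Xbar x_X Xbar, the ideal I_Delta is the kernel of q, and
   p1 f = f(x), p2 f = f(y). The algebra S is identified by sigma with A^s. *)
Definition is_lipschitz_saturation (A S : comAlgType C) : Prop :=
  exists (B P Q : comAlgType C) (nu : {lrmorphism A -> B})
    (p1 p2 : {lrmorphism B -> P}) (q : {lrmorphism P -> Q})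
    (sigma : {lrmorphism S -> B}),
    [/\ is_normalization nu, germ_fiber_product nu nu p1 p2 q,
        injective sigma &
        range sigma = [set f | integral_closure (kernel q) (p1 f - p2 f)]].

Definition cone (n d : nat) (gamma : 'I_n -> 'rV[int]_d) : set 'rV[R]_d :=
  [set x | exists c : 'I_n -> R, (forall i, 0 <= c i) /\
     x = \sum_i c i *: map_mx intr (gamma i)].

Definition strongly_convex (d : nat) (s : set 'rV[R]_d) : Prop :=
  forall x, s x -> s (- x) -> x = 0.

(* Kernel of z_i |-> t^(gamma_i): every coefficient of the Laurent polynomial
   p(t^(gamma_1), ..., t^(gamma_n)) vanishes. *)
Definition toric_ideal (n d : nat) (gamma : 'I_n -> 'rV[int]_d)
    : set {mpoly C[n]} :=
  [set p | forall v : 'rV[int]_d,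
     \sum_(m <- msupp p | \sum_i gamma i *+ m i == v) p@_m = 0].

(* Algebras isomorphic to that of (X_Gamma, 0) with Gamma in Z^d. As dim X_Gamma
   = d, these are the germs of toric singularities of dimension d. A zero
   generator gamma_i would put z_i - 1 in the ideal, hence make the quotient
   trivial, which the non-triviality of A excludes. *)
Definition toric_germ (d : nat) (A : comAlgType C) : Prop :=
  exists (n : nat) (gamma : 'I_n -> 'rV[int]_d),
    [/\ forall v, exists c : 'I_n -> int, v = \sum_i gamma i *~ c i,
        strongly_convex (cone gamma) &
        exists phi : {lrmorphism C{n} -> A}, range phi = setT /\
          kernel phi = ideal_span (cvps_of_mpoly @` toric_ideal gamma)].

End Germs.

(* Main.v *)
Require Import Defs.
From HB Require Import structures.
From mathcomp Require Import all_boot all_order all_algebra cyclic separable cyclotomic.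
From mathcomp Require Import boolp classical_sets reals.
From mathcomp.real_closed Require Import complex.
From mathcomp.multinomials Require Import ssrcomplements mpoly.
From mathcomp Require Import ring lra zify.

Set Implicit Arguments.
Unset Strict Implicit.
Unset Printing Implicit Defensive.

Import Order.TTheory GRing.Theory Num.Theory.
Local Open Scope ring_scope.

(** Write C{x} for the ring of convergent power series in x_1, ..., x_d. Each
of the three saturations turns out to be the ring of all convergent series, in
one variable for the curves and in two for their product, whose exponents lie
in a certain set; the set belonging to the product is the product of those
belonging to the curves, and both invariants count exponents.

Models. A toric curve has coordinates t^g_i with coprime positive g_i, and the
product of two of them has coordinates x^g_i and y^h_j. Both are instances of
[monomial_model]: an algebra A with a presentation psi from C{z_1, ..., z_N}
and an embedding theta in C{x} that sends every coordinate to a power of a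
single variable ([toric_curve_model], [product_model]). Their algebras are
given by arbitrary presentations, and only as C-algebras. Two facts make up
for the absence of a topology: a morphism of C-algebras between rings of
convergent series is determined by the images of the variables ([lrm_ext]),
and two such morphisms differ on F by a combination of their differences on
the variables ([lrm_congr]). That theta is injective ([model_injective]) uses
that A is a domain, which holds because A embeds in its normalization.

Normalization. It is C{x} ([normalization_of_model]): C{x} is integral over
the image of A, has the same fractions because the g_i are coprime, and is
normal ([cvps_almost_integral]). Normality comes from division with remainder
by a series with a given leading monomial ([cvps_division]), applied to a
fraction all of whose powers have a common denominator.

Saturation. Let d(a) be the gcd of the exponents g_i <= a of the variable x_j.
Then x_j^a lies in the saturation if and only if d(a) divides a, and a series
does if and only if all its monomials do ([lipschitz_saturation_model]). For
necessity, compare F(x) with F(x') on the graph of the map x' that multiplies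
x_j by a primitive d(a)-th root of unity (by 0 if no g_i <= a). There the
ideal of the diagonal vanishes to order > a in x_j, hence so does everything
integral over it ([ord_ge_integral_closure]); but the map only rescales the
coefficients of F, so that exponents a of x_j not divisible by d(a) would
survive. For sufficiency, X^a - Y^a is integral over the ideal generated by
the X^g_i - Y^g_i: the Euclidean algorithm can be run on exponents
([diff_integral_saturation]).

Invariants. If a, b > 0 are exponents of the saturation of a curve and e is
the least positive one, then a + b - e is one too ([arf_saturated]). Let the
order of a be the largest k such that a is a sum of k positive exponents; by
the preceding property, k - 1 of them can be taken equal to e. In two
variables orders are added, and the k-th power of the maximal ideal consists
of the series with all monomials of order >= k ([ideal_exp_nonunits]). As 0 is
the only exponent of order 0 and each positive order is taken e times
([arf_countS]), the curve has embedding dimension e and colength 1 + e(k - 1)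
of the k-th power, hence multiplicity e. For the product, with e_1 and e_2,
there are e_1 + e_2 monomials of order 1, and the colength is 1 + (e_1 +
e_2)(k - 1) + e_1 e_2 (k - 1)(k - 2)/2, so that the multiplicity is e_1 e_2
([has_edim_two], [has_mult_two]). *)

(** * Convergent power series *)

Section Estimates.
Context {K : numFieldType} {n : nat}.
Implicit Types (f g : 'X_{1..n} -> K) (F G : cvps K n) (m e : 'X_{1..n}).

Lemma sum_inj_le (I J : finType) (h : I -> J) (F : J -> K) :
  injective h -> (forall j, 0 <= F j) -> \sum_i F (h i) <= \sum_j F j.
Proof.
move=> h_inj F_ge0.
rewrite -(big_imset (fun j => F j)) /=; last by move=> i j _ _; apply: h_inj.
rewrite [leRHS](bigID (mem (h @: [set: I]))) /=.
have -> : \sum_(j in [set h x | x in I]) F j = \sum_(j in [set h x | x in [set: I]]) F j.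
  by apply: eq_bigl => j; apply/imsetP/imsetP => -[x _ ->]; exists x.
by rewrite lerDl sumr_ge0.
Qed.

Lemma sum_half_pow (N : nat) : \sum_(j < N) (2^-1 : K) ^+ j <= 2.
Proof.
have -> : \sum_(j < N) (2^-1 : K) ^+ j = 2 - 2 * (2^-1) ^+ N.
  elim: N => [|N IH]; first by rewrite big_ord0 expr0 mulr1 subrr.
  by rewrite big_ord_recr /= IH exprS; field.
by rewrite gerBl mulr_ge0 // exprn_ge0 // invr_ge0.
Qed.

Lemma sum_half_mdeg (N : nat) :
  \sum_(m : 'X_{1..n < N}) (2^-1 : K) ^+ mdeg m <= 2 ^+ n.
Proof.
have mN (m : 'X_{1..n < N}) i : (m i < N)%N.
  by apply: leq_ltn_trans (bmdeg m); rewrite mdegE (bigD1 i) //= leq_addr.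
pose h (m : 'X_{1..n < N}) := [ffun i : 'I_n => Ordinal (mN m i)].
pose F (u : {ffun 'I_n -> 'I_N}) : K := \prod_i (2^-1) ^+ u i.
have -> : \sum_(m : 'X_{1..n < N}) (2^-1 : K) ^+ mdeg m
    = \sum_(m : 'X_{1..n < N}) F (h m).
  apply: eq_bigr => m _; rewrite mdegE expr_sum.
  by apply: eq_bigr => i _; rewrite ffunE.
apply: le_trans (sum_inj_le _ _) _.
- move=> m m' /ffunP E; apply/val_inj/mnmP => i.
  by have := E i; rewrite !ffunE => -[].
- by move=> u; apply: prodr_ge0 => i _; rewrite exprn_ge0 // invr_ge0.
rewrite /F -(bigA_distr_bigA (fun (i : 'I_n) (j : 'I_N) => (2^-1 : K) ^+ j)) /=.
rewrite -[X in 2 ^+ X]card_ord -prodr_const; apply: ler_prod => i _.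
by rewrite sum_half_pow andbT sumr_ge0 // => j _; rewrite exprn_ge0 // invr_ge0.
Qed.

(** Cauchy's estimate, and a comparison with a product of geometric series.
Most constructions below verify this coefficientwise criterion. *)
Lemma convergent_geo f :
  convergent f <-> exists C r : K, [/\ 0 < r, 0 <= C &
    forall m, `|f m| <= C * r ^+ mdeg m].
Proof.
split=> [[r [M [r_gt0 H]]]|[C [r [r_gt0 C_ge0 H]]]].
  have M_ge0 : 0 <= M.
    apply: le_trans (H 0%N); apply: sumr_ge0 => m _.
    by rewrite mulr_ge0 // exprn_ge0 // ltW.
  exists M, r^-1; split; rewrite ?invr_gt0 // => m.
  rewrite exprVn ler_pdivlMr ?exprn_gt0 //.
  apply: le_trans (H (mdeg m).+1).
  rewrite (bigD1 (BMultinom (ltnSn (mdeg m)))) //= lerDl.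
  by apply: sumr_ge0 => k _; rewrite mulr_ge0 // exprn_ge0 // ltW.
exists (2 * r)^-1, (C * 2 ^+ n); split; first by rewrite invr_gt0 mulr_gt0.
move=> N; apply: le_trans (_ : C * \sum_(m : 'X_{1..n < N}) 2^-1 ^+ mdeg m <= _).
  rewrite mulr_sumr; apply: ler_sum => m _.
  rewrite invfM exprMn mulrCA [leRHS]mulrC ler_wpM2l ?exprn_ge0 ?invr_ge0 //.
  by rewrite exprVn ler_pdivrMr ?exprn_gt0.
by apply: ler_wpM2l => //; apply: sum_half_mdeg.
Qed.

Lemma cvps_geo F : exists C r : K, [/\ 0 < r, 0 <= C &
  forall m, `|F m| <= C * r ^+ mdeg m].
Proof. exact/convergent_geo/cvpsP. Qed.

Definition nrm (r : K) (N : nat) f := \sum_(m : 'X_{1..n < N}) `|f m| * r ^+ mdeg m.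

Lemma nrm_ge0 r N f : 0 <= r -> 0 <= nrm r N f.
Proof. by move=> r0; apply: sumr_ge0 => m _; rewrite mulr_ge0 // exprn_ge0. Qed.

Lemma nrm_mul r N f g : 0 <= r -> nrm r N (ps_mul f g) <= nrm r N f * nrm r N g.
Proof.
move=> r_ge0.
pose a (k : 'X_{1..n < N, N}) :=
  (`|f k.1| * r ^+ mdeg k.1) * (`|g k.2| * r ^+ mdeg k.2).
have a_ge0 k : 0 <= a k by rewrite !mulr_ge0 ?exprn_ge0.
apply: (@le_trans _ _ (\sum_k a k)); last first.
  rewrite -(pair_big xpredT xpredT (fun i j : 'X_{1..n < N} =>
     (`|f i| * r ^+ mdeg i) * (`|g j| * r ^+ mdeg j))) /=.
  by rewrite -big_distrlr.
apply: (@le_trans _ _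
  (\sum_(m : 'X_{1..n < N}) \sum_(k | bmnm m == (bmnm k.1 + bmnm k.2)%MM) a k)).
  apply: ler_sum => m _; rewrite (@ps_mulE _ _ N) ?bmdeg //.
  apply: (le_trans (ler_wpM2r _ (ler_norm_sum _ _ _))); first by rewrite exprn_ge0.
  rewrite mulr_suml; apply: ler_sum => k /eqP ->.
  by rewrite /a mdegD exprD normrM mulrACA.
rewrite (exchange_big_dep xpredT) //=; apply: ler_sum => k _.
have [kN|Nk] := ltnP (mdeg (k.1 + k.2)%MM) N.
  by rewrite (big_pred1 (BMultinom kN)).
rewrite big_pred0 // => m; apply/eqP => E.
by move: (bmdeg m); rewrite E ltnNge Nk.
Qed.

Lemma nrm1 r N : 0 <= r -> nrm r N (ps_one (K := K)) <= 1.
Proof.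
case: N => [|N] r0.
  by rewrite /nrm big1 ?ler01 // => m; have := bmdeg m; rewrite ltn0.
rewrite /nrm (bigD1 (bm0 : 'X_{1..n < N.+1})) //= big1 => [|m m0].
  by rewrite /ps_one eqxx normr1 mdeg0 expr0 mulr1 addr0.
rewrite /ps_one; case: eqP => [E|_]; last by rewrite normr0 mul0r.
by case/eqP: m0; apply: val_inj.
Qed.

Lemma nrm_eq r N f g : (forall m, (mdeg m < N)%N -> f m = g m) -> nrm r N f = nrm r N g.
Proof. by move=> E; apply: eq_bigr => m _; rewrite E // bmdeg. Qed.

Lemma cvcD F G m : (F + G) m = F m + G m. Proof. by []. Qed.
Lemma cvcB F G m : (F - G) m = F m - G m. Proof. by []. Qed.
Lemma cvcZ c F m : (c *: F) m = c * F m. Proof. by []. Qed.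
Lemma cvc0 m : (0 : cvps K n) m = 0. Proof. by []. Qed.
Lemma cvc1 m : (1 : cvps K n) m = (m == 0%MM)%:R. Proof. by []. Qed.
Lemma cvc_sum (I : Type) (s : seq I) (P : pred I) (F : I -> cvps K n) m :
  (\sum_(i <- s | P i) F i) m = \sum_(i <- s | P i) F i m.
Proof. by apply: (big_morph (fun H : cvps K n => H m)). Qed.
Lemma cvcM F G m : (F * G) m =
  \sum_(k : 'X_{1..n < (mdeg m).+1, (mdeg m).+1} | m == (k.1 + k.2)%MM) F k.1 * G k.2.
Proof. by []. Qed.
Lemma cvc_alg c m : ((c%:A : cvps K n) m) = c * (m == 0%MM)%:R. Proof. by []. Qed.

Lemma cvcM_neq0 F G m : (F * G) m != 0 ->
  exists k l, [/\ m = (k + l)%MM, F k != 0 & G l != 0].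
Proof.
rewrite cvcM => H.
have [k /andP[/eqP E Hk]] : exists k : 'X_{1..n < (mdeg m).+1, (mdeg m).+1},
    (m == (k.1 + k.2)%MM) && (F k.1 * G k.2 != 0).
  apply/existsP; apply: contraR H; rewrite negb_exists => /forallP H.
  by rewrite big1 // => k E; have := H k; rewrite E /= negbK => /eqP.
exists k.1, k.2; split=> //; apply: contraNneq Hk => ->; rewrite ?mul0r ?mulr0 //.
Qed.

Lemma cvcM0 F G : (F * G) 0%MM = F 0%MM * G 0%MM.
Proof.
rewrite /= (@ps_mulE _ _ 1) ?mdeg0 //.
rewrite (big_pred1 (bm0 : 'X_{1..n < 1}, bm0 : 'X_{1..n < 1})) // => -[k1 k2] /=.
apply/eqP/eqP => [E|[-> ->]]; last by rewrite addm0.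
have := bmdeg k1; have := bmdeg k2; rewrite !ltnS !leqn0 !mdeg_eq0 => /eqP e2 /eqP e1.
by congr pair; apply: val_inj.
Qed.

Definition cvX e : cvps K n := cvps_of_mpoly 'X_[e].

Lemma cvcX e m : cvX e m = (e == m)%:R.
Proof. exact: mcoeffX. Qed.

Lemma cvcXM e F m : (cvX e * F) m = if (e <= m)%MM then F (m - e)%MM else 0.
Proof.
rewrite cvcM; case: ifP => em.
  have b1 : (mdeg e < (mdeg m).+1)%N.
    by rewrite ltnS -(submK em) mdegD leq_addl.
  have b2 : (mdeg (m - e) < (mdeg m).+1)%N by rewrite ltnS mdegB.
  rewrite (bigD1 (BMultinom b1, BMultinom b2)) /=; last by rewrite addmC submK.
  rewrite mcoeffX eqxx mul1r big1 ?addr0 // => -[k1 k2] /= /andP[/eqP E ne].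
  rewrite mcoeffX; case: eqP => [E1|_]; last by rewrite mul0r.
  case/eqP: ne; congr pair; apply: val_inj => //=.
  apply: (@addmI _ e); rewrite [RHS]addmC submK //.
  exact: (etrans (congr1 (fun z => z + k2)%MM E1) (esym E)).
apply: big1 => -[k1 k2] /= /eqP E; rewrite mcoeffX; case: eqP => [E1|_]; rewrite ?mul0r //.
by case/negP: (negbT em); rewrite [X in (_ <= X)%MM]E E1 lem_addr.
Qed.

Lemma cvXD a b : cvX (a + b) = cvX a * cvX b.
Proof.
apply: cvps_inj => m; rewrite cvcXM !cvcX; case: ifP => am.
  by rewrite -{1}(submK am) addmC eqm_add2r.
by case: eqP => // E; move: am; rewrite -E lem_addr.
Qed.

Lemma cvX0 : cvX 0 = 1.
Proof. by apply: cvps_inj => m; rewrite cvcX cvc1 eq_sym. Qed.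

Lemma cvXn e k : cvX e ^+ k = cvX (e *+ k).
Proof.
elim: k => [|k IH]; first by rewrite expr0 mulm0n cvX0.
by rewrite exprS IH mulmS cvXD.
Qed.

Lemma cvX_sum (I : Type) (s : seq I) (P : pred I) (e : I -> 'X_{1..n}) :
  \prod_(i <- s | P i) cvX (e i) = cvX (\sum_(i <- s | P i) e i)%MM.
Proof. by rewrite (big_morph cvX cvXD cvX0). Qed.

Lemma cvXE e : cvX e = \prod_i cvX U_(i) ^+ e i.
Proof.
rewrite [in LHS](multinomUE_id e) -cvX_sum.
by apply: eq_bigr => i _; rewrite cvXn.
Qed.

(** Membership in the N-th power of the maximal ideal, by coefficients. *)
Definition ordge (N : nat) F := forall m, (mdeg m < N)%N -> F m = 0.

Lemma ordge0 F : ordge 0 F. Proof. by []. Qed.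
Lemma ordgeD N F G : ordge N F -> ordge N G -> ordge N (F + G).
Proof. by move=> HF HG m mN; rewrite cvcD HF ?HG ?addr0. Qed.
Lemma ordge_sum N (I : Type) (s : seq I) (P : pred I) (F : I -> cvps K n) :
  (forall i, P i -> ordge N (F i)) -> ordge N (\sum_(i <- s | P i) F i).
Proof. by move=> H m mN; rewrite cvc_sum big1 // => i Pi; apply: H. Qed.
Lemma ordgeZ N c F : ordge N F -> ordge N (c *: F).
Proof. by move=> HF m mN; rewrite cvcZ HF ?mulr0. Qed.
Lemma ordgeM N N' F G : ordge N F -> ordge N' G -> ordge (N + N') (F * G).
Proof.
move=> HF HG m mN; apply/eqP; apply: contraTT mN => /cvcM_neq0[k [l [-> Fk Gl]]].
rewrite -leqNgt mdegD leq_add // leqNgt.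
  by apply: contraNN Fk => /HF ->.
by apply: contraNN Gl => /HG ->.
Qed.
Lemma ordge_leq N N' F : (N' <= N)%N -> ordge N F -> ordge N' F.
Proof. by move=> NN H m mN; apply: H; apply: leq_trans mN NN. Qed.
Lemma ordge_eq0 F : (forall N, ordge N F) -> F = 0.
Proof. by move=> H; apply: cvps_inj => m; apply: (H (mdeg m).+1). Qed.
Lemma ordge1 F : ordge 1 F <-> F 0%MM = 0.
Proof.
split=> [H|H m]; first by apply: H; rewrite mdeg0.
by rewrite ltnS leqn0 mdeg_eq0 => /eqP ->.
Qed.
Lemma ordgeXn k F : ordge 1 F -> ordge k (F ^+ k).
Proof.
move=> HF; elim: k => [|k IH]; first exact: ordge0.
by rewrite exprS -add1n; apply: ordgeM.
Qed.
End Estimates.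

Lemma ordge_prod (K : numFieldType) (n : nat) (I : finType) (N : I -> nat)
    (F : I -> cvps K n) :
  (forall i, ordge (N i) (F i)) -> ordge (\sum_i N i) (\prod_i F i).
Proof.
move=> H; apply: (big_ind2 (fun a b => ordge a b)) => //.
by move=> a b c d; apply: ordgeM.
Qed.

(** * Morphisms between rings of convergent power series *)

(** Bundling a function given with proofs, for morphisms that only exist
propositionally. *)
Lemma mk_lrmorphism (R : comNzRingType) (U V : comAlgType R) (f : U -> V) :
  linear f -> (forall u v, f (u * v) = f u * f v) -> f 1 = 1 ->
  exists F : {lrmorphism U -> V}, F =1 f.
Proof.
move=> lin mul one.
pose m1 := GRing.isLinear.Build R U V *:%R f lin.
have mm : GRing.monoid_morphism f by split.
pose m2 := GRing.isMonoidMorphism.Build U V f mm.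
pose F : {lrmorphism U -> V} := HB.pack f m1 m2.
by exists F.
Qed.

Section LRMorphismTheory.
Context {R : comNzRingType} {U V : comAlgType R} (f : {lrmorphism U -> V}).
Lemma lrD u v : f (u + v) = f u + f v. Proof. exact: raddfD. Qed.
Lemma lrB u v : f (u - v) = f u - f v. Proof. exact: raddfB. Qed.
Lemma lrM u v : f (u * v) = f u * f v. Proof. exact: rmorphM. Qed.
Lemma lrXn u j : f (u ^+ j) = f u ^+ j. Proof. exact: rmorphXn. Qed.
Lemma lrZ a u : f (a *: u) = a *: f u. Proof. exact: linearZ. Qed.
Lemma lr0 : f 0 = 0. Proof. exact: raddf0. Qed.
Lemma lr1 : f 1 = 1. Proof. exact: rmorph1. Qed.
Lemma lr_alg a : f a%:A = a%:A. Proof. by rewrite lrZ lr1. Qed.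
Lemma lr_sum (I : Type) (s : seq I) (P : pred I) (F : I -> U) :
  f (\sum_(i <- s | P i) F i) = \sum_(i <- s | P i) f (F i).
Proof. exact: raddf_sum. Qed.
Lemma lr_prod (I : Type) (s : seq I) (P : pred I) (F : I -> U) :
  f (\prod_(i <- s | P i) F i) = \prod_(i <- s | P i) f (F i).
Proof. exact: rmorph_prod. Qed.
End LRMorphismTheory.

Section Substitution.
Context {K : numFieldType} {k n : nat}.
Variable g : 'I_k -> cvps K n.
Hypothesis g0 : forall i, g i 0%MM = 0.
Implicit Types (f : cvps K k) (m : 'X_{1..k}) (a : 'X_{1..n}).

Definition partial_subst (N : nat) (f : 'X_{1..k} -> K) : cvps K n :=
  \sum_(m : 'X_{1..k < N}) f m *: mmap1 g m.

(** A coefficient of the composed series involves only finitely many monomials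
because the g_i have no constant term. *)
Definition subst_coef (f : 'X_{1..k} -> K) (a : 'X_{1..n}) : K :=
  partial_subst (mdeg a).+1 f a.

Lemma ordge_mmap1 m : ordge (mdeg m) (mmap1 g m).
Proof. by rewrite mdegE; apply: ordge_prod => i; apply/ordgeXn/ordge1. Qed.

Lemma partial_substE N f : partial_subst N f = mmap (in_alg (cvps K n)) g (trunc N f).
Proof.
rewrite /trunc raddf_sum /=; apply: eq_bigr => m _.
by rewrite mmapZ mmapX mulr_algl.
Qed.

Lemma mmap_ordge N (p : {mpoly K[k]}) : (forall m, (mdeg m < N)%N -> p@_m = 0) ->
  ordge N (mmap (in_alg (cvps K n)) g p).
Proof.
move=> pN; apply: ordge_sum => m _; rewrite mulr_algl.
have [mN|Nm] := ltnP (mdeg m) N; first by rewrite pN // scale0r.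
by apply/ordgeZ/(ordge_leq Nm)/ordge_mmap1.
Qed.

Lemma partial_subst_leq N N' f : (N <= N')%N ->
  ordge N (partial_subst N' f - partial_subst N f).
Proof.
move=> NN; rewrite !partial_substE -raddfB; apply: mmap_ordge => m mN.
by rewrite mcoeffB !coef_trunc ?subrr // (leq_trans mN).
Qed.

Lemma subst_coefE N f a : (mdeg a < N)%N -> subst_coef f a = partial_subst N f a.
Proof.
move=> aN; apply/eqP; rewrite eq_sym -subr_eq0 -cvcB; apply/eqP.
exact: (partial_subst_leq f aN).
Qed.

(** On a small polydisc the g_i stay in the polydisc of convergence of the
series into which they are substituted. *)
Lemma small_radius (e : K) : 0 < e ->
  exists r : K, 0 < r /\ forall N i, nrm r N (g i) <= e.
Proof.
move=> e0.
have /choice[p Hp] : forall i, exists p : K * K, [/\ 0 < p.2, 0 <= p.1 &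
    forall a, `|g i a| <= p.1 * p.2 ^+ mdeg a].
  by move=> i; have [C [r H]] := cvps_geo (g i); exists (C, r).
pose C := \sum_i (p i).1; pose s := 1 + \sum_i (p i).2.
have C_ge0 : 0 <= C by apply: sumr_ge0 => i _; case: (Hp i).
have s_gt0 : 0 < s.
  by apply: ltr_wpDr => //; apply: sumr_ge0 => i _; case: (Hp i) => /ltW.
have gCs i a : `|g i a| <= C * s ^+ mdeg a.
  have [r0 C0 H] := Hp i; apply: le_trans (H a) _; apply: ler_pM => //.
  - by rewrite exprn_ge0 // ltW.
  - by rewrite /C (bigD1 i) //= lerDl sumr_ge0 // => j _; case: (Hp j).
  - apply: lerXn2r; rewrite ?nnegrE; [exact: ltW|exact: ltW|].
    rewrite /s (bigD1 i) //= addrCA lerDl.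
    by rewrite addr_ge0 // sumr_ge0 // => j _; case: (Hp j) => /ltW.
pose D := e + C * 2 ^+ n.
have D_gt0 : 0 < D by rewrite ltr_wpDr // mulr_ge0 // exprn_ge0.
have [t tE] : {t : K | t = e / D} by exists (e / D).
have t_ge0 : 0 <= t by rewrite tE divr_ge0 // ltW.
have t_le1 : t <= 1 by rewrite tE ler_pdivrMr // mul1r lerDl mulr_ge0 // exprn_ge0.
have t_gt0 : 0 < t by rewrite tE divr_gt0.
(* the g_i have no constant term, so that a radius t / (2 s) gains a factor t *)
exists (t / (2 * s)); split; first by rewrite divr_gt0 // mulr_gt0.
move=> N i; apply: le_trans (_ : C * t * \sum_(m : 'X_{1..n < N}) 2^-1 ^+ mdeg m <= _).
  rewrite mulr_sumr; apply: ler_sum => m _.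
  have [m0|m_gt0] := posnP (mdeg m).
    have -> : bmnm m = 0%MM by apply/eqP; rewrite -mdeg_eq0 m0.
    by rewrite g0 normr0 mul0r mdeg0 expr0 mulr1 mulr_ge0.
  have q_ge0 : 0 <= (t / (2 * s)) ^+ mdeg m.
    by rewrite exprn_ge0 // divr_ge0 // mulr_ge0 // ltW.
  apply: le_trans (ler_wpM2r q_ge0 (gCs i m)) _.
  rewrite -!mulrA ler_wpM2l // -exprMn.
  have -> : s * (t / (2 * s)) = t * 2^-1 by field; rewrite gt_eqF.
  rewrite exprMn ler_wpM2r ?exprn_ge0 ?invr_ge0 //.
  by rewrite -[leRHS]expr1 ler_wiXn2l.
apply: le_trans (ler_wpM2l _ (sum_half_mdeg N)) _; first by rewrite mulr_ge0.
have -> : C * t * 2 ^+ n = e * (C * 2 ^+ n) / D by rewrite tE; ring.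
by rewrite ler_pdivrMr // ler_wpM2l ?(ltW e0) // lerDr ltW.
Qed.

Lemma nrm_mmap1 r e N m : 0 <= r -> (forall i, nrm r N (g i) <= e) ->
  nrm r N (mmap1 g m) <= e ^+ mdeg m.
Proof.
move=> r0 He; rewrite mdegE expr_sum /mmap1.
apply: (big_ind2 (fun (a : cvps K n) b => nrm r N a <= b)) => [|a b c d ab cd|i _].
- exact: nrm1.
- by apply: le_trans (nrm_mul _ _ _ r0) _; apply: ler_pM => //; apply: nrm_ge0.
elim: (m i) => [|j IH]; first exact: nrm1.
by rewrite !exprS; apply: le_trans (nrm_mul _ _ _ r0) _; apply: ler_pM => //; apply: nrm_ge0.
Qed.

Lemma convergent_subst f : convergent (subst_coef f).
Proof.
have [e [M [e_gt0 HM]]] := cvpsP f.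
have [r [r_gt0 Hr]] := small_radius e_gt0.
have r_ge0 := ltW r_gt0.
exists r, M; split=> // N; apply: le_trans (HM N).
rewrite -/(nrm r N _) (@nrm_eq _ _ _ _ _ (partial_subst N f)); last first.
  by move=> m mN; apply: subst_coefE.
apply: le_trans (_ : \sum_(m : 'X_{1..k < N}) `|f m| * nrm r N (mmap1 g m) <= _).
  rewrite /nrm; under [leRHS]eq_bigr do rewrite mulr_sumr.
  rewrite exchange_big /=; apply: ler_sum => a _.
  under [leRHS]eq_bigr do rewrite mulrA.
  rewrite -mulr_suml ler_wpM2r ?exprn_ge0 // cvc_sum.
  apply: le_trans (ler_norm_sum _ _ _) _.
  by apply: ler_sum => m _; rewrite cvcZ normrM.
by apply: ler_sum => m _; rewrite ler_wpM2l // nrm_mmap1.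
Qed.

Definition subst_fun f : cvps K n := CVPS (convergent_subst f).

Lemma subst_funE N f : ordge N (subst_fun f - partial_subst N f).
Proof. by move=> a aN; rewrite cvcB /= (subst_coefE f aN) subrr. Qed.

Lemma subst_fun_eq f F : (forall N, ordge N (F - partial_subst N f)) -> subst_fun f = F.
Proof.
move=> H; apply/eqP; rewrite -subr_eq0; apply/eqP/ordge_eq0 => N a aN.
have := H N a aN; have := subst_funE f aN; rewrite !cvcB => E1 E2.
have -> : subst_fun f a = partial_subst N f a by apply/eqP; rewrite -subr_eq0 E1.
by rewrite -opprB E2 oppr0.
Qed.

(** The composed series are determined by congruences modulo all powers of the
maximal ideal, which reduces the morphism laws to the evaluation of
polynomials. *)
Theorem subst_exists :
  exists chi : {lrmorphism cvps K k -> cvps K n}, forall i, chi (cvX U_(i)) = g i.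
Proof.
have [|||chi Hchi] := @mk_lrmorphism K (cvps K k) (cvps K n) subst_fun.
- move=> c f f'; apply: subst_fun_eq => N.
  have -> : partial_subst N (c *: f + f') = c *: partial_subst N f + partial_subst N f'.
    rewrite /partial_subst scaler_sumr -big_split; apply: eq_bigr => m _ /=.
    by rewrite scalerDl scalerA.
  rewrite opprD addrACA -scalerBr; apply: ordgeD; last exact: subst_funE.
  exact/ordgeZ/subst_funE.
- move=> f f'; apply: subst_fun_eq => N.
  have H : ordge N (partial_subst N f * partial_subst N f' - partial_subst N (f * f')).
    rewrite !partial_substE -rmorphM -rmorphB; apply: mmap_ordge => m mN.
    by rewrite mcoeffB coef_trunc //= (ps_mul_trunc f f' mN) subrr.
  rewrite -(subrK (partial_subst N f * partial_subst N f') (_ * _)) -addrA.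
  apply: ordgeD => //.
  have -> (a b c d : cvps K n) : a * b - c * d = (a - c) * b + c * (b - d) by ring.
  apply: ordgeD.
    by apply: (@ordge_leq _ _ (N + 0)); [rewrite addn0 | apply: ordgeM => //; exact: subst_funE].
  by apply: (@ordge_leq _ _ (0 + N)); [rewrite add0n | apply: ordgeM => //; exact: subst_funE].
- apply: subst_fun_eq => -[|N]; first exact: ordge0.
  rewrite partial_substE.
  have -> : trunc N.+1 (1 : cvps K k) = 1.
    apply/mpolyP => m; rewrite mcoeff1.
    have [mN|Nm] := ltnP (mdeg m) N.+1; first by rewrite coef_trunc.
    rewrite /trunc raddf_sum /= big1 => [|m' _].
      by case: eqP Nm => // ->; rewrite mdeg0.
    rewrite mcoeffZ mcoeffX; case: eqP => [E|_]; last by rewrite mulr0.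
    by have := bmdeg m'; rewrite E ltnNge Nm.
  by rewrite rmorph1 subrr => m _; rewrite cvc0.
exists chi => i; rewrite Hchi; apply: subst_fun_eq => N.
have [N1|N1] := leqP N 1.
  apply: ordge_leq N1 _; apply/ordge1; rewrite cvcB g0 sub0r; apply/eqP; rewrite oppr_eq0.
  rewrite /partial_subst cvc_sum big1 // => m _; rewrite cvcZ cvcX.
  case: eqP => [<-|_]; rewrite ?mul0r // mmap1U g0 mulr0 //.
have UN : (mdeg (U_(i)%MM : 'X_{1..k}) < N)%N by rewrite mdeg1.
rewrite /partial_subst (bigD1 (BMultinom UN)) // cvcX eqxx scale1r mmap1U opprD addrA subrr.
rewrite sub0r big1 => [|m m1]; first by rewrite oppr0 => m _; rewrite cvc0.
rewrite cvcX; case: eqP => [E|_]; last by rewrite scale0r.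
by case/eqP: m1; apply: val_inj.
Qed.
End Substitution.

Section Splitting.
Context {K : numFieldType} {n : nat}.
Implicit Types (F : cvps K n) (m q : 'X_{1..n}).

(** Distributing the monomials of F over finitely many divisors x^(e i),
following a rule that picks a divisor for each monomial. All finite generation
statements below, and the expansion by residues of exponents, come from a
suitable rule. *)
Lemma cvps_split (I : finType) (e : I -> 'X_{1..n}) (pick : 'X_{1..n} -> option I) F :
  (forall m, F m != 0 -> exists2 i, pick m = Some i & (e i <= m)%MM) ->
  exists G : I -> cvps K n, F = \sum_i cvX (e i) * G i /\
    forall i q, G i q = if pick (e i + q)%MM == Some i then F (e i + q)%MM else 0.
Proof.
move=> He; have [C [r [r_gt0 C_ge0 HC]]] := cvps_geo F.
pose g i q := if pick (e i + q)%MM == Some i then F (e i + q)%MM else 0.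
have cg i : convergent (g i).
  apply/convergent_geo; exists (C * r ^+ mdeg (e i)), r.
  split=> // [|q]; first by rewrite mulr_ge0 // exprn_ge0 // ltW.
  rewrite -mulrA -exprD -mdegD /g; case: ifP => // _.
  by rewrite normr0 mulr_ge0 // exprn_ge0 // ltW.
exists (fun i => CVPS (cg i)); split=> //.
apply: cvps_inj => m; rewrite cvc_sum.
have term i : (cvX (e i) * CVPS (cg i)) m =
    if (pick m == Some i) && (e i <= m)%MM then F m else 0.
  rewrite cvcXM; case: (boolP (e i <= m)%MM) => em; last by rewrite andbF.
  by rewrite andbT /= /g addmC submK.
rewrite (eq_bigr _ (fun i _ => term i)).
have [F0|/He[i pi ei]] := eqVneq (F m) 0.
  by rewrite F0 big1 // => i _; case: ifP.
rewrite (bigD1 i) //= pi eqxx ei big1 ?addr0 // => j /negbTE ji.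
by case: eqP => // -[E]; rewrite E eqxx in ji.
Qed.

Lemma cvps_split_vars (V : pred 'I_n) F :
  (forall m, (forall i, V i -> m i = 0%N) -> F m = 0) ->
  exists G : 'I_n -> cvps K n, F = \sum_(i | V i) cvX U_(i) * G i /\
    forall i q, G i q = 0 \/ G i q = F (U_(i) + q)%MM.
Proof.
move=> FV.
pose pk (m : 'X_{1..n}) := [pick i | V i && (m i != 0%N)].
have [m Fm|G [EG HG]] := @cvps_split 'I_n (fun i => U_(i)%MM) pk F.
  rewrite /pk; case: pickP => [i /andP[Vi mi]|none].
    by exists i => //; rewrite lep1mP.
  case/eqP: Fm; apply: FV => i Vi; apply/eqP.
  by have := none i; rewrite Vi /= => /negbFE.
exists G; split; last by move=> i q; rewrite HG; case: ifP; [right|left].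
rewrite {1}EG [RHS]big_mkcond; apply: eq_bigr => i _; case: ifP => // Vi.
suff -> : G i = 0 by rewrite mulr0.
apply: cvps_inj => q; rewrite HG /pk; case: pickP => [j /andP[Vj _]|//].
by case: eqP => // -[E]; rewrite -E Vj in Vi.
Qed.

Lemma ordge_split N F : ordge N.+1 F ->
  exists G : 'I_n -> cvps K n, F = \sum_i cvX U_(i) * G i /\ forall i, ordge N (G i).
Proof.
move=> FN; have [m Hm|G [EG HG]] := @cvps_split_vars predT F.
  apply: FN; suff -> : m = 0%MM by rewrite mdeg0.
  by apply/mnmP => i; rewrite mnm0E Hm.
exists G; split=> // i q qN; have [->//|->] := HG i q.
by apply: FN; rewrite mdegD mdeg1.
Qed.

End Splitting.

Section Units.
Context {K : numFieldType} {n : nat}.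
Implicit Types (F : cvps K n).

(** The inverse is the geometric series, all of whose coefficients are 1. *)
Lemma geometric_inverse :
  exists G : cvps K 1, G * (1 - cvX U_(ord0)) = 1.
Proof.
have cg : convergent (fun _ : 'X_{1..1} => 1 : K).
  apply/convergent_geo; exists 1, 1; split=> // m.
  by rewrite normr1 expr1n mulr1.
exists (CVPS cg); apply: cvps_inj => m.
rewrite mulrBr mulr1 mulrC cvcB cvcXM cvc1 /= lep1mP -mdeg_eq0 mdegE big_ord1.
by case: (m ord0 == 0)%N; rewrite ?subr0 ?subrr.
Qed.

(** The inverse of F is expressed by a substitution in the geometric series,
which shows that its support stays in the monoid generated by that of F. *)
Lemma cvps_inverse_geometric F : F 0%MM != 0 ->
  exists (chi : {lrmorphism cvps K 1 -> cvps K n}) (G : cvps K 1),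
    (forall i, chi (cvX U_(i)) = 1 - (F 0%MM)^-1 *: F) /\
    F * ((F 0%MM)^-1 *: chi G) = 1.
Proof.
move=> F0; pose u : cvps K n := 1 - (F 0%MM)^-1 *: F.
have u0 (i : 'I_1) : u 0%MM = 0.
  by rewrite /u cvcB cvcZ cvc1 eqxx mulVf ?subrr.
have [chi Hchi] := subst_exists u0.
have [G HG] := geometric_inverse.
exists chi, G; split=> //.
rewrite -scalerAr scalerAl mulrC -[(F 0%MM)^-1 *: F](subKr 1) -/u.
by have := congr1 chi HG; rewrite lrM lrB !lr1 Hchi.
Qed.

End Units.

Section Morphisms.
Context {K : numFieldType} {k n : nat}.
Variable chi : {lrmorphism cvps K k -> cvps K n}.
Implicit Types (F : cvps K k).
Local Notation x := (fun i => chi (cvX U_(i))).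

(** A morphism of algebras is local: otherwise F - c, with c the constant term
of the image of F, would be a unit with a non-unit image. *)
Lemma lrm_const F : chi F 0%MM = F 0%MM.
Proof.
apply/eqP; rewrite eq_sym -subr_eq0; apply/negPn/negP => H.
set c := chi F 0%MM in H.
have F0 : (F - c%:A) 0%MM != 0 by rewrite cvcB cvc_alg eqxx mulr1.
have [psi [G [_]]] := cvps_inverse_geometric F0; move: (_ *: psi G) => F' /(congr1 chi).
rewrite lrM lrB lr_alg lr1 => /(congr1 (fun H : cvps K n => cvcoef H 0%MM)).
rewrite cvcM0 cvcB -/c cvc_alg cvc1 eqxx mulr1 subrr mul0r => /esym/eqP.
by rewrite oner_eq0.
Qed.

Lemma lrm_var0 i : chi (cvX U_(i)) 0%MM = 0.
Proof. by rewrite lrm_const cvcX mnm1_eq0. Qed.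

Lemma lrm_ordge N F : ordge N F -> ordge N (chi F).
Proof.
elim: N F => [|N IH] F; first by move=> _; apply: ordge0.
move=> /ordge_split[G [-> HG]]; rewrite lr_sum.
apply: ordge_sum => i _; rewrite lrM -add1n; apply: ordgeM; last exact: IH.
by apply/ordge1/lrm_var0.
Qed.

Lemma lrm_cvX m : chi (cvX m) = mmap1 x m.
Proof. by rewrite cvXE lr_prod; apply: eq_bigr => i _; rewrite lrXn. Qed.

(** Continuity of an abstract morphism of algebras for the topology of the
maximal ideal. *)
Lemma lrm_partial N F : ordge N (chi F - partial_subst x N F).
Proof.
have -> : partial_subst x N F = chi (\sum_(m : 'X_{1..k < N}) F m *: cvX m).
  by rewrite lr_sum; apply: eq_bigr => m _; rewrite lrZ lrm_cvX.
rewrite -lrB; apply: lrm_ordge => m mN; rewrite cvcB cvc_sum.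
rewrite (bigD1 (BMultinom mN)) // cvcZ cvcX eqxx mulr1 [X in _ - (_ + X)]big1.
  by rewrite addr0 subrr.
move=> m' mm'; rewrite cvcZ cvcX.
case: eqP => [E|_]; last by rewrite mulr0.
by case/eqP: mm'; apply: val_inj.
Qed.

Lemma lrm_coef N F a : (mdeg a < N)%N ->
  chi F a = \sum_(m : 'X_{1..k < N}) F m * mmap1 x m a.
Proof.
move=> aN; apply/eqP; rewrite -subr_eq0; apply/eqP.
have := lrm_partial F aN; rewrite cvcB cvc_sum => E; rewrite -[RHS]E.
by congr (_ - _); apply: eq_bigr => m _; rewrite cvcZ.
Qed.

End Morphisms.

Lemma lrm_ext (K : numFieldType) k n (chi chi' : {lrmorphism cvps K k -> cvps K n}) :
  (forall i, chi (cvX U_(i)) = chi' (cvX U_(i))) -> chi =1 chi'.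
Proof.
move=> E F; apply: cvps_inj => a; rewrite !(lrm_coef _ _ (ltnSn (mdeg a))).
by apply: eq_bigr => m _; rewrite (mmap1_eq m E).
Qed.

Definition supp_in (K : numFieldType) n (G : 'X_{1..n} -> Prop) (F : cvps K n) :=
  forall m, F m != 0 -> G m.

Section Support.
Context {K : numFieldType} {n : nat}.
Variable G : 'X_{1..n} -> Prop.
Implicit Types (F : cvps K n).

Lemma supp_inD F F' : supp_in G F -> supp_in G F' -> supp_in G (F + F').
Proof.
move=> H H' m; rewrite cvcD => Hm; have [F0|/H//] := eqVneq (F m) 0.
by apply: H'; rewrite F0 add0r in Hm.
Qed.

Lemma supp_inZ c F : supp_in G F -> supp_in G (c *: F).
Proof. by move=> GF m; rewrite cvcZ mulf_eq0 negb_or => /andP[_ /GF]. Qed.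

Lemma supp_inB F F' : supp_in G F -> supp_in G F' -> supp_in G (F - F').
Proof. by move=> H H'; apply: supp_inD => //; rewrite -scaleN1r; apply: supp_inZ. Qed.

Lemma supp_in0 : supp_in G (0 : cvps K n).
Proof. by move=> m; rewrite cvc0 eqxx. Qed.

Lemma supp_inX a : G a -> supp_in G (cvX a : cvps K n).
Proof. by move=> Ga m; rewrite cvcX; case: (a =P m) => [<-|]; rewrite ?eqxx. Qed.

Hypothesis G0 : G 0%MM.
Hypothesis GD : forall a b, G a -> G b -> G (a + b)%MM.

Lemma supp_inM F F' : supp_in G F -> supp_in G F' -> supp_in G (F * F').
Proof. by move=> H H' m /cvcM_neq0[a [b [-> /H Ha /H' Hb]]]; apply: GD. Qed.

Lemma supp_in1 : supp_in G (1 : cvps K n).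
Proof. by move=> m; rewrite cvc1; case: (m =P 0%MM) => [->|]; rewrite ?eqxx. Qed.

Lemma supp_inXn F j : supp_in G F -> supp_in G (F ^+ j).
Proof.
by move=> H; elim: j => [|j IH]; [exact: supp_in1 | rewrite exprS; apply: supp_inM].
Qed.

Lemma supp_in_lrm k (chi : {lrmorphism cvps K k -> cvps K n}) (F : cvps K k) :
  (forall i, supp_in G (chi (cvX U_(i)))) -> supp_in G (chi F).
Proof.
move=> H a; rewrite (lrm_coef _ _ (ltnSn _)) => /eqP Ha.
apply: contrapT => nG; apply: Ha; apply: big1 => m _.
have [->|ma] := eqVneq (mmap1 (fun i => chi (cvX U_(i))) m a) 0; first by rewrite mulr0.
case: nG; apply: (_ : supp_in G (mmap1 (fun i => chi (cvX U_(i))) m)) => //.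
apply: (big_ind (supp_in G)) => [|F1 F2|i _]; [exact: supp_in1|exact: supp_inM|].
exact: supp_inXn.
Qed.

Lemma cvps_inverse_supp F : F 0%MM != 0 -> supp_in G F ->
  exists2 F', F * F' = 1 & supp_in G F'.
Proof.
move=> F0 GF; have [chi [H [Hchi HF]]] := cvps_inverse_geometric F0.
eexists; [exact: HF | apply/supp_inZ/supp_in_lrm => i].
by rewrite Hchi; apply: supp_inB; [exact: supp_in1 | exact: supp_inZ].
Qed.
End Support.

Section Blocks.
Context {K : numFieldType} {n1 n2 : nat}.

Definition mnm_join (a : 'X_{1..n1}) (b : 'X_{1..n2}) : 'X_{1..n1 + n2} :=
  [multinom match split i with inl j => a j | inr j => b j end | i < n1 + n2].

Lemma mnm_join_l a b i : mnm_join a b (lshift n2 i) = a i.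
Proof. by rewrite mnmE (unsplitK (inl i)). Qed.
Lemma mnm_join_r a b i : mnm_join a b (rshift n1 i) = b i.
Proof. by rewrite mnmE (unsplitK (inr i)). Qed.
Lemma mnml_join a b : mnml (mnm_join a b) = a.
Proof. by apply/mnmP => i; rewrite mnmE mnm_join_l. Qed.
Lemma mnmr_join a b : mnmr (mnm_join a b) = b.
Proof. by apply/mnmP => i; rewrite mnmE mnm_join_r. Qed.
Lemma mnm_joinE a : a = mnm_join (mnml a) (mnmr a).
Proof. by apply: mnm_split_inj; rewrite ?mnml_join ?mnmr_join. Qed.

Lemma mnm_joinU_l i : mnm_join U_(i) 0 = U_(lshift n2 i)%MM.
Proof.
apply/mnmP => j; rewrite -(splitK j); case: (split j) => i' /=.
  by rewrite mnm_join_l !mnm1E eq_lshift.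
by rewrite mnm_join_r mnm1E mnm0E eq_lrshift.
Qed.
Lemma mnm_joinU_r i : mnm_join 0 U_(i) = U_(rshift n1 i)%MM.
Proof.
apply/mnmP => j; rewrite -(splitK j); case: (split j) => i' /=.
  by rewrite mnm_join_l mnm1E mnm0E eq_rlshift.
by rewrite mnm_join_r !mnm1E eq_rshift.
Qed.

Lemma mnm_join_sum_l (a : 'X_{1..n1}) :
  (\sum_i U_(lshift n2 i) *+ a i)%MM = mnm_join a 0.
Proof.
apply/mnmP => j; rewrite mnm_sumE -(splitK j).
case: (split j) => i /=; rewrite ?mnm_join_l ?mnm_join_r ?mnm0E.
  rewrite (bigD1 i) //= mulmnE mnm1E eqxx mul1n big1 ?addn0 // => i' ii'.
  by rewrite mulmnE mnm1E eq_lshift (negbTE ii').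
by rewrite big1 // => i' _; rewrite mulmnE mnm1E eq_lrshift.
Qed.

Lemma mnm_join_sum_r (b : 'X_{1..n2}) :
  (\sum_i U_(rshift n1 i) *+ b i)%MM = mnm_join 0 b.
Proof.
apply/mnmP => j; rewrite mnm_sumE -(splitK j).
case: (split j) => i /=; rewrite ?mnm_join_l ?mnm_join_r ?mnm0E.
  by rewrite big1 // => i' _; rewrite mulmnE mnm1E eq_rlshift.
rewrite (bigD1 i) //= mulmnE mnm1E eqxx mul1n big1 ?addn0 // => i' ii'.
by rewrite mulmnE mnm1E eq_rshift (negbTE ii').
Qed.

Lemma cvps_inl_lrm : exists chi : {lrmorphism cvps K n1 -> cvps K (n1 + n2)},
  chi =1 cvps_inl.
Proof.
have [|chi Hchi] := @subst_exists K n1 (n1 + n2) (fun i => cvX U_(lshift n2 i)).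
  by move=> i; rewrite cvcX mnm1_eq0.
exists chi => F; apply: cvps_inj => a; rewrite (lrm_coef _ _ (ltnSn _)).
have E m : mmap1 (fun i => chi (cvX U_(i))) m = cvX (mnm_join m 0%MM).
  rewrite (mmap1_eq m Hchi) /mmap1; under eq_bigr do rewrite cvXn.
  by rewrite cvX_sum mnm_join_sum_l.
rewrite /= /ps_inl; case: eqP => [a2|a2].
  have aN : (mdeg (mnml a) < (mdeg a).+1)%N by rewrite ltnS [leqRHS]mdeg_split leq_addr.
  rewrite (bigD1 (BMultinom aN)) //= E cvcX -{1}a2 -mnm_joinE eqxx mulr1.
  rewrite big1 ?addr0 // => m mm; rewrite E cvcX; case: eqP => [Em|]; last by rewrite mulr0.
  by case/eqP: mm; apply/val_inj/(etrans (esym (mnml_join m 0%MM)) (congr1 _ Em)).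
rewrite big1 // => m _; rewrite E cvcX; case: eqP => [Em|]; last by rewrite mulr0.
by case: a2; rewrite -Em mnmr_join.
Qed.

Lemma cvps_inr_lrm : exists chi : {lrmorphism cvps K n2 -> cvps K (n1 + n2)},
  chi =1 cvps_inr.
Proof.
have [|chi Hchi] := @subst_exists K n2 (n1 + n2) (fun i => cvX U_(rshift n1 i)).
  by move=> i; rewrite cvcX mnm1_eq0.
exists chi => F; apply: cvps_inj => a; rewrite (lrm_coef _ _ (ltnSn _)).
have E m : mmap1 (fun i => chi (cvX U_(i))) m = cvX (mnm_join 0%MM m).
  rewrite (mmap1_eq m Hchi) /mmap1; under eq_bigr do rewrite cvXn.
  by rewrite cvX_sum mnm_join_sum_r.
rewrite /= /ps_inr; case: eqP => [a2|a2].
  have aN : (mdeg (mnmr a) < (mdeg a).+1)%N by rewrite ltnS [leqRHS]mdeg_split leq_addl.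
  rewrite (bigD1 (BMultinom aN)) //= E cvcX -{1}a2 -mnm_joinE eqxx mulr1.
  rewrite big1 ?addr0 // => m mm; rewrite E cvcX; case: eqP => [Em|]; last by rewrite mulr0.
  by case/eqP: mm; apply/val_inj/(etrans (esym (mnmr_join 0%MM m)) (congr1 _ Em)).
rewrite big1 // => m _; rewrite E cvcX; case: eqP => [Em|]; last by rewrite mulr0.
by case: a2; rewrite -Em mnml_join.
Qed.

Lemma cvps_inl_X i : cvps_inl (cvX U_(i)) = cvX U_(lshift n2 i) :> cvps K (n1 + n2).
Proof.
apply: cvps_inj => m; rewrite cvcX /= /ps_inl mcoeffX -mnm_joinU_l.
case: (mnmr m =P 0%MM) => [mr|mr].
  congr (nat_of_bool _)%:R; apply/eqP/eqP => [->|<-]; last by rewrite mnml_join.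
  by rewrite -mr -mnm_joinE.
by case: eqP => // E; case: mr; rewrite -E mnmr_join.
Qed.

Lemma cvps_inr_X i : cvps_inr (cvX U_(i)) = cvX U_(rshift n1 i) :> cvps K (n1 + n2).
Proof.
apply: cvps_inj => m; rewrite cvcX /= /ps_inr mcoeffX -mnm_joinU_r.
case: (mnml m =P 0%MM) => [mr|mr].
  congr (nat_of_bool _)%:R; apply/eqP/eqP => [->|<-]; last by rewrite mnmr_join.
  by rewrite -mr -mnm_joinE.
by case: eqP => // E; case: mr; rewrite -E mnml_join.
Qed.
End Blocks.

Section Congruence.
Context {K : numFieldType} {k n : nat}.

Lemma cvps_left_restriction (Z : {lrmorphism cvps K (k + n) -> cvps K k}) :
  (forall i, Z (cvX U_(lshift n i)) = cvX U_(i)) ->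
  (forall i, Z (cvX U_(rshift k i)) = 0) ->
  forall F a, Z F a = F (mnm_join a 0).
Proof.
move=> Zl Zr F a; rewrite (lrm_coef _ _ (ltnSn _)).
have E m : mmap1 (fun i => Z (cvX U_(i))) m =
    if mnmr m == 0%MM then cvX (mnml m) else 0.
  rewrite /mmap1 big_split_ord /=.
  have -> : \prod_(i < k) Z (cvX U_(lshift n i)) ^+ m (lshift n i) = cvX (mnml m).
    by rewrite cvXE; apply: eq_bigr => i _; rewrite Zl mnmE.
  case: eqP => [m0|/eqP].
    rewrite big1 ?mulr1 // => i _; have /mnmP/(_ i) := m0.
    by rewrite mnmE mnm0E => ->; rewrite expr0.
  case: (pickP (fun i => mnmr m i != 0%N)) => [i|none]; last first.
    by case/eqP; apply/mnmP => i; have := none i; rewrite mnm0E => /negbFE/eqP.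
  rewrite mnmE => mi _.
  by rewrite (bigD1 i) //= Zr expr0n (negbTE mi) mul0r mulr0.
have aN : (mdeg (mnm_join a (0%MM : 'X_{1..n})) < (mdeg a).+1)%N.
  by rewrite mdeg_split mnml_join mnmr_join mdeg0 addn0.
rewrite (bigD1 (BMultinom aN)) //= E mnmr_join mnml_join eqxx cvcX eqxx mulr1.
rewrite big1 ?addr0 // => m ma; rewrite E; case: eqP => [mr|_]; last by rewrite cvc0 mulr0.
rewrite cvcX; case: (mnml m =P a) => [ml|_]; last by rewrite mulr0.
case/eqP: ma; apply: val_inj.
exact: (etrans (mnm_joinE m) (f_equal2 mnm_join ml mr)).
Qed.
End Congruence.

(** This is the substitute for continuity of morphisms to quotients of rings
of series: in the expansion of F(x + y) - F(x) every monomial contains some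
y_i. *)
Lemma lrm_congr (K : numFieldType) k n (chi chi' : {lrmorphism cvps K k -> cvps K n}) F :
  exists Q : 'I_k -> cvps K n,
    chi F - chi' F = \sum_i (chi (cvX U_(i)) - chi' (cvX U_(i))) * Q i.
Proof.
pose z (j : 'I_(k + k)) : cvps K k :=
  match split j with inl i => cvX U_(i) | inr i => 0 end.
have [|Z HZ] := @subst_exists _ _ _ z.
  by move=> j; rewrite /z; case: split => i; rewrite ?cvcX ?mnm1_eq0 ?cvc0.
have Zl i : Z (cvX U_(lshift k i)) = cvX U_(i) by rewrite HZ /z (unsplitK (inl i)).
have Zr i : Z (cvX U_(rshift k i)) = 0 by rewrite HZ /z (unsplitK (inr i)).
have [|T HT] := @subst_exists K k (k + k)
  (fun i => cvX U_(lshift k i) + cvX U_(rshift k i)).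
  by move=> i; rewrite cvcD !cvcX !mnm1_eq0 addr0.
have [L HL] := @cvps_inl_lrm K k k.
pose s (j : 'I_(k + k)) : cvps K n :=
  match split j with inl i => chi' (cvX U_(i))
                   | inr i => chi (cvX U_(i)) - chi' (cvX U_(i)) end.
have [|S HS] := @subst_exists _ _ _ s.
  by move=> j; rewrite /s; case: split => i; rewrite ?cvcB !lrm_var0 ?subrr.
have Sl i : S (cvX U_(lshift k i)) = chi' (cvX U_(i)) by rewrite HS /s (unsplitK (inl i)).
have Sr i : S (cvX U_(rshift k i)) = chi (cvX U_(i)) - chi' (cvX U_(i)).
  by rewrite HS /s (unsplitK (inr i)).
have ST : S \o T =1 chi.
  by apply: lrm_ext => i /=; rewrite HT lrD Sl Sr addrC subrK.
have SL : S \o L =1 chi' by apply: lrm_ext => i /=; rewrite HL cvps_inl_X Sl.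
have ZT : Z \o T =1 idfun by apply: lrm_ext => i /=; rewrite HT lrD Zl Zr addr0.
have ZL : Z \o L =1 idfun by apply: lrm_ext => i /=; rewrite HL cvps_inl_X Zl.
have [m m0|G [EG _]] := @cvps_split_vars K _
    [pred j | mnml (U_(j))%MM == (0%MM : 'X_{1..k})] (T F - L F).
  have mr : mnmr m = 0%MM.
    apply/mnmP => i; rewrite mnmE mnm0E; apply: m0 => /=; apply/eqP/mnmP => j.
    by rewrite mnmE mnm0E mnm1E eq_rlshift.
  rewrite (mnm_joinE m) mr -(cvps_left_restriction Zl Zr) lrB.
  by rewrite (ZT F : Z (T F) = F) (ZL F : Z (L F) = F) subrr.
exists (fun i => S (G (rshift k i))).
rewrite -(ST F) -(SL F) /= -lrB EG lr_sum big_split_ord /= big1.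
  rewrite Monoid.Theory.mul1m; apply: eq_big => i.
    by apply/eqP/mnmP => j; rewrite mnmE mnm0E mnm1E eq_rlshift.
  by move=> _; rewrite lrM Sr.
move=> i /eqP/mnmP/(_ i).
by rewrite mnmE mnm0E mnm1E eqxx.
Qed.

Section Residues.
Context {K : numFieldType} {n : nat}.
Variables (c N : nat).
Hypothesis N_gt0 : (0 < N)%N.

Definition residue (m : nat) := if (m < c)%N then m else (c + (m - c) %% N)%N.

Lemma residue_lt m : (residue m < c + N)%N.
Proof.
by rewrite /residue; case: (ltnP m c) => mc; have := ltn_pmod (m - c) N_gt0; move: (_ %% _)%N; lia. Qed.

Lemma residue_le m : (residue m <= m)%N.
Proof.
by rewrite /residue; case: (ltnP m c) => mc //; have := leq_mod (m - c) N; move: (_ %% _)%N; lia. Qed.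

Lemma residue_eq r q : residue (r + q) = r -> (N %| q)%N /\ (q = 0 \/ c <= r)%N.
Proof.
rewrite /residue; case: (ltnP (r + q) c) => rqc E.
  have -> : q = 0%N by lia.
  by split; [exact: dvdn0 | left].
have cr : (c <= r)%N by lia.
split; last by right.
have : (r - c + q)%N = r - c %[mod N].
  have -> : (r - c + q = r + q - c)%N by lia.
  by rewrite -(modn_mod (r + q - c)); congr (_ %% _)%N; lia.
by move/eqP; rewrite -[X in _ == X %[mod _]]addn0 eqn_modDl mod0n.
Qed.

Lemma power_map_coef (P : {lrmorphism cvps K n -> cvps K n}) :
  (forall i, P (cvX U_(i)) = cvX (U_(i) *+ N)) ->
  forall F a, P F a = if [forall i, N %| a i]%N
                      then F [multinom (a i %/ N)%N | i < n] else 0.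
Proof.
move=> HP F a; rewrite (lrm_coef _ _ (ltnSn _)).
have E m : mmap1 (fun i => P (cvX U_(i))) m = cvX (m *+ N).
  rewrite (mmap1_eq m HP) /mmap1; under eq_bigr do rewrite cvXn.
  rewrite cvX_sum; congr cvX; apply/mnmP => j; rewrite mnm_sumE mulmnE (bigD1 j) //=.
  rewrite !mulmnE mnm1E eqxx mul1n big1 ?addn0 1?mulnC // => i ij.
  by rewrite !mulmnE mnm1E (negbTE ij).
case: forallP => [Na|nNa]; last first.
  rewrite big1 // => m _; rewrite E cvcX; case: eqP => [Em|]; last by rewrite mulr0.
  by case: nNa => i; rewrite -Em mulmnE dvdn_mull.
set b := [multinom _ | i < n].
have bN : (mdeg b < (mdeg a).+1)%N.
  by rewrite ltnS !mdegE leq_sum // => i _; rewrite mnmE leq_div.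
have Eb : (b *+ N)%MM = a by apply/mnmP => i; rewrite mulmnE mnmE divnK.
rewrite (bigD1 (BMultinom bN)) //= E cvcX Eb eqxx mulr1 big1 ?addr0 // => m mb.
rewrite E cvcX; case: eqP => [Em|]; last by rewrite mulr0.
case/eqP: mb; apply/val_inj/mnmP => i /=.
have /mnmP/(_ i) := etrans Em (esym Eb); rewrite !mulmnE => /eqP.
by rewrite eqn_pmul2r // => /eqP.
Qed.

Definition residue_exp (r : {ffun 'I_n -> 'I_(c + N)}) : 'X_{1..n} :=
  [multinom (r i : nat) | i < n].

(** Sorting the monomials of F by the residues of their exponents modulo N.
Exponents below the threshold c are left alone, so that, when the part of
index r is nonzero, each r_i lies in every set of numbers that contains the
i-th exponents of F and all numbers >= c. *)
Lemma cvps_residues (P : {lrmorphism cvps K n -> cvps K n}) (F : cvps K n) :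
  (forall i, P (cvX U_(i)) = cvX (U_(i) *+ N)) ->
  exists G : {ffun 'I_n -> 'I_(c + N)} -> cvps K n,
    F = \sum_r cvX (residue_exp r) * P (G r) /\
    forall r q, G r q != 0 -> F (residue_exp r + q *+ N)%MM != 0 /\
      forall i, q i = 0%N \/ (c <= r i)%N.
Proof.
move=> HP; pose pick (m : 'X_{1..n}) := Some [ffun i => Ordinal (residue_lt (m i))].
have [m Fm|G [EG HG]] := @cvps_split K n _ residue_exp pick F.
  eexists; first by reflexivity.
  by apply/mnm_lepP => i; rewrite mnmE ffunE /= residue_le.
have pickE r q : pick (residue_exp r + q)%MM = Some r ->
    forall i, (N %| q i)%N /\ (q i = 0 \/ c <= r i)%N.
  move=> [/ffunP E] i; apply: residue_eq.
  by have := congr1 val (E i); rewrite ffunE /= mnmDE mnmE.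
have cG r : convergent (fun q => G r (q *+ N)%MM).
  have [C [s [s_gt0 C0 Hs]]] := cvps_geo (G r).
  apply/convergent_geo; exists C, (s ^+ N); split=> // [|q]; first by rewrite exprn_gt0.
  by apply: le_trans (Hs _) _; rewrite mdegMn -exprM mulnC.
exists (fun r => CVPS (cG r)); split=> [|r q /=].
  rewrite [LHS]EG; apply: eq_bigr => r _; congr (_ * _); apply: cvps_inj => a.
  rewrite (power_map_coef HP); case: forallP => [Na|nNa] /=.
    by congr (G r _); apply/mnmP => i; rewrite mulmnE mnmE divnK.
  rewrite HG; case: (_ =P Some r) => // /pickE H; case: nNa => i.
  by case: (H i).
rewrite HG; case: (_ =P Some r) => [/pickE H Fq|_]; last by rewrite eqxx.
split=> // i; have [_ [qi|]] := H i; [left|by right].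
by move/eqP: qi; rewrite mulmnE muln_eq0 (gtn_eqF N_gt0) orbF => /eqP.
Qed.
End Residues.

(** * Leading monomials, division and normality *)

Section Lead.
Context {K : numFieldType} {n : nat}.
Implicit Types (F G H Q R : cvps K n) (m a : 'X_{1..n}).

Definition is_lead F a := F a != 0 /\ forall m, F m != 0 -> (a <= m)%O.

Lemma lead_exists F : F != 0 -> exists a, is_lead F a.
Proof.
move=> F0; have [m Fm] : exists m, F m != 0.
  apply: contrapT => none; case/eqP: F0; apply: cvps_inj => m; apply/eqP.
  by apply/negPn/negP => Fm; apply: none; exists m.
move: m Fm; apply: (@ltmwf n) => m IH Fm.
have [[m' [m'm Fm']]|none] := pselect (exists m', (m' < m)%O /\ F m' != 0).
  exact: IH Fm'.
exists m; split=> // m' Fm'; rewrite leNgt; apply/negP => m'm.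
by apply: none; exists m'.
Qed.

Lemma lead_neq0 F a : is_lead F a -> F != 0.
Proof. by move=> [Fa _]; apply: contraNneq Fa => ->. Qed.

Lemma lead_mul F G a b : is_lead F a -> is_lead G b -> is_lead (F * G) (a + b)%MM.
Proof.
move=> [Fa HF] [Gb HG]; split=> [|m /cvcM_neq0[k [l [-> /HF ak /HG bl]]]]; last exact: lem_add.
have ab : (mdeg a < (mdeg (a + b)).+1)%N by rewrite ltnS mdegD leq_addr.
have ba : (mdeg b < (mdeg (a + b)).+1)%N by rewrite ltnS mdegD leq_addl.
rewrite cvcM (bigD1 (BMultinom ab, BMultinom ba)) //= big1 ?addr0 ?mulf_neq0 //.
move=> [k l] /= /andP[/eqP E kl].
have [->|Fk] := eqVneq (F k) 0; first by rewrite mul0r.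
have [->|Gl] := eqVneq (G l) 0; first by rewrite mulr0.
have ak := HF _ Fk; have bl := HG _ Gl.
case/eqP: kl; have ak' : a = k.
  apply/eqP; rewrite eq_le ak /= leNgt; apply/negP => lt_ak.
  by have := ltmc_le_add lt_ak bl; rewrite -E ltxx.
congr pair; apply: val_inj => //=.
apply: (@addmI _ a).
exact: (esym (etrans E (congr1 (fun z => z + l)%MM (esym ak')))).
Qed.

Lemma lead1 : is_lead 1 0%MM.
Proof.
by split=> [|m _]; rewrite ?le0m // cvc1 eqxx oner_neq0.
Qed.

Lemma lead_exp F a j : is_lead F a -> is_lead (F ^+ j) (a *+ j)%MM.
Proof.
move=> Fa; elim: j => [|j IH]; first by rewrite expr0 mulm0n; apply: lead1.
by rewrite exprS mulmS; apply: lead_mul.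
Qed.

Lemma cvps_mul_eq0 F G : F * G = 0 -> F = 0 \/ G = 0.
Proof.
have [->|/lead_exists[a Fa]] := eqVneq F 0; first by left.
have [->|/lead_exists[b Gb]] := eqVneq G 0; first by right.
by move=> E; have /lead_neq0 := lead_mul Fa Gb; rewrite E eqxx.
Qed.

Lemma cvps_mulI F : F != 0 -> injective ( *%R F).
Proof.
move=> F0 G H /eqP; rewrite -subr_eq0 -mulrBr => /eqP/cvps_mul_eq0[E|/eqP].
  by rewrite E eqxx in F0.
by rewrite subr_eq0 => /eqP.
Qed.
End Lead.

(** An exponent a that is minimal in the degree-lexicographic order on some
set is also minimal there for one positive integral weight. The weight of x_i
is a power of mdeg a + 1, decreasing with i to imitate the lexicographic
order, plus a term D large enough to give priority to the degree. Weights,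
unlike the order, yield estimates, on the polydiscs of radii s^(weight of
x_i). *)
Section Weight.
Context {n : nat}.
Variable a : 'X_{1..n}.
Let L := mdeg a.
Let D := (L * L.+1 ^ n).+1.

Definition weight (m : 'X_{1..n}) : nat := (\sum_i m i * (D + L.+1 ^ (n - i)))%N.

Lemma weightE m : weight m = (D * mdeg m + \sum_i m i * L.+1 ^ (n - i))%N.
Proof.
rewrite /weight mdegE big_distrr -big_split; apply: eq_bigr => i _ /=.
by rewrite mulnDr [(D * _)%N]mulnC.
Qed.

Lemma weightD m m' : weight (m + m')%MM = (weight m + weight m')%N.
Proof. by rewrite -big_split; apply: eq_bigr => i _ /=; rewrite mnmDE mulnDl. Qed.

Lemma mdeg_le_weight m : (mdeg m <= weight m)%N.
Proof. by rewrite weightE mulSn; lia. Qed.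

Definition weight_slope : nat := (D + L.+1 ^ n)%N.

Lemma weight_le_mdeg m : (weight m <= weight_slope * mdeg m)%N.
Proof.
rewrite /weight_slope mdegE big_distrr; apply: leq_sum => i _ /=.
by rewrite mulnC leq_mul2r leq_add2l leq_pexp2l ?leq_subr ?orbT.
Qed.

Lemma weight_lt m : (a < m)%O -> (weight a < weight m)%N.
Proof.
move=> am; have := lemc_mdeg (ltW am); rewrite leq_eqVlt => /orP[/eqP E|].
  have /(ltmcP E)[i Hi ai] := am.
  rewrite !weightE E ltn_add2l.
  rewrite (bigID (fun j : 'I_n => (j < i)%N)) [ltnRHS](bigID (fun j : 'I_n => (j < i)%N)) /=.
  rewrite (eq_bigr (fun j : 'I_n => m j * L.+1 ^ (n - j)))%N; last by move=> j /Hi ->.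
  rewrite ltn_add2l (bigD1 i) ?ltnn //= [ltnRHS](bigD1 i) ?ltnn //=.
  apply: leq_trans (leq_addr _ _).
  apply: leq_trans (_ : (a i).+1 * L.+1 ^ (n - i) <= _)%N; last by rewrite leq_mul2r ai orbT.
  rewrite mulSnr ltn_add2l.
  apply: leq_ltn_trans (_ : L * L.+1 ^ (n - i).-1 < _)%N; last first.
    have : (0 < n - i)%N by rewrite subn_gt0.
    by case: (n - i)%N => // k _; rewrite expnS ltn_mul2r expn_gt0 ltnSn.
  apply: leq_trans (_ : \sum_(j < n | ~~ (j < i)%N && (j != i)) a j * L.+1 ^ (n - i).-1 <= _)%N.
    apply: leq_sum => j /andP[]; rewrite -leqNgt => ij ji.
    rewrite leq_mul2l leq_pexp2l ?orbT // -subnS leq_sub2l // ltn_neqAle ij andbT.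
    by apply: contra_neq ji => /val_inj.
  rewrite -big_distrl leq_mul2r; apply/orP; right.
  by rewrite /L mdegE [leqRHS](bigID (fun j : 'I_n => ~~ (j < i)%N && (j != i))) leq_addr.
rewrite -/L => Lm; apply: leq_ltn_trans (_ : D * L + L * L.+1 ^ n < _)%N.
  rewrite weightE leq_add2l /L mdegE big_distrl; apply: leq_sum => i _ /=.
  by rewrite leq_mul2l leq_pexp2l ?leq_subr ?orbT.
rewrite weightE; apply: leq_trans (leq_addr _ _).
by apply: leq_trans (_ : D * L.+1 <= _)%N; rewrite ?leq_mul2l ?Lm ?orbT // mulnS /D; lia.
Qed.
End Weight.

Section Division.
Context {K : numFieldType} {n : nat}.
Implicit Types (F G H Q R : cvps K n) (m a b : 'X_{1..n}).

Section Recursion.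
Variables (a : 'X_{1..n}) (F H : cvps K n).
Hypothesis Ha : forall m, H m != 0 -> (a < m)%O.
Local Notation w := (weight a).

(** For G = x^a + H with leading monomial x^a, the quotient Q solves Q(b) =
F(b + a) - (H Q)(b + a). The right-hand side involves Q only at weights
smaller than that of b, so that iteration from 0 becomes stationary at every
b. *)
Fixpoint quot_approx (t : nat) : 'X_{1..n} -> K :=
  if t is t'.+1 then fun b => F (b + a)%MM - ps_mul H (quot_approx t') (b + a)%MM
  else fun=> 0.

Definition quot_coef b := quot_approx (w b).+1 b.

Lemma weight_split k1 k2 b : (b + a)%MM = (k1 + k2)%MM -> H k1 != 0 -> (w k2 < w b)%N.
Proof.
move=> E /Ha/weight_lt lt1.
by have := congr1 (weight a) E; rewrite !weightD; move: lt1; lia.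
Qed.

Lemma ps_mul_local (q q' : 'X_{1..n} -> K) b :
  (forall b', (w b' < w b)%N -> q b' = q' b') ->
  ps_mul H q (b + a)%MM = ps_mul H q' (b + a)%MM.
Proof.
move=> E; apply: eq_bigr => -[k1 k2] /= /eqP Ek.
have [->|H1] := eqVneq (H k1) 0; first by rewrite !mul0r.
by rewrite E //; apply: weight_split Ek H1.
Qed.

Lemma quot_approx_stable t t' b : (w b < t)%N -> (w b < t')%N ->
  quot_approx t b = quot_approx t' b.
Proof.
elim: t t' b => // t IH [//|t'] b /= bt bt'; congr (_ - _).
by apply: ps_mul_local => b' b'b; apply: IH; apply: leq_trans b'b _.
Qed.

Lemma quot_coefE b : quot_coef b = F (b + a)%MM - ps_mul H quot_coef (b + a)%MM.
Proof.
rewrite {1}/quot_coef /=; congr (_ - _); apply: ps_mul_local => b' b'b.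
by apply: quot_approx_stable.
Qed.

(** On the polydiscs of radii s^(weight of x_i), the series H is small
compared with the monomial x^a for s small, since all its monomials have
larger weight. *)
Lemma division_radius : exists s C : K, [/\ 0 < s, s <= 1, 0 <= C,
  forall m, `|F m| * s ^+ w m <= C &
  forall N, \sum_(m : 'X_{1..n < N}) `|H m| * s ^+ w m <= 2^-1 * s ^+ w a].
Proof.
have [C1 [r1 [r1_gt0 C1_ge0 H1]]] := cvps_geo F.
have [C2 [r2 [r2_gt0 C2_ge0 H2]]] := cvps_geo H.
pose r := r1 + r2; have r_gt0 : 0 < r by rewrite addr_gt0.
have t_gt0 : 0 < 1 + 2 * r by rewrite addr_gt0 // mulr_gt0.
(* The radius is s = s0 d: the factor s0 makes the sums of F and H converge, and
   d, gained once because the weights of H exceed that of x^a, makes that of H small. *)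
have [s0 s0E] : {s0 | s0 = (1 + 2 * r)^-1} by eexists.
have s0_gt0 : 0 < s0 by rewrite s0E invr_gt0.
have s0_le1 : s0 <= 1 by rewrite s0E invf_le1 // lerDl mulr_ge0 // ltW.
have rs0 : 2 * r * s0 <= 1.
  by rewrite s0E ler_pdivrMr // mul1r lerDr.
have [M ME] : {M | M = C2 * 2 ^+ n / s0 ^+ w a} by eexists.
have M_ge0 : 0 <= M by rewrite ME divr_ge0 ?mulr_ge0 ?exprn_ge0 // ltW.
have [d dE] : {d | d = (1 + 2 * M)^-1} by eexists.
have d1_gt0 : 0 < 1 + 2 * M by rewrite ltr_wpDr // mulr_ge0.
have d_gt0 : 0 < d by rewrite dE invr_gt0.
have d_le1 : d <= 1 by rewrite dE invf_le1 // lerDl mulr_ge0.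
have dM : M * d <= 2^-1.
  rewrite dE ler_pdivrMr //.
  have -> : 2^-1 * (1 + 2 * M) = 2^-1 + M by field.
  by rewrite lerDr invr_ge0.
have s_le : s0 * d <= s0 by rewrite ler_piMr // ltW.
exists (s0 * d), C1; split=> //.
- by rewrite mulr_gt0.
- exact: le_trans s_le s0_le1.
- move=> m; apply: le_trans (_ : C1 * (r1 * s0) ^+ mdeg m <= _).
    rewrite [X in _ <= _ * X]exprMn mulrA; apply: ler_pM => //.
      by rewrite exprn_ge0 // mulr_ge0 // ltW.
    apply: le_trans (_ : s0 ^+ w m <= _); first by rewrite lerXn2r ?nnegrE ?mulr_ge0 // ltW.
    by rewrite ler_wiXn2l ?mdeg_le_weight // ltW.
  rewrite ler_piMr // exprn_ile1 // ?mulr_ge0 ?(ltW r1_gt0) ?(ltW s0_gt0) //.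
  apply: le_trans rs0; rewrite ler_wpM2r ?(ltW s0_gt0) // /r mulrDr mulrDl mul1r.
  by rewrite -addrA lerDl addr_ge0 // ?mulr_ge0 // ltW.
move=> N.
apply: le_trans (_ : (s0 * d) ^+ w a * (C2 / s0 ^+ w a * d) *
    \sum_(m : 'X_{1..n < N}) 2^-1 ^+ mdeg m <= _); last first.
  rewrite [leRHS]mulrC -mulrA ler_wpM2l ?exprn_ge0 ?mulr_ge0 ?(ltW s0_gt0) ?(ltW d_gt0) //.
  apply: le_trans dM; rewrite ME.
  have -> : C2 * 2 ^+ n / s0 ^+ w a * d = C2 / s0 ^+ w a * d * 2 ^+ n by ring.
  by rewrite ler_wpM2l ?sum_half_mdeg // mulr_ge0 ?divr_ge0 ?exprn_ge0 // ltW.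
rewrite mulr_sumr; apply: ler_sum => m _.
have [->|Hm] := eqVneq (H m) 0.
  rewrite normr0 mul0r mulr_ge0 ?exprn_ge0 ?invr_ge0 //.
  by rewrite !mulr_ge0 ?exprn_ge0 ?invr_ge0 ?mulr_ge0 ?exprn_ge0 // ltW.
have wam := weight_lt (Ha Hm).
have [j Ej] : exists j, w m = (w a + j.+1)%N.
  by exists (w m - w a).-1; rewrite prednK ?subn_gt0 // subnKC // ltnW.
have -> : (s0 * d) ^+ w m = (s0 * d) ^+ w a * (s0 ^+ w m / s0 ^+ w a * d ^+ j.+1).
  rewrite Ej !exprD !exprMn; field.
  by rewrite expf_neq0 // gt_eqF.
rewrite mulrCA -[leRHS]mulrA ler_wpM2l ?exprn_ge0 ?mulr_ge0 ?(ltW s0_gt0) ?(ltW d_gt0) //.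
have -> : C2 / s0 ^+ w a * d * 2^-1 ^+ mdeg m = C2 * 2^-1 ^+ mdeg m / s0 ^+ w a * d by ring.
rewrite mulrA; apply: ler_pM; rewrite ?exprn_ge0 ?(ltW d_gt0) //.
- by rewrite mulr_ge0 // divr_ge0 ?exprn_ge0 // ltW.
- rewrite mulrA ler_wpM2r ?invr_ge0 ?exprn_ge0 ?(ltW s0_gt0) //.
  apply: le_trans (_ : C2 * r2 ^+ mdeg m * s0 ^+ mdeg m <= _).
    apply: ler_pM => //; first by rewrite exprn_ge0 // ltW.
    by rewrite ler_wiXn2l ?mdeg_le_weight // ltW.
  rewrite -mulrA -exprMn ler_wpM2l // lerXn2r ?nnegrE ?mulr_ge0 ?invr_ge0
    ?(ltW r2_gt0) ?(ltW s0_gt0) //.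
  rewrite -[leRHS]mul1r ler_pdivlMr // mulrC; apply: le_trans rs0.
  by rewrite -mulrA ler_wpM2l // ler_wpM2r ?(ltW s0_gt0) // /r lerDr ltW.
by rewrite exprS ler_piMr ?(ltW d_gt0) // exprn_ile1 // ltW.
Qed.

(** By induction on the weight of b, the coefficient of Q at b is bounded by
C' / s^(weight of b): half of C' is used for F, and the other half for H Q. *)
Lemma convergent_quot : convergent quot_coef.
Proof.
have [s [C [s_gt0 s_le1 C_ge0 HF HH]]] := division_radius.
have sa_gt0 : 0 < s ^+ w a by rewrite exprn_gt0.
have [C' C'E] : {C' | C' = 2 * C / s ^+ w a} by eexists.
have C'_ge0 : 0 <= C' by rewrite C'E divr_ge0 ?mulr_ge0 // ltW.
have key b : `|quot_coef b| * s ^+ w b <= C'.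
  have [t] := ubnP (w b); elim: t b => // t IH b; rewrite ltnS => bt.
  rewrite quot_coefE -(ler_pM2r sa_gt0) -mulrA -exprD -weightD.
  apply: le_trans (ler_wpM2r _ (ler_normB _ _)) _; first by rewrite exprn_ge0 // ltW.
  have -> : C' * s ^+ w a = C + C' * (2^-1 * s ^+ w a).
    by rewrite C'E; field; rewrite gt_eqF.
  rewrite mulrDl; apply: lerD; first exact: HF.
  apply: le_trans (ler_wpM2r _ (ler_norm_sum _ _ _)) _; first by rewrite exprn_ge0 // ltW.
  set N := (mdeg (b + a)).+1; apply: le_trans (ler_wpM2l C'_ge0 (HH N)).
  rewrite mulr_suml mulr_sumr.
  rewrite -(pair_big_dep xpredT (fun k1 k2 : 'X_{1..n < N} => (b + a)%MM == (k1 + k2)%MM)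
    (fun k1 k2 : 'X_{1..n < N} => `|H k1 * quot_coef k2| * s ^+ w (b + a)%MM)) /=.
  apply: ler_sum => k1 _.
  have [[k2 Ek]|none] := pselect (exists k2 : 'X_{1..n < N}, (b + a = k1 + k2)%MM); last first.
    rewrite big1 => [|k2 /eqP Ek]; last by case: none; exists k2.
    by rewrite mulr_ge0 // mulr_ge0 // exprn_ge0 // ltW.
  rewrite (big_pred1 k2) => [|k3 /=]; last by rewrite Ek eqm_add2l eq_sym.
  have [->|Hk1] := eqVneq (H k1) 0.
    by rewrite mul0r normr0 !mul0r mulr0.
  rewrite Ek weightD exprD normrM mulrACA [leRHS]mulrC ler_wpM2l //.
    by rewrite mulr_ge0 // exprn_ge0 // ltW.
  by apply: IH; apply: leq_trans (weight_split Ek Hk1) bt.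
apply/convergent_geo; exists C', (s^-1 ^+ weight_slope a); split; rewrite ?exprn_gt0 ?invr_gt0 // => b.
rewrite -exprM; apply: le_trans (_ : C' * s^-1 ^+ w b <= _).
  by rewrite exprVn ler_pdivlMr ?exprn_gt0 ?key.
rewrite ler_wpM2l // ler_weXn2l ?weight_le_mdeg //.
by rewrite -[leLHS]invr1 lef_pV2 ?posrE.
Qed.
End Recursion.

Lemma cvps_division F G a : is_lead G a ->
  exists Q, forall m, (a <= m)%MM -> (F - G * Q) m = 0.
Proof.
move=> [Ga HG]; pose H := (G a)^-1 *: G - cvX a.
have Ha m : H m != 0 -> (a < m)%O.
  rewrite cvcB cvcZ cvcX lt_neqAle; case: (a =P m) => [<-|_] /=.
    by rewrite mulVf ?subrr ?eqxx.
  by rewrite subr0 mulf_eq0 negb_or => /andP[_ /HG].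
pose q : cvps K n := CVPS (convergent_quot F Ha).
exists ((G a)^-1 *: q) => m am; rewrite -scalerAr scalerAl.
have -> : (G a)^-1 *: G = cvX a + H by rewrite addrC subrK.
have Eq : q (m - a)%MM = F m - (H * q) m.
  by rewrite /= (quot_coefE F Ha) submK.
by rewrite mulrDl cvcB cvcD cvcXM am Eq subrK subrr.
Qed.

(** Normality, for fractions F/G all of whose powers have a common denominator
H. The remainder S of F divided by G has the same property. If S had a leading
exponent r, then h + j r >= j a for all j, where h and a are the leading
exponents of H and G; hence r >= a, although S has no such monomial. *)
Theorem cvps_almost_integral F G H : G != 0 -> H != 0 ->
  (forall j, exists R, H * F ^+ j = G ^+ j * R) -> exists Q, F = G * Q.
Proof.
move=> /lead_exists[a Ga] H0 AI.
have [Q HQ] := cvps_division F Ga; exists Q; apply/eqP; rewrite -subr_eq0.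
apply/negPn/negP; set S := F - G * Q in HQ * => S0.
have {}AI j : exists R, H * S ^+ j = G ^+ j * R.
  have /choice[T HT] := AI.
  exists (\sum_(i < j.+1) (- Q) ^+ i *+ 'C(j, i) * T (j - i)%N).
  rewrite /S -mulrN exprDn !mulr_sumr; apply: eq_bigr => i _.
  rewrite mulrnAl !mulrnAr; congr (_ *+ _).
  rewrite exprMn [LHS]mulrA HT.
  have -> : G ^+ j = G ^+ (j - i) * G ^+ i by rewrite -exprD subnK // -ltnS.
  ring.
have [h Hh] := lead_exists H0; have [r Sr] := lead_exists S0.
(* if r i < a i, the equality h + j r = j a + t fails at i for j = h i + 1 *)
have [ar|] := boolP (a <= r)%MM; first by have [] := Sr; rewrite HQ ?eqxx.
move/mnm_lepP => nar; apply: nar => i; rewrite leqNgt; apply/negP => ri.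
have [T ET] := AI (h i).+1.
have HS := lead_mul Hh (lead_exp (h i).+1 Sr).
have T0 : T != 0 by apply: contraTneq (lead_neq0 HS) => T0; rewrite ET T0 mulr0 eqxx.
have [t Tt] := lead_exists T0.
have GT := lead_mul (lead_exp (h i).+1 Ga) Tt.
have E : (h + r *+ (h i).+1 = a *+ (h i).+1 + t)%MM.
  rewrite ET in HS; apply/eqP; rewrite eq_le.
  by rewrite (HS.2 _ GT.1) (GT.2 _ HS.1).
have /mnmP/(_ i) := E; rewrite !mnmDE !mulmnE.
have : ((r i).+1 * (h i).+1 <= a i * (h i).+1)%N by rewrite leq_mul2r ri orbT.
by rewrite mulSn; lia.
Qed.
End Division.

(** * Integral closure of ideals *)

Section Ideals.
Context {T : comNzRingType}.
Implicit Types (G I J : set T).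
Local Open Scope classical_set_scope.

Definition is_ideal J := [/\ J 0, forall x y, J x -> J y -> J (x + y) &
  forall a x, J x -> J (a * x)].

Lemma ideal_span_is_ideal G : is_ideal (ideal_span G).
Proof.
split=> [|x y [k [a [g [Gg ->]]]] [l [b [h [Gh ->]]]]|c x [k [a [g [Gg ->]]]]].
- by exists 0%N, (fun=> 0), (fun=> 0); split=> [[]//|]; rewrite big_ord0.
- exists (k + l)%N, (fun i => match split i with inl j => a j | inr j => b j end),
    (fun i => match split i with inl j => g j | inr j => h j end); split.
    by move=> i; case: split.
  rewrite big_split_ord /=; congr (_ + _); apply: eq_bigr => i _.
    by rewrite (unsplitK (inl i)).
  by rewrite (unsplitK (inr i)).
- exists k, (fun i => c * a i), g; split=> //.
  by rewrite mulr_sumr; apply: eq_bigr => i _; rewrite mulrA.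
Qed.

Lemma ideal_span_mem G x : G x -> ideal_span G x.
Proof.
move=> Gx; exists 1%N, (fun=> 1), (fun=> x); split=> //.
by rewrite big_ord1 mul1r.
Qed.

Lemma is_ideal_sum J (K : Type) (s : seq K) (P : pred K) (F : K -> T) :
  is_ideal J -> (forall i, P i -> J (F i)) -> J (\sum_(i <- s | P i) F i).
Proof. by move=> [J0 JD _] H; apply: (big_ind J). Qed.

Lemma ideal_span_min G J : is_ideal J -> (forall x, G x -> J x) ->
  forall x, ideal_span G x -> J x.
Proof.
move=> Jid H x [k [a [g [Gg ->]]]]; apply: is_ideal_sum => // i _.
by case: Jid => _ _; apply; apply: H.
Qed.

Lemma ideal_exp_is_ideal I k : is_ideal (ideal_exp I k).
Proof. by case: k => [|k]; [split | exact: ideal_span_is_ideal]. Qed.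

Lemma ideal_expM I i j x y :
  ideal_exp I i x -> ideal_exp I j y -> ideal_exp I (i + j) (x * y).
Proof.
elim: i x => [|i IH] x.
  by move=> _ Hy; have [_ _] := ideal_exp_is_ideal I j; apply.
move=> [k [a [g [Gg ->]]]] Hy; rewrite mulr_suml.
apply: is_ideal_sum; first exact: ideal_exp_is_ideal.
move=> l _; have [u Iu [v Iv <-]] := Gg l.
rewrite -mulrA; have [_ _] := ideal_exp_is_ideal I (i.+1 + j); apply.
by apply: ideal_span_mem; exists u => //; exists (v * y); [exact: IH | rewrite mulrA].
Qed.

Lemma ideal_exp1 I x : I x -> ideal_exp I 1 x.
Proof. by move=> Ix; apply: ideal_span_mem; exists x => //; exists 1; rewrite ?mulr1. Qed.

Lemma is_idealN J x : is_ideal J -> J x -> J (- x).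
Proof. by move=> [_ _ JM] Jx; rewrite -mulN1r; apply: JM. Qed.

End Ideals.

(** An element h is integral over the ideal I when h 'X is integral over the
Rees algebra, the ring of polynomials whose coefficient of 'X^i lies in the
i-th power of I. So the closure properties of the integral closure of an ideal
follow from those of integral elements of a ring. *)
Section Rees.
Context {T : comNzRingType} (I : set T).

Definition rees_pred : pred {poly T} := fun p => `[< forall i, ideal_exp I i p`_i >].

Lemma rees_predP (p : {poly T}) : reflect (forall i, ideal_exp I i p`_i) (p \in rees_pred).
Proof. exact: asboolP. Qed.

Lemma rees_subring_closed : subring_closed rees_pred.
Proof.
split=> [|p q /rees_predP Hp /rees_predP Hq|p q /rees_predP Hp /rees_predP Hq].
- apply/rees_predP => i; rewrite coef1; case: eqP => [->//|_].
  by case: (ideal_exp_is_ideal I i).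
- apply/rees_predP => i; rewrite coefB.
  have id := ideal_exp_is_ideal I i; have [_ ID _] := id.
  by apply: ID => //; apply: is_idealN.
- apply/rees_predP => i; rewrite coefM; apply: is_ideal_sum; first exact: ideal_exp_is_ideal.
  by move=> j _; rewrite -{1}(subnKC (ltn_ord j : j <= i)%N); apply: ideal_expM.
Qed.

HB.instance Definition _ := GRing.isSubringClosed.Build {poly T} rees_pred
  rees_subring_closed.

Record rees := Rees { rees_val :> {poly T}; rees_valP : rees_val \in rees_pred }.
HB.instance Definition _ := [isSub for rees_val].
HB.instance Definition _ := [Choice of rees by <:].
HB.instance Definition _ := [SubChoice_isSubComNzRing of rees by <:].

Definition rees_incl : {rmorphism rees -> {poly T}} := val.

Definition rees_integral (h : T) := integralOver rees_incl (h *: 'X).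

Let rees_int (p : {poly T}) := integralOver rees_incl p.

(** The coefficient of 'X^k in an integral equation of degree k for h 'X. *)
Lemma rees_integral_closure h : rees_integral h -> integral_closure I h.
Proof.
move=> [p mon_p].
set k := (size p).-1; have sp : size p = k.+1.
  by rewrite prednK // lt0n size_poly_eq0 monic_neq0.
move=> /rootP; rewrite horner_coef => E.
have size_mp : (size (map_poly rees_incl p) <= k.+1)%N.
  by rewrite -sp; apply: size_poly.
have cE : \sum_(i < k.+1) (rees_incl p`_i)`_(k - i) * h ^+ i = 0.
  have := congr1 (fun q : {poly T} => q`_k) E; rewrite coef0 coef_sum => E0; rewrite -[RHS]E0.
  rewrite [RHS](_ : _ = \sum_(i < k.+1) ((rees_incl p`_i) * (h *: 'X) ^+ i)`_k).
    apply: eq_bigr => i _; rewrite exprZn -scalerAr coefZ coefMXn mulrC.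
    by rewrite ltnNge -ltnS ltn_ord.
  rewrite (big_ord_widen k.+1 (fun i => ((map_poly rees_incl p)`_i
    * (h *: 'X) ^+ i)`_k) size_mp) big_mkcond.
  apply: eq_bigr => i _; rewrite coef_map_id0 //; case: ltnP => // /leq_sizeP/(_ i (leqnn _)).
  by rewrite coef_map_id0 // => ->; rewrite mul0r coef0.
have k_gt0 : (0 < k)%N.
  rewrite lt0n; apply/eqP => k0; move: cE; rewrite k0 big_ord1 expr0 mulr1.
  have : p`_0 = 1 by have := monicP mon_p; rewrite lead_coefE -/k k0.
  by move=> -> /=; rewrite coef1 eqxx => /eqP; rewrite oner_eq0.
exists k, (fun j => (rees_incl p`_(k - j))`_j); split=> // [j /andP[_ jk]|].
  exact: (rees_predP _ (rees_valP p`_(k - j))).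
have : \sum_(0 <= i < k.+1) (rees_incl p`_(k - i))`_i * h ^+ (k - i) = 0.
  rewrite big_mkord -[RHS]cE [RHS](reindex_inj rev_ord_inj) /=.
  by apply: eq_bigr => i _; rewrite subSS subKn // -ltnS.
rewrite big_ltn // !subn0; have := monicP mon_p; rewrite lead_coefE -/k => -> /=.
by rewrite coef1 eqxx mul1r.
Qed.

Lemma rees_integral_mem h : I h -> rees_integral h.
Proof.
move=> Ih; have Hh : h *: 'X \in rees_pred.
  apply/rees_predP => i; rewrite coefZ coefX.
  case: eqP => [->|_]; first by rewrite mulr1; apply: ideal_exp1.
  by rewrite mulr0; case: (ideal_exp_is_ideal I i).
exact: (integral_id rees_incl (Rees Hh)).
Qed.

Lemma rees_int_const c : rees_int c%:P.
Proof.
have Hc : c%:P \in rees_pred.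
  apply/rees_predP => i; rewrite coefC; case: eqP => [->//|_].
  by case: (ideal_exp_is_ideal I i).
exact: (integral_id rees_incl (Rees Hc)).
Qed.

Lemma rees_integralM c h : rees_integral h -> rees_integral (c * h).
Proof.
rewrite /rees_integral -scalerA -[c *: _]mul_polyC => Hh.
exact: (integral_mul (RtoK := rees_incl) (rees_int_const c) Hh).
Qed.

Lemma rees_integralD g h : rees_integral g -> rees_integral h -> rees_integral (g + h).
Proof. by rewrite /rees_integral scalerDl; apply: (integral_add (RtoK := rees_incl)). Qed.

Lemma rees_integralB g h : rees_integral g -> rees_integral h -> rees_integral (g - h).
Proof. by rewrite /rees_integral scalerBl; apply: (integral_sub (RtoK := rees_incl)). Qed.

Lemma rees_integral0 : rees_integral 0.
Proof. by rewrite /rees_integral scale0r; apply: (integral0 rees_incl). Qed.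

Lemma rees_integral_sum (J : Type) (s : seq J) (P : pred J) (F : J -> T) :
  (forall i, P i -> rees_integral (F i)) -> rees_integral (\sum_(i <- s | P i) F i).
Proof. by move=> H; apply: big_ind => //; [exact: rees_integral0 | exact: rees_integralD]. Qed.

Lemma rees_int_exp u j : rees_int u -> rees_int (u ^+ j).
Proof.
move=> Hu; elim: j => [|j IH]; first exact: (integral1 rees_incl).
by rewrite exprS; apply: (integral_mul (RtoK := rees_incl)).
Qed.

(** This is the only source of new integral elements: monomials between two
extreme ones have a power that is a product of powers of the extreme ones. *)
Lemma rees_integral_root i j h g z : (0 < i + j)%N ->
  rees_integral g -> rees_integral h -> z ^+ (i + j) = g ^+ i * h ^+ j ->
  rees_integral z.
Proof.
move=> ij_gt0 Hg Hh E.
pose u := (z *: 'X : {poly T}) ^+ (i + j).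
have Hu : rees_int u.
  have -> : u = (g *: 'X) ^+ i * (h *: 'X) ^+ j.
    by rewrite /u !exprZn -scalerAl -scalerAr scalerA E exprD.
  by apply: (integral_mul (RtoK := rees_incl)); apply: rees_int_exp.
apply: (integral_root_monic (RtoK := rees_incl) (p := 'X^(i + j) - u%:P)).
- exact: monicXnsubC.
- by apply/rootP; rewrite !hornerE subrr.
apply/(integral_poly rees_incl) => l; rewrite coefB coefXn coefC.
apply: (integral_sub (RtoK := rees_incl)); first exact: (integral_nat rees_incl).
by case: eqP => // _; apply: (integral0 rees_incl).
Qed.

End Rees.

Lemma gcdn_closed (P : nat -> Prop) : P 0%N ->
  (forall e f, (e <= f)%N -> P e -> P f -> P (f - e)%N) ->
  forall e f, P e -> P f -> P (gcdn e f).
Proof.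
move=> P0 PB e f; have [t] := ubnP (e + f).
elim: t e f => // t IH e f; rewrite ltnS => eft He Hf.
have [->|e_gt0] := posnP e; first by rewrite gcd0n.
have [->|f_gt0] := posnP f; first by rewrite gcdn0.
have [ef|fe] := leqP e f.
  by rewrite -(subnKC ef) gcdnDl; apply: IH => //; [lia | exact: PB].
rewrite -(subnKC (ltnW fe)) gcdnC gcdnDl; apply: IH => //; first lia.
by apply: PB => //; apply: ltnW.
Qed.

(** In the ideal generated by some X^g - Y^g, which a are such that X^a - Y^a
is integral? Fix the degree D and consider the e such that X^e - Y^e times any
monomial of degree D - e is integral. They form a set closed under
differences, so that Euclid's algorithm applies. *)
Section Differences.
Context {T : comNzRingType} (I : set T) (X Y : T).

Definition diff_integral (D e : nat) : Prop := (e <= D)%N /\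
  forall i j, (i + j = D - e)%N -> rees_integral I ((X ^+ e - Y ^+ e) * (X ^+ i * Y ^+ j)).

Lemma diff_integral0 D : diff_integral D 0.
Proof.
by split=> // i j _; rewrite !expr0 subrr mul0r; apply: rees_integral0.
Qed.

Lemma diff_integral_gen D g : (g <= D)%N -> I (X ^+ g - Y ^+ g) -> diff_integral D g.
Proof.
by move=> gD Ig; split=> // i j _; rewrite mulrC; apply/rees_integralM/rees_integral_mem.
Qed.

(** Both X^e (X^(f-e) - Y^(f-e)) and Y^e (X^(f-e) - Y^(f-e)) are combinations
of the differences for e and f. Multiplied by the missing monomials they give
the two extreme products X^(p+q) h and Y^(p+q) h, and the product X^p Y^q h
has the power of exponent p + q equal to (X^(p+q) h)^p (Y^(p+q) h)^q. *)
Lemma diff_integral_sub D e f : (e <= f)%N ->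
  diff_integral D e -> diff_integral D f -> diff_integral D (f - e).
Proof.
move=> ef [eD He] [fD Hf]; split=> [|p q pq]; first lia.
pose h := X ^+ (f - e) - Y ^+ (f - e).
have HX i j : (i + j = D - f)%N -> rees_integral I (X ^+ (e + i) * Y ^+ j * h).
  move=> ij.
  have -> : X ^+ (e + i) * Y ^+ j * h = (X ^+ f - Y ^+ f) * (X ^+ i * Y ^+ j)
      - (X ^+ e - Y ^+ e) * (X ^+ i * Y ^+ (f - e + j)).
    by rewrite /h -(subnK ef) addnK !exprD; ring.
  by apply: rees_integralB; [apply: Hf | apply: He; lia].
have HY i j : (i + j = D - f)%N -> rees_integral I (X ^+ i * Y ^+ (e + j) * h).
  move=> ij.
  have -> : X ^+ i * Y ^+ (e + j) * h = (X ^+ f - Y ^+ f) * (X ^+ i * Y ^+ j)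
      - (X ^+ e - Y ^+ e) * (X ^+ (f - e + i) * Y ^+ j).
    by rewrite /h -(subnK ef) addnK !exprD; ring.
  by apply: rees_integralB; [apply: Hf | apply: He; lia].
have [pq0|pq_gt0] := posnP (p + q)%N.
  have -> : e = 0%N by lia.
  rewrite subn0; have -> : p = 0%N by lia.
  have -> : q = 0%N by lia.
  by apply: Hf; lia.
apply: (@rees_integral_root _ _ p q (Y ^+ (p + q) * h) (X ^+ (p + q) * h)) => //.
- have := @HX (D - f)%N 0%N (addn0 _); rewrite expr0 mulr1.
  by have -> : (e + (D - f) = p + q)%N by lia.
- have := @HY 0%N (D - f)%N (add0n _); rewrite expr0 mul1r.
  by have -> : (e + (D - f) = p + q)%N by lia.
by rewrite -/h !exprMn -!exprM exprD [(p * _)%N]mulnC [(q * _)%N]mulnC; ring.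
Qed.

Theorem diff_integral_saturation (J : finType) (P : pred J) (g : J -> nat) (a : nat) :
  (forall j, P j -> I (X ^+ g j - Y ^+ g j)) ->
  (\big[gcdn/0]_(j | P j && (g j <= a)) g j %| a)%N ->
  rees_integral I (X ^+ a - Y ^+ a).
Proof.
move=> Ig; set d := (\big[gcdn/0]_(j | _) _)%N => /dvdnP[k ak].
have [_ Hd] : diff_integral a d.
  apply: (big_ind (diff_integral a)) => [|e f|j /andP[Pj ja]].
  - exact: diff_integral0.
  - exact: gcdn_closed (diff_integral0 a) (@diff_integral_sub a) e f.
  - by apply: diff_integral_gen => //; apply: Ig.
rewrite {1 2}ak [(k * d)%N]mulnC !exprM subrXX mulr_sumr.
apply: rees_integral_sum => i _; rewrite -!exprM; apply: Hd.
have -> : (a - d = d * k.-1)%N by rewrite ak -subn1 mulnBr muln1 mulnC.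
by rewrite -mulnDr; congr (_ * _)%N; have := ltn_ord i; lia.
Qed.
End Differences.

Section CoordinateOrder.
Context {K : numFieldType} {n : nat}.
Implicit Types (F G : cvps K n) (j : 'I_n).

Definition ord_ge (j : 'I_n) (e : nat) F := supp_in (fun m => e <= m j)%N F.

Lemma ord_geM j e e' F G : ord_ge j e F -> ord_ge j e' G -> ord_ge j (e + e') (F * G).
Proof.
move=> HF HG m /cvcM_neq0[k [l [-> /HF Hk /HG Hl]]].
by rewrite mnmDE leq_add.
Qed.

Lemma ord_ge_leq j e e' F : (e' <= e)%N -> ord_ge j e F -> ord_ge j e' F.
Proof. by move=> ee H m /H; apply: leq_trans. Qed.

Lemma ord_ge0 j F : ord_ge j 0 F. Proof. by []. Qed.

Lemma ord_geXn j e F i : ord_ge j e F -> ord_ge j (e * i) (F ^+ i).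
Proof.
move=> HF; elim: i => [|i IH]; first by rewrite muln0.
by rewrite exprS mulnS; apply: ord_geM.
Qed.

Lemma ord_ge_ideal j e : is_ideal [set F | ord_ge j e F].
Proof.
split=> [|F G|F G] /=; [exact: supp_in0|exact: supp_inD|].
by move=> HG; rewrite -[e]add0n; apply: ord_geM.
Qed.

Lemma cvps_filter (P : pred 'X_{1..n}) F :
  exists F', forall m, F' m = if P m then F m else 0.
Proof.
have [C [r [r_gt0 C_ge0 H]]] := cvps_geo F.
have cF : convergent (fun m => if P m then F m else 0).
  apply/convergent_geo; exists C, r; split=> // m; case: ifP => // _.
  by rewrite normr0 mulr_ge0 // exprn_ge0 // ltW.
by exists (CVPS cF).
Qed.

(** The order in one variable is a valuation: if o < e is the order of F, the
part F' of F of order exactly o has powers without cancellation, whereas the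
equation forces F^k to have order > o k. *)
Lemma ord_ge_integral j e k (a : nat -> cvps K n) F : (0 < k)%N ->
  (forall i, (1 <= i <= k)%N -> ord_ge j (e * i) (a i)) ->
  F ^+ k + \sum_(1 <= i < k.+1) a i * F ^+ (k - i) = 0 -> ord_ge j e F.
Proof.
move=> k_gt0 Ha E.
suff H o : (o <= e)%N -> ord_ge j o F by apply: H.
elim: o => [|o IH] oe; first exact: ord_ge0.
have Fo := IH (ltnW oe).
have [F' HF'] := cvps_filter (fun m => m j == o) F.
have F'o : ord_ge j o F' by move=> m; rewrite HF'; case: (m j =P o) => [->|]; rewrite ?eqxx.
have FF' : ord_ge j o.+1 (F - F').
  move=> m; rewrite cvcB HF'; case: (m j =P o) => [|mo]; rewrite ?subrr ?eqxx // subr0.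
  by move/Fo; rewrite leq_eqVlt => /orP[/eqP/esym|].
have id := ord_ge_ideal j (o * k).+1; have [_ IA IM] := id.
have Fk : ord_ge j (o * k).+1 (F ^+ k).
  have -> : F ^+ k = - \sum_(1 <= i < k.+1) a i * F ^+ (k - i) by apply/eqP; rewrite -addr_eq0 E.
  apply: (is_idealN id); rewrite big_nat_cond; 
  refine (@is_ideal_sum (cvps K n) _ _ _ _ _ id _) => i /andP[/andP[i1 ik] _].
  have i1k : (1 <= i <= k)%N by rewrite i1 -ltnS.
  have Hi := ord_geM (Ha i i1k) (@ord_geXn _ _ _ (k - i) Fo).
  apply: ord_ge_leq Hi; rewrite mulnBr.
  have : (o * i < e * i)%N by rewrite ltn_mul2r i1.
  have : (o * i <= o * k)%N by rewrite leq_mul2l -ltnS ik orbT.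
  lia.
have F'k : ord_ge j (o * k).+1 (F' ^+ k).
  have -> : F' ^+ k = F ^+ k - (F ^+ k - F' ^+ k) by rewrite subKr.
  apply: IA => //; apply: (is_idealN id); rewrite subrXX mulr_sumr.
  refine (@is_ideal_sum (cvps K n) _ _ _ _ _ id _) => i _.
  apply: ord_ge_leq (ord_geM FF' (ord_geM (@ord_geXn _ _ _ (k.-1 - i) Fo) (@ord_geXn _ _ _ i F'o))).
  rewrite -mulnDr addSn ltnS -mulnS leq_mul2l; apply/orP; right.
  by have := ltn_ord i; lia.
have F'k_le m : (F' ^+ k) m != 0 -> m j = (o * k)%N.
  elim: (k) m => [|l IHl] m.
    rewrite expr0 cvc1; case: (m =P 0%MM) => [->|]; rewrite ?eqxx // => _.
    by rewrite muln0 mnm0E.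
  rewrite exprS => /cvcM_neq0[k1 [l1 [-> + /IHl E1]]].
  by rewrite HF' mnmDE E1 mulnS; case: (k1 j =P o) => [->|]; rewrite ?eqxx.
have F'0 : F' = 0.
  apply/eqP/negPn/negP => /lead_exists[b Fb].
  have [nz _] := lead_exp k Fb.
  by have := F'k _ nz; rewrite (F'k_le _ nz) ltnn.
by rewrite F'0 subr0 in FF'.
Qed.

Lemma ord_ge_integral_closure (T : comNzRingType) (I : set T)
    (chi : {rmorphism T -> cvps K n}) j e :
  (forall x, I x -> ord_ge j e (chi x)) ->
  forall h, integral_closure I h -> ord_ge j e (chi h).
Proof.
move=> HI h [k [a [k_gt0 Ha E]]].
have HIk i x : ideal_exp I i x -> ord_ge j (e * i) (chi x).
  elim: i x => [|i IH] x; first by rewrite muln0.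
  apply: (@ideal_span_min _ _ [set x | ord_ge j (e * i.+1) (chi x)]); last first.
    by move=> _ [u Iu [v Iv <-]] /=; rewrite rmorphM mulnS; apply: ord_geM; [exact: HI | exact: IH].
  have [J0 JD JM] := ord_ge_ideal j (e * i.+1).
  split=> [|u v /= Hu Hv|u v /= Hv]; first by rewrite /= rmorph0; apply: J0.
    by rewrite rmorphD; apply: JD.
  by rewrite rmorphM; apply: JM.
apply: (@ord_ge_integral _ _ k (chi \o a)) => // [i Hi|]; first exact/HIk/Ha.
have := congr1 chi E; rewrite rmorphD rmorphXn rmorph_sum rmorph0 => E0; rewrite -[RHS]E0.
by congr (_ + _); apply: eq_bigr => i _; rewrite rmorphM rmorphXn.
Qed.
End CoordinateOrder.

Lemma lrm_factor (R : comNzRingType) (U V W : comAlgType R)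
    (phi : {lrmorphism U -> V}) (psi : {lrmorphism U -> W}) :
  (range phi = setT)%classic -> (forall u, phi u = 0 -> psi u = 0) ->
  exists theta : {lrmorphism V -> W}, forall u, theta (phi u) = psi u.
Proof.
move=> surj ker; have /choice[s Hs] : forall v, exists u, phi u = v.
  by move=> v; have : (range phi)%classic v by [rewrite surj]; case=> u _ <-; exists u.
have E u u' : phi u = phi u' -> psi u = psi u'.
  by move=> H; apply/eqP; rewrite -subr_eq0 -lrB ker // lrB H subrr.
have [|||theta Ht] := @mk_lrmorphism R V W (psi \o s).
- by move=> c u v /=; rewrite -lrZ -lrD; apply: E; rewrite lrD lrZ !Hs.
- by move=> u v /=; rewrite -lrM; apply: E; rewrite lrM !Hs.
- by rewrite /= -(lr1 psi); apply: E; rewrite lr1 Hs.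
by exists theta => u; rewrite Ht; apply: E; rewrite Hs.
Qed.

(** * Monomial parametrizations *)

Section PowerMap.
Context {K : numFieldType} {n : nat}.

Lemma power_map_inj (N : nat) (P : {lrmorphism cvps K n -> cvps K n}) :
  (0 < N)%N -> (forall i, P (cvX U_(i)) = cvX (U_(i) *+ N)) ->
  forall F, P F = 0 -> F = 0.
Proof.
move=> N_gt0 HP F PF; apply: cvps_inj => m.
have := congr1 (fun G : cvps K n => G (m *+ N)%MM) PF; rewrite (power_map_coef N_gt0 HP).
case: forallP => [_|[]]; last by move=> i; rewrite mulmnE dvdn_mull.
move=> H; apply: etrans H; congr (F _); apply/mnmP => i.
by rewrite mnmE mulmnE mulnK.
Qed.
End PowerMap.

Section Model.
Context {K : numFieldType} {d N : nat} {A : comAlgType K}.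
Variables (c : 'I_N -> 'I_d) (g : 'I_N -> nat).
Variables (psi : {lrmorphism cvps K N -> A}) (theta : {lrmorphism A -> cvps K d}).

(** The color c i says which variable x_j the i-th coordinate is a power of.
Keeping the colors general treats monomial curves (d = 1) and their products
(d = 2) at once. *)
Definition monomial_model : Prop :=
  [/\ forall a, exists F, psi F = a,
      forall i, theta (psi (cvX U_(i))) = cvX (U_(c i) *+ g i),
      forall i, (0 < g i)%N &
      forall j, \big[gcdn/0%N]_(i | c i == j) g i = 1%N].

Hypothesis model : monomial_model.

(** One coordinate is chosen for each variable of C{x}, and raised to a power
that makes its exponent equal to M, for all variables alike. *)
Lemma model_pivots : exists (p : 'I_d -> 'I_N) (e : 'I_d -> nat) (M : nat)
    (Y : {lrmorphism cvps K d -> cvps K N}),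
  [/\ (0 < M)%N, forall j, c (p j) = j, forall j, (e j * g (p j) = M)%N &
      forall j, Y (cvX U_(j)) = cvX (U_(p j) *+ e j)].
Proof.
have [_ _ g_gt0 gcd1] := model.
have /choice[p Hp] : forall j, exists i, c i = j.
  move=> j; case: (pickP (fun i => c i == j)) => [i /eqP|none]; first by exists i.
  by have := gcd1 j; rewrite big_pred0.
pose M := (\prod_j g (p j))%N; pose e j := (M %/ g (p j))%N.
have M_gt0 : (0 < M)%N by rewrite prodn_gt0.
have eM j : (e j * g (p j) = M)%N by rewrite divnK // /M (bigD1 j) //= dvdn_mulr.
have [|Y HY] := @subst_exists K d N (fun j => cvX (U_(p j) *+ e j)).
  move=> j; rewrite cvcX -mdeg_eq0 mdegMn mdeg1 mul1n; case: eqP => // e0.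
  by have := eM j; rewrite e0 mul0n => M0; rewrite -M0 in M_gt0.
by exists p, e, M, Y.
Qed.

Lemma model_power_map : exists (M : nat) (P : {lrmorphism cvps K d -> cvps K d})
    (iota : {lrmorphism cvps K d -> A}),
  [/\ (0 < M)%N, forall j, P (cvX U_(j)) = cvX (U_(j) *+ M) &
      forall F, theta (iota F) = P F].
Proof.
have [_ Htheta _ _] := model.
have [p [e [M [Y [M_gt0 cp eM HY]]]]] := model_pivots.
exists M, (theta \o (psi \o Y)), (psi \o Y); split=> // j /=.
rewrite HY -cvXn !lrXn Htheta cp cvXn; congr cvX.
by apply/mnmP => i; rewrite !mulmnE -mulnA [(_ * e j)%N]mulnC eM.
Qed.

Hypothesis A_domain : forall a b : A, a * b = 0 -> a = 0 \/ b = 0.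
Hypothesis psi_rel : forall i j, c i = c j ->
  psi (cvX U_(i)) ^+ g j = psi (cvX U_(j)) ^+ g i.

(** The power series in suitable M-th powers of the x_j embed in A, and A is
integral over them. If theta kills a <> 0, dividing an integral equation of a
by a power of a leaves an equation with nonzero constant term, which theta
maps to zero. *)
Theorem model_injective : injective theta.
Proof.
have [psi_surj Htheta g_gt0 _] := model.
have [p [e [M [Y [M_gt0 cp eM HY]]]]] := model_pivots.
pose iota : {lrmorphism cvps K d -> A} := psi \o Y.
have iota_inj F : theta (iota F) = 0 -> F = 0.
  apply: (@power_map_inj _ _ M (theta \o iota)) => // j /=.
  rewrite HY -cvXn !lrXn Htheta cp cvXn; congr cvX.
  by apply/mnmP => i; rewrite !mulmnE -mulnA [(_ * e j)%N]mulnC eM.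
have [|W HW] := @subst_exists K N d (fun i => cvX (U_(c i) *+ g i)).
  by move=> i; rewrite cvcX -mdeg_eq0 mdegMn mdeg1 mul1n gtn_eqF.
have [|P HP] := @subst_exists K N N (fun i => cvX (U_(i) *+ M)).
  by move=> i; rewrite cvcX -mdeg_eq0 mdegMn mdeg1 mul1n gtn_eqF.
have xM i : psi (cvX U_(i)) ^+ M = iota (cvX (U_(c i) *+ g i)).
  rewrite -cvXn lrXn /= HY -cvXn lrXn -(eM (c i)) mulnC exprM psi_rel ?cp //.
  by rewrite -!exprM mulnC.
have iotaP F : psi (P F) = iota (W F).
  have [Q HQ] := lrm_congr P (Y \o W) F.
  apply/eqP; rewrite -subr_eq0 -lrB [X in psi X]HQ lr_sum big1 // => i _.
  rewrite lrM lrB HP -cvXn lrXn xM /= HW subrr mul0r //.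
have int_x i : integralOver iota (psi (cvX U_(i))).
  apply: (integral_root_monic (RtoK := iota) (p := 'X^M - (iota (cvX (U_(c i) *+ g i)))%:P)).
  - exact: monicXnsubC.
  - by apply/rootP; rewrite !hornerE xM subrr.
  apply/(integral_poly iota) => l; rewrite coefB coefXn coefC.
  apply: (integral_sub (RtoK := iota)); first exact: (integral_nat iota).
  by case: eqP => // _; [exact: (integral_id iota) | exact: (integral0 iota)].
have int_X i k : integralOver iota (psi (cvX U_(i)) ^+ k).
  elim: k => [|k IH]; first exact: (integral1 iota).
  by rewrite exprS; apply: (integral_mul (RtoK := iota)).
have int_A a : integralOver iota a.
  have [h <-] := psi_surj a; have [G [-> _]] := @cvps_residues K N 0 M M_gt0 P h HP.
  rewrite lr_sum; apply: (big_ind (integralOver iota)) => [|u v|r _].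
  - exact: (integral0 iota).
  - exact: (integral_add (RtoK := iota)).
  rewrite lrM iotaP; apply: (integral_mul (RtoK := iota)); last exact: (integral_id iota).
  rewrite cvXE lr_prod; apply: (big_ind (integralOver iota)) => [|u v|i _].
  - exact: (integral1 iota).
  - exact: (integral_mul (RtoK := iota)).
  by rewrite lrXn.
move=> a b /eqP; rewrite -subr_eq0 -lrB => /eqP.
set u := a - b => theta_u; apply/eqP; rewrite -subr_eq0 -/u; apply/eqP.
apply: contrapT => u0; have [q mon_q /rootP qu] := int_A u.
suff q0 : q = 0 by have := monic_neq0 mon_q; rewrite q0 eqxx.
elim/poly_ind: q qu {mon_q} => // q t IH.
rewrite rmorphD rmorphM /= map_polyX map_polyC /= hornerMXaddC => E.
have t0 : t = 0.
  apply: iota_inj; have := congr1 theta E.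
  by rewrite lrD lrM theta_u mulr0 add0r lr0.
have [/IH ->|//] : (map_poly iota q).[u] = 0 \/ u = 0.
  by apply: A_domain; rewrite -[RHS]E t0 !lr0 addr0.
by rewrite t0 mul0r add0r.
Qed.
End Model.

(** * The normalization of a monomial model *)

Section Fractions.
Context {K : numFieldType} {d N : nat} {A : comAlgType K}.
Variables (c : 'I_N -> 'I_d) (g : 'I_N -> nat).
Variables (psi : {lrmorphism cvps K N -> A}) (theta : {lrmorphism A -> cvps K d}).
Hypothesis model : monomial_model c g psi theta.
Hypothesis theta_inj : injective theta.

Lemma theta_eq0 (a : A) : theta a = 0 -> a = 0.
Proof. by move=> H; apply: theta_inj; rewrite H lr0. Qed.

Lemma model_domain (a b : A) : a * b = 0 -> a = 0 \/ b = 0.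
Proof.
move=> /(congr1 theta); rewrite lrM lr0 => /cvps_mul_eq0[] /theta_eq0 ->; by [left|right].
Qed.

Lemma model_residues : exists (J : finType) (r : J -> 'X_{1..d})
    (iota : {lrmorphism cvps K d -> A}),
  forall F, exists G : J -> cvps K d, F = \sum_j cvX (r j) * theta (iota (G j)).
Proof.
have [M [P [iota [M_gt0 HP HiP]]]] := model_power_map model.
exists {ffun 'I_d -> 'I_(0 + M)}, (@residue_exp d 0 M), iota => F.
have [G [-> _]] := cvps_residues 0 M_gt0 F HP.
by exists G; apply: eq_bigr => j _; rewrite HiP.
Qed.

Lemma model_integral F : integralOver theta F.
Proof.
have [M [P [iota [M_gt0 HP HiP]]]] := model_power_map model.
have int_x i : integralOver theta (cvX U_(i)).
  apply: (integral_root_monic (RtoK := theta) (p := 'X^M - (cvX (U_(i) *+ M))%:P)).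
  - exact: monicXnsubC.
  - by apply/rootP; rewrite !hornerE cvXn subrr.
  apply/(integral_poly theta) => l; rewrite coefB coefXn coefC.
  apply: (integral_sub (RtoK := theta)); first exact: (integral_nat theta).
  case: eqP => // _; last exact: (integral0 theta).
  by rewrite -HP -HiP; apply: (integral_id theta).
have int_X m : integralOver theta (cvX m).
  rewrite cvXE; apply: (big_ind (integralOver theta)) => [|u v|i _].
  - exact: (integral1 theta).
  - exact: (integral_mul (RtoK := theta)).
  elim: (m i) => [|k IH]; first exact: (integral1 theta).
  by rewrite exprS; apply: (integral_mul (RtoK := theta)).
have [J [r [iota' HJ]]] := model_residues; have [G ->] := HJ F.
apply: (big_ind (integralOver theta)) => [|u v|j _].
- exact: (integral0 theta).
- exact: (integral_add (RtoK := theta)).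
by apply: (integral_mul (RtoK := theta)) => //; apply: (integral_id theta).
Qed.

Definition is_fraction (F : cvps K d) : Prop :=
  exists a b, b != 0 /\ theta a = theta b * F.

Lemma is_fractionD F G : is_fraction F -> is_fraction G -> is_fraction (F + G).
Proof.
move=> [a [b [b0 E]]] [a' [b' [b'0 E']]]; exists (a * b' + a' * b), (b * b'); split.
  by apply/eqP => /model_domain[] /eqP; apply/negP.
by rewrite lrD !lrM E E'; ring.
Qed.

Lemma is_fractionM F G : is_fraction F -> is_fraction G -> is_fraction (F * G).
Proof.
move=> [a [b [b0 E]]] [a' [b' [b'0 E']]]; exists (a * a'), (b * b'); split.
  by apply/eqP => /model_domain[] /eqP; apply/negP.
by rewrite !lrM E E'; ring.
Qed.

Lemma is_fraction_theta a : is_fraction (theta a).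
Proof. by exists a, 1; rewrite oner_neq0 lr1 mul1r. Qed.

(** The exponents e such that x_j^e lies in A are coprime, hence two sums of
such exponents differ by one: the differences are closed under gcd. *)
Lemma is_fraction_var j : is_fraction (cvX U_(j)).
Proof.
have [_ Htheta _ gcd1] := model.
pose S e := exists a, theta a = cvX (U_(j) *+ e).
have S0 : S 0%N by exists 1; rewrite lr1 mulm0n cvX0.
have SD e f : S e -> S f -> S (e + f)%N.
  move=> [a Ea] [b Eb]; exists (a * b); rewrite lrM Ea Eb -cvXD; congr cvX.
  by apply/mnmP => i; rewrite mnmDE !mulmnE mulnDr.
pose D del := exists2 e, S e & S (e + del)%N.
have [e [a Ea] [b Eb]] : D 1%N; last first.
  exists b, a; split; last by rewrite Ea Eb addn1 mulmSr cvXD.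
  apply: contraTneq (oner_neq0 K) => a0; rewrite negbK.
  have := congr1 (fun F : cvps K d => F (U_(j) *+ e)%MM) Ea.
  by rewrite a0 lr0 cvcX eqxx cvc0 => /esym/eqP.
rewrite -(gcd1 j); apply: (big_ind D) => [|e f|i /eqP ci].
- by exists 0%N.
- apply: gcdn_closed => [|{}e {}f ef [e' Se' See'] [f' Sf' Sff']]; first by exists 0%N.
  exists (f' + (e' + e))%N; first exact: SD.
  have -> : (f' + (e' + e) + (f - e) = f' + f + e')%N by lia.
  exact: SD.
exists 0%N => //; rewrite add0n; exists (psi (cvX U_(i))).
by rewrite Htheta ci.
Qed.

Lemma is_fraction_all F : is_fraction F.
Proof.
have [J [r [iota HJ]]] := model_residues; have [G ->] := HJ F.
apply: (big_ind is_fraction) => [||j _]; last 1 first.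
- apply: is_fractionM; last exact: is_fraction_theta.
  rewrite cvXE; apply: (big_ind is_fraction) => [||i _]; last 1 first.
  + elim: (r j i) => [|k IH]; first by rewrite expr0 -(lr1 theta); apply: is_fraction_theta.
    by rewrite exprS; apply: is_fractionM => //; apply: is_fraction_var.
  + by rewrite -(lr1 theta); apply: is_fraction_theta.
  + exact: is_fractionM.
- by rewrite -(lr0 theta); apply: is_fraction_theta.
- exact: is_fractionD.
Qed.
End Fractions.

Lemma clear_denominators (A B : comNzRingType) (nu : {rmorphism A -> B}) (q : {poly A})
    (a b : A) (z : B) k : (size q <= k.+1)%N -> z * nu b = nu a ->
  nu b ^+ k * (map_poly nu q).[z] = nu (\sum_(i < k.+1) q`_i * (a ^+ i * b ^+ (k - i))).
Proof.
move=> sq E; rewrite (horner_coef_wide _ (leq_trans (size_poly _ _) sq)).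
rewrite rmorph_sum mulr_sumr; apply: eq_bigr => i _.
rewrite coef_map !rmorphM !rmorphXn -E exprMn.
have -> : nu b ^+ k = nu b ^+ i * nu b ^+ (k - i) by rewrite -exprD subnKC // -ltnS.
ring.
Qed.

Section Normalization.
Context {R : realType} {d N : nat} {A B : comAlgType R[i]%C}.
Local Notation C := R[i]%C.
Variables (c : 'I_N -> 'I_d) (g : 'I_N -> nat).
Variables (psi : {lrmorphism cvps C N -> A}) (theta : {lrmorphism A -> cvps C d}).
Hypothesis model : monomial_model c g psi theta.
Hypothesis theta_inj : injective theta.
Variable nu : {lrmorphism A -> B}.
Hypothesis norm : is_normalization nu.

Let domainA := model_domain theta_inj.

Lemma normalization_nu_inj : injective nu.
Proof. by case: norm => F [j []]. Qed.

Lemma normalization_domain (x y : B) : x * y = 0 -> x = 0 \/ y = 0.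
Proof.
case: norm => F [j [_ j_inj _ _]] /(congr1 j); rewrite rmorphM rmorph0 => /eqP.
by rewrite mulf_eq0 => /orP[] /eqP E; [left|right]; apply: j_inj; rewrite E rmorph0.
Qed.

(** The graph of the isomorphism from B to C{x}: both sides are the fraction
a/a'. *)
Definition represents (b : B) (F : cvps C d) : Prop :=
  exists a a', [/\ a' != 0, b * nu a' = nu a & theta a = theta a' * F].

Lemma theta_neq0 (a : A) : a != 0 -> theta a != 0.
Proof. by apply: contra_neq => /(theta_eq0 theta_inj). Qed.

Lemma nu_neq0 (a : A) : a != 0 -> nu a != 0.
Proof. by apply: contra_neq => E; apply: normalization_nu_inj; rewrite E raddf0. Qed.

Lemma represents_uniq b F F' : represents b F -> represents b F' -> F = F'.
Proof.
move=> [a [a' [a'0 Ea Ta]]] [e [e' [e'0 Ee Te]]].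
have E : a * e' = e * a'.
  by apply: normalization_nu_inj; rewrite !lrM -Ea -Ee mulrAC.
have := congr1 theta E; rewrite !lrM Ta Te => E'.
apply: (cvps_mulI (theta_neq0 a'0)); apply: (cvps_mulI (theta_neq0 e'0)).
by rewrite mulrC E'; ring.
Qed.

(** An integral equation of b over A shows that all powers of b have a common
denominator, a power of a', so that normality applies. *)
Lemma represents_total b : exists F, represents b F.
Proof.
case: norm => FF [j [_ j_inj fracB intB]].
have [a [a' [a'0 Ej]]] := fracB (j b).
have ja' : j (nu a') != 0.
  by apply: contra_neq (nu_neq0 a'0) => E; apply: j_inj; rewrite E rmorph0.
have Eb : b * nu a' = nu a by apply: j_inj; rewrite rmorphM Ej mulfVK.
have [p mon_p root_p] : integralOver (j \o nu) (j b) by apply/intB; exists b.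
have pb : (map_poly nu p).[b] = 0.
  by apply: j_inj; rewrite -horner_map -map_poly_comp rmorph0; apply/rootP.
have [Q HQ] : exists Q, theta a = theta a' * Q.
  apply: (@cvps_almost_integral _ _ _ _ (theta (a' ^+ (size p)))).
  - exact: theta_neq0.
  - rewrite lrXn; elim: (size p) => [|k IH]; first by rewrite expr0 oner_neq0.
    rewrite exprS; apply/eqP => /cvps_mul_eq0[] /eqP; apply/negP => //.
    exact: theta_neq0.
  move=> l; pose q := Pdiv.Ring.rmodp 'X^l p.
  have Eq : b ^+ l = (map_poly nu q).[b].
    have := Pdiv.RingMonic.rdivp_eq mon_p 'X^l.
    move=> /(congr1 (fun r => (map_poly nu r).[b])).
    rewrite rmorphD rmorphM hornerD hornerM /= pb mulr0 add0r map_polyXn hornerXn => ->.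
    by [].
  have sq : (size q <= (size p).+1)%N.
    by rewrite leqW // ltnW // Pdiv.Ring.ltn_rmodp monic_neq0.
  have := clear_denominators sq Eb; rewrite -Eq; move: (\sum_(i < _) _) => s Es.
  exists (theta s); rewrite -!lrXn -!lrM.
  suff -> : a' ^+ size p * a ^+ l = a' ^+ l * s by [].
  by apply: normalization_nu_inj; rewrite !lrM -Es !lrXn -Eb exprMn; ring.
by exists Q, a, a'.
Qed.

Lemma represents_surj F : exists b, represents b F.
Proof.
case: norm => FF [j [_ j_inj fracB intB]].
have [a [a' [a'0 ET]]] := is_fraction_all model theta_inj F.
have ja' : j (nu a') != 0.
  by apply: contra_neq (nu_neq0 a'0) => E; apply: j_inj; rewrite E rmorph0.
have [p mon_p /rootP pF] := model_integral model F.
have [b _ Eb] : (range j (j (nu a) / j (nu a')))%classic.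
  apply/intB; exists p => //; apply/rootP.
  have sp : (size p <= (size p).+1)%N by [].
  have E1 : F * theta a' = theta a by rewrite ET mulrC.
  have E2 : (j (nu a) / j (nu a')) * (j \o nu) a' = (j \o nu) a by rewrite /= mulfVK.
  have := clear_denominators sp E1; rewrite pF mulr0 -[LHS](lr0 theta) => /theta_inj E0.
  have := clear_denominators (nu := j \o nu) sp E2; rewrite -E0 rmorph0 => /eqP.
  by rewrite mulf_eq0 expf_eq0 /= (negbTE ja') andbF => /eqP.
exists b, a, a'; split=> //; apply: j_inj.
by rewrite rmorphM Eb mulfVK.
Qed.

Theorem normalization_of_model : exists beta : {lrmorphism B -> cvps C d},
  [/\ injective beta, forall F, exists b, beta b = F & forall a, beta (nu a) = theta a].
Proof.
have /choice[f Hf] := represents_total.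
have uniq b F : represents b F -> f b = F by apply: represents_uniq.
have [|||beta Hbeta] := @mk_lrmorphism C B (cvps C d) f.
- move=> t x y; apply: uniq.
  have [a [a' [a'0 Ea Ta]]] := Hf x; have [e [e' [e'0 Ee Te]]] := Hf y.
  exists (t *: a * e' + e * a'), (a' * e'); split.
  + by apply/eqP => /domainA[] /eqP; apply/negP.
  + rewrite lrD !lrM lrZ -Ea -Ee mulrDl -!scalerAl; congr (_ + _); last by ring.
    by congr (_ *: _); ring.
  + rewrite lrD !lrM lrZ Ta Te mulrDr -!scalerAl -scalerAr; congr (_ + _); last by ring.
    by congr (_ *: _); ring.
- move=> x y; apply: uniq.
  have [a [a' [a'0 Ea Ta]]] := Hf x; have [e [e' [e'0 Ee Te]]] := Hf y.
  exists (a * e), (a' * e'); split.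
  + by apply/eqP => /domainA[] /eqP; apply/negP.
  + by rewrite !lrM -Ea -Ee; ring.
  + by rewrite !lrM Ta Te; ring.
- by apply: uniq; exists 1, 1; rewrite oner_neq0 !lr1 !mulr1.
exists beta; split.
- move=> x y /eqP; rewrite -subr_eq0 -lrB => /eqP; rewrite Hbeta => H.
  apply/eqP; rewrite -subr_eq0; apply/eqP.
  have [a [a' [a'0 Ea Ta]]] := Hf (x - y).
  move: Ta; rewrite H mulr0 => /(theta_eq0 theta_inj) a0.
  move: Ea; rewrite a0 lr0 => /normalization_domain[//|/eqP].
  by rewrite (negbTE (nu_neq0 a'0)).
- move=> F; have [b Hb] := represents_surj F; exists b.
  by rewrite Hbeta; apply: uniq.
- move=> a; rewrite Hbeta; apply: uniq.
  by exists a, 1; rewrite oner_neq0 !lr1 mulr1 mul1r.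
Qed.
End Normalization.

(** * Products and monomial curves *)

Section GermProduct.
Context {R : realType}.
Local Notation C := R[i]%C.

(** The universal property of the product, restricted to targets in which
morphisms are determined by the images of coordinates. *)
Lemma germ_product_lift (B1 B2 P : comAlgType C)
    (p1 : {lrmorphism B1 -> P}) (p2 : {lrmorphism B2 -> P}) n
    (chi1 : {lrmorphism B1 -> cvps C n}) (chi2 : {lrmorphism B2 -> cvps C n}) :
  germ_product p1 p2 -> exists chi : {lrmorphism P -> cvps C n},
    (forall b, chi (p1 b) = chi1 b) /\ (forall b, chi (p2 b) = chi2 b).
Proof.
move=> [n1 [n2 [phi1 [phi2 [phi [[surj1 surj2] surj E1 E2 kerE]]]]]].
pose s (k : 'I_(n1 + n2)) : cvps C n :=
  match split k with inl i => chi1 (phi1 (cvX U_(i)))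
                   | inr i => chi2 (phi2 (cvX U_(i))) end.
have [|S HS] := @subst_exists _ _ _ s.
  move=> k; rewrite /s; case: split => i.
    exact: (lrm_var0 (chi1 \o phi1)).
  exact: (lrm_var0 (chi2 \o phi2)).
have [L HL] := @cvps_inl_lrm C n1 n2; have [L' HL'] := @cvps_inr_lrm C n1 n2.
have SL : S \o L =1 chi1 \o phi1.
  by apply: lrm_ext => i /=; rewrite HL cvps_inl_X HS /s (unsplitK (inl i)).
have SL' : S \o L' =1 chi2 \o phi2.
  by apply: lrm_ext => i /=; rewrite HL' cvps_inr_X HS /s (unsplitK (inr i)).
have SI F : S (cvps_inl F) = chi1 (phi1 F) by rewrite -HL; apply: SL.
have SI' F : S (cvps_inr F) = chi2 (phi2 F) by rewrite -HL'; apply: SL'.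
have [u u0|chi Hchi] := lrm_factor (psi := S) surj.
  have : kernel phi u by [].
  rewrite kerE; apply: (@ideal_span_min _ _ [set x | S x = 0]) => [|_ [[f f0 <-]|[f f0 <-]]] /=.
  - split=> [|x y /= Sx Sy|x y /= Sy]; first exact: lr0.
      by rewrite lrD Sx Sy addr0.
    by rewrite lrM Sy mulr0.
  - by rewrite SI f0 lr0.
  - by rewrite SI' f0 lr0.
have onto (U V : Type) (f : U -> V) v : (range f = setT)%classic -> exists u, f u = v.
  by move=> sf; have : (range f)%classic v by [rewrite sf]; case=> u _ <-; exists u.
exists chi; split=> b.
  by have [f <-] := onto _ _ _ b surj1; rewrite -E1 Hchi SI.
by have [f <-] := onto _ _ _ b surj2; rewrite -E2 Hchi SI'.
Qed.

Section ProductModel.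
Context {A1 A2 A : comAlgType C} {d1 d2 N1 N2 : nat}.
Variables (pr1 : {lrmorphism A1 -> A}) (pr2 : {lrmorphism A2 -> A}).
Variables (c1 : 'I_N1 -> 'I_d1) (g1 : 'I_N1 -> nat).
Variables (psi1 : {lrmorphism cvps C N1 -> A1}) (theta1 : {lrmorphism A1 -> cvps C d1}).
Variables (c2 : 'I_N2 -> 'I_d2) (g2 : 'I_N2 -> nat).
Variables (psi2 : {lrmorphism cvps C N2 -> A2}) (theta2 : {lrmorphism A2 -> cvps C d2}).

Definition sum_color (k : 'I_(N1 + N2)) : 'I_(d1 + d2) :=
  match split k with inl i => lshift d2 (c1 i) | inr i => rshift d1 (c2 i) end.
Definition sum_exponent (k : 'I_(N1 + N2)) : nat :=
  match split k with inl i => g1 i | inr i => g2 i end.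

Lemma sum_color_l i : sum_color (lshift N2 i) = lshift d2 (c1 i).
Proof. by rewrite /sum_color (unsplitK (inl i)). Qed.
Lemma sum_color_r i : sum_color (rshift N1 i) = rshift d1 (c2 i).
Proof. by rewrite /sum_color (unsplitK (inr i)). Qed.
Lemma sum_exponent_l i : sum_exponent (lshift N2 i) = g1 i.
Proof. by rewrite /sum_exponent (unsplitK (inl i)). Qed.
Lemma sum_exponent_r i : sum_exponent (rshift N1 i) = g2 i.
Proof. by rewrite /sum_exponent (unsplitK (inr i)). Qed.

Hypothesis model1 : monomial_model c1 g1 psi1 theta1.
Hypothesis model2 : monomial_model c2 g2 psi2 theta2.
Hypothesis inj1 : injective theta1.
Hypothesis inj2 : injective theta2.
Hypothesis prod : germ_product pr1 pr2.
Hypothesis A_domain : forall a b : A, a * b = 0 -> a = 0 \/ b = 0.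

(** The coordinates w_j of the given presentation of the product need not be
monomial. The coordinates of the models are lifted to series in the w_j; as
each w_j agrees in A with a series in these lifts, substitution of the lifts
presents A again. *)
Theorem product_model :
  exists (psi : {lrmorphism cvps C (N1 + N2) -> A})
    (theta : {lrmorphism A -> cvps C (d1 + d2)}),
    monomial_model sum_color sum_exponent psi theta /\ injective theta.
Proof.
have [surj1 Htheta1 g1_gt0 gcd1] := model1; have [surj2 Htheta2 g2_gt0 gcd2] := model2.
have [L HL] := @cvps_inl_lrm C d1 d2; have [L' HL'] := @cvps_inr_lrm C d1 d2.
have [theta [T1 T2]] := germ_product_lift (L \o theta1) (L' \o theta2) prod.
have [n1 [n2 [phi1 [phi2 [phi [[sphi1 sphi2] sphi E1 E2 kerE]]]]]] := prod.
have onto (U V : Type) (f : U -> V) v : (range f = setT)%classic -> exists u, f u = v.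
  by move=> sf; have : (range f)%classic v by [rewrite sf]; case=> u _ <-; exists u.
have /choice[l1 Hl1] i : exists l, phi1 l = psi1 (cvX U_(i)) by apply: onto.
have /choice[l2 Hl2] i : exists l, phi2 l = psi2 (cvX U_(i)) by apply: onto.
have l10 i : l1 i 0%MM = 0.
  by rewrite -(lrm_const (theta1 \o phi1)) /= Hl1 (lrm_var0 (theta1 \o psi1)).
have l20 i : l2 i 0%MM = 0.
  by rewrite -(lrm_const (theta2 \o phi2)) /= Hl2 (lrm_var0 (theta2 \o psi2)).
have [S1 HS1] := subst_exists l10; have [S2 HS2] := subst_exists l20.
have phiS1 F : phi1 (S1 F) = psi1 F.
  apply: inj1; apply: (@lrm_ext _ _ _ (theta1 \o (phi1 \o S1)) (theta1 \o psi1)) => i /=.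
  by rewrite HS1 Hl1.
have phiS2 F : phi2 (S2 F) = psi2 F.
  apply: inj2; apply: (@lrm_ext _ _ _ (theta2 \o (phi2 \o S2)) (theta2 \o psi2)) => i /=.
  by rewrite HS2 Hl2.
have [I HI] := @cvps_inl_lrm C n1 n2; have [I' HI'] := @cvps_inr_lrm C n1 n2.
pose l (k : 'I_(N1 + N2)) :=
  match split k with inl i => I (l1 i) | inr i => I' (l2 i) end.
have [|S HS] := @subst_exists _ _ _ l.
  by move=> k; rewrite /l; case: split => i; rewrite lrm_const.
have SX1 i : S (cvX U_(lshift N2 i)) = I (l1 i) by rewrite HS /l (unsplitK (inl i)).
have SX2 i : S (cvX U_(rshift N1 i)) = I' (l2 i) by rewrite HS /l (unsplitK (inr i)).
pose psi : {lrmorphism cvps C (N1 + N2) -> A} := phi \o S.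
have psi1E i : psi (cvX U_(lshift N2 i)) = pr1 (psi1 (cvX U_(i))).
  by rewrite /= SX1 HI E1 Hl1.
have psi2E i : psi (cvX U_(rshift N1 i)) = pr2 (psi2 (cvX U_(i))).
  by rewrite /= SX2 HI' E2 Hl2.
have psi_surj a : exists F, psi F = a.
  have [h <-] := onto _ _ _ a sphi.
  have /choice[r1 Hr1] j : exists r, psi1 r = phi1 (cvX U_(j)) by apply: surj1.
  have /choice[r2 Hr2] j : exists r, psi2 r = phi2 (cvX U_(j)) by apply: surj2.
  have r10 j : r1 j 0%MM = 0.
    by rewrite -(lrm_const (theta1 \o psi1)) /= Hr1 (lrm_var0 (theta1 \o phi1)).
  have r20 j : r2 j 0%MM = 0.
    by rewrite -(lrm_const (theta2 \o psi2)) /= Hr2 (lrm_var0 (theta2 \o phi2)).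
  have [J HJ] := @cvps_inl_lrm C N1 N2; have [J' HJ'] := @cvps_inr_lrm C N1 N2.
  pose r (k : 'I_(n1 + n2)) :=
    match split k with inl i => J (r1 i) | inr i => J' (r2 i) end.
  have [|T HT] := @subst_exists _ _ _ r.
    by move=> k; rewrite /r; case: split => i; rewrite lrm_const.
  have SJ F : S (J F) = I (S1 F).
    apply: (@lrm_ext _ _ _ (S \o J) (I \o S1)) => i /=.
    by rewrite HJ cvps_inl_X SX1 HS1.
  have SJ' F : S (J' F) = I' (S2 F).
    apply: (@lrm_ext _ _ _ (S \o J') (I' \o S2)) => i /=.
    by rewrite HJ' cvps_inr_X SX2 HS2.
  exists (T h); apply/eqP; rewrite -subr_eq0 /= -lrB.
  have [Q HQ] := lrm_congr (S \o T) idfun h; rewrite [X in phi X]HQ lr_sum big1 // => k _.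
  rewrite lrM lrB /= HT /r -(splitK k) unsplitK; case: (split k) => i /=.
    rewrite SJ HI E1 phiS1 Hr1 -E1 cvps_inl_X subrr mul0r //.
  by rewrite SJ' HI' E2 phiS2 Hr2 -E2 cvps_inr_X subrr mul0r.
clearbody psi.
have model : monomial_model sum_color sum_exponent psi theta.
  split=> // [k|k|j].
  - rewrite -(splitK k); case: (split k) => i /=.
      rewrite psi1E T1 /= Htheta1 sum_color_l sum_exponent_l -!cvXn lrXn HL.
      by rewrite cvps_inl_X.
    rewrite psi2E T2 /= Htheta2 sum_color_r sum_exponent_r -!cvXn lrXn HL'.
    by rewrite cvps_inr_X.
  - by rewrite -(splitK k); case: (split k) => i /=; rewrite ?sum_exponent_l ?sum_exponent_r.
  rewrite big_split_ord /= -(splitK j); case: (split j) => i /=.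
    rewrite [X in gcdn _ X]big_pred0 => [|k]; last by rewrite sum_color_r eq_rlshift.
    rewrite gcdn0 -[RHS](gcd1 i); apply: eq_big => k; rewrite ?sum_exponent_l //.
    by rewrite sum_color_l eq_lshift.
  rewrite [X in gcdn X _]big_pred0 => [|k]; last by rewrite sum_color_l eq_lrshift.
  rewrite gcd0n -[RHS](gcd2 i); apply: eq_big => k; rewrite ?sum_exponent_r //.
  by rewrite sum_color_r eq_rshift.
exists psi, theta; split=> //; apply: (model_injective model) => // k k'.
rewrite -(splitK k) -(splitK k'); case: (split k) => i; case: (split k') => i' /=.
- rewrite !sum_color_l !sum_exponent_l !psi1E -!lrXn => /eqP; rewrite eq_lshift => /eqP cc.
  congr (pr1 _); apply: inj1; rewrite !lrXn !Htheta1 cc !cvXn; congr cvX.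
  by apply/mnmP => z; rewrite !mulmnE -!mulnA; congr (_ * _)%N; rewrite mulnC.
- by rewrite sum_color_l sum_color_r => /eqP; rewrite eq_lrshift.
- by rewrite sum_color_l sum_color_r => /eqP; rewrite eq_rlshift.
rewrite !sum_color_r !sum_exponent_r !psi2E -!lrXn => /eqP; rewrite eq_rshift => /eqP cc.
congr (pr2 _); apply: inj2; rewrite !lrXn !Htheta2 cc !cvXn; congr cvX.
by apply/mnmP => z; rewrite !mulmnE -!mulnA; congr (_ * _)%N; rewrite mulnC.
Qed.
End ProductModel.
End GermProduct.

Section ToricCurve.
Context {R : realType}.
Local Notation C := R[i]%C.

Section Ideal.
Context {n d : nat} (gamma : 'I_n -> 'rV[int]_d).

Lemma toric_ideal_wide (p : {mpoly C[n]}) k v : (msize p <= k)%N ->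
  \sum_(m <- msupp p | \sum_i gamma i *+ m i == v) p@_m =
  \sum_(m : 'X_{1..n < k} | \sum_i gamma i *+ m i == v) p@_m.
Proof.
move=> pk; rewrite big_mkcond [RHS]big_mkcond /=; set I : subFinType _ := 'X_{1..n < k}.
rewrite (big_mksub I) ?msupp_uniq //=; last by move=> x /msize_mdeg_lt /leq_trans; apply.
rewrite big_rmcond //= => m /memN_msupp_eq0 ->.
by case: ifP.
Qed.

Lemma toric_ideal_binomial (m m' : 'X_{1..n}) :
  \sum_i gamma i *+ m i = \sum_i gamma i *+ m' i ->
  toric_ideal (R := R) gamma ('X_[m] - 'X_[m']).
Proof.
move=> E v; set p := _ - _; pose k := (msize p + (mdeg m).+1 + (mdeg m').+1)%N.
have pk : (msize p <= k)%N by rewrite /k -addnA leq_addr.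
rewrite (toric_ideal_wide _ pk) /p; under eq_bigr do rewrite mcoeffB !mcoeffX.
have delta m1 : (mdeg m1 < k)%N ->
    \sum_(m0 : 'X_{1..n < k} | \sum_i gamma i *+ m0 i == v) (m1 == m0)%:R
    = (\sum_i gamma i *+ m1 i == v)%:R :> C.
  move=> m1k; rewrite big_mkcond (bigD1 (BMultinom m1k)) //= eqxx [X in _ + X]big1 => [|m0].
    by rewrite addr0; case: ifP.
  rewrite eq_sym => m0m; case: ifP => // _; case: eqP => // m1m0.
  by case/eqP: m0m; apply: val_inj.
by rewrite sumrB !delta ?E ?subrr // /k; lia.
Qed.

Lemma lrm_toric_ideal (gn : 'I_n -> 'X_{1..d}) (T : {lrmorphism cvps C n -> cvps C d})
    (wt : 'X_{1..d} -> 'rV[int]_d) p :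
  (forall i, T (cvX U_(i)) = cvX (gn i)) -> injective wt ->
  (forall m : 'X_{1..n}, wt (\sum_i gn i *+ m i)%MM = \sum_i gamma i *+ m i) ->
  toric_ideal gamma p -> T (cvps_of_mpoly p) = 0.
Proof.
move=> HT wt_inj Hwt Hp.
have E m : mmap1 (fun i => T (cvX U_(i))) m = cvX (\sum_i gn i *+ m i)%MM.
  by rewrite /mmap1 -cvX_sum; apply: eq_bigr => i _; rewrite HT cvXn.
apply: cvps_inj => a; rewrite cvc0.
pose k := (msize p + (mdeg a).+1)%N.
have ak : (mdeg a < k)%N by rewrite /k; lia.
rewrite (lrm_coef _ _ ak) -[RHS](Hp (wt a)) (toric_ideal_wide _ (leq_addr _ _ : _ <= k)%N).
rewrite [RHS]big_mkcond /=; apply: eq_bigr => m _.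
rewrite E cvcX -Hwt (inj_eq wt_inj).
by case: eqP => _; rewrite ?mulr1 ?mulr0.
Qed.
End Ideal.

(** Generators of opposite signs would span a line in the cone. *)
Lemma toric_curve_exponents n (gamma : 'I_n -> 'rV[int]_1) :
  strongly_convex (cone (R := R) gamma) -> (forall i, gamma i != 0) ->
  exists s : int, (s = 1 \/ s = -1) /\ forall i, gamma i ord0 ord0 = s * `|gamma i ord0 ord0|%N%:Z.
Proof.
move=> conv gamma0; have g0 i : gamma i ord0 ord0 != 0.
  apply: contra (gamma0 i) => /eqP E; apply/eqP/rowP => j.
  by rewrite (ord1 j) E mxE.
have in_cone i (t : R) : 0 <= t -> cone gamma (t *: map_mx intr (gamma i)).
  move=> t0; exists (fun k => if k == i then t else 0); split.
    by move=> k; case: ifP.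
  by rewrite (bigD1 i) //= eqxx big1 ?addr0 // => k /negbTE ->; rewrite scale0r.
case: (pickP (fun i => 0 < gamma i ord0 ord0)) => [i gi|none]; last first.
  exists (-1); split=> [|j]; first by right.
  by have := none j; have := g0 j; lia.
exists 1; split=> [|j]; first by left.
rewrite mul1r gez0_abs //; have [//|gj] := leP 0 (gamma j ord0 ord0).
have := conv _ (in_cone i (- (gamma j ord0 ord0)%:~R) _).
have -> : - (- (gamma j ord0 ord0)%:~R *: map_mx intr (gamma i) : 'rV[R]_1)
    = (gamma i ord0 ord0)%:~R *: map_mx intr (gamma j).
  by apply/rowP => k; rewrite !mxE (ord1 k) mulNr opprK mulrC.
move=> /(_ _ (in_cone j _ _)) H.
have /rowP/(_ ord0) : - (gamma j ord0 ord0)%:~R *: map_mx intr (gamma i) = 0 :> 'rV[R]_1.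
  by apply: H; rewrite ?oppr_ge0 ?ler0z ?lerz0 ltW.
move=> /eqP; rewrite !mxE mulf_eq0 oppr_eq0 !intr_eq0.
by rewrite !(negbTE (g0 _)).
Qed.

(** A zero generator gamma_i would send the unit z_i - 1 to zero. *)
Theorem toric_curve_model (A : comAlgType C) :
  (forall a b : A, a * b = 0 -> a = 0 \/ b = 0) -> toric_germ 1 A ->
  exists (n : nat) (g : 'I_n -> nat) (psi : {lrmorphism cvps C n -> A})
    (theta : {lrmorphism A -> cvps C 1}),
    monomial_model (fun _ => ord0) g psi theta /\ injective theta.
Proof.
move=> domainA [n [gamma [gen conv [phi [surj kerE]]]]].
have binomial (m m' : 'X_{1..n}) : \sum_i gamma i *+ m i = \sum_i gamma i *+ m' i ->
    phi (cvX m) = phi (cvX m').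
  move=> E; apply/eqP; rewrite -subr_eq0 -lrB; apply/eqP.
  have : kernel phi (cvps_of_mpoly ('X_[m] - 'X_[m'])).
    by rewrite kerE; apply: ideal_span_mem; exists ('X_[m] - 'X_[m']) => //;
      apply: toric_ideal_binomial.
  move=> <-; congr (phi _); apply: cvps_inj => a.
  by rewrite cvcB !cvcX /= mcoeffB !mcoeffX.
have sumU i : \sum_j gamma j *+ (U_(i)%MM : 'X_{1..n}) j = gamma i.
  rewrite (bigD1 i) //= mnm1E eqxx big1 ?addr0 // => j /negbTE ji.
  by rewrite mnm1E eq_sym ji.
have gamma0 i : gamma i != 0.
  apply/eqP => g0.
  have E : phi (cvX U_(i)) = 1.
    rewrite -(lr1 phi) -cvX0; apply: binomial.
    by rewrite sumU g0 big1 // => j _; rewrite mnm0E.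
  have [|u Hu] := @cvps_inverse_supp C n (fun=> True) I (fun _ _ _ _ => I)
    (cvX U_(i) - 1) _ (fun _ _ => I).
    by rewrite cvcB cvcX mnm1_eq0 cvc1 eqxx sub0r oppr_eq0 oner_neq0.
  move=> _; have := congr1 phi Hu; rewrite lrM lrB E lr1 subrr mul0r => /esym/eqP.
  by rewrite oner_eq0.
have [s [s1 gE]] := toric_curve_exponents conv gamma0.
pose g i := `|gamma i ord0 ord0|%N.
have g_gt0 i : (0 < g i)%N.
  rewrite absz_gt0; apply: contra (gamma0 i) => /eqP E; apply/eqP/rowP => j.
  by rewrite (ord1 j) E mxE.
have gammaE i : gamma i = const_mx (s * (g i)%:Z).
  by apply/rowP => j; rewrite (ord1 j) mxE gE.
pose wt (a : 'X_{1..1}) : 'rV[int]_1 := const_mx (s * (a ord0)%:Z).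
have wt_inj : injective wt.
  move=> a b /rowP/(_ ord0); rewrite !mxE => E; apply/mnmP => i; rewrite (ord1 i).
  by case: s1 E => ->; rewrite ?mul1r ?mulN1r; [|move/oppr_inj] => -[].
have Hwt (m : 'X_{1..n}) : wt (\sum_i (U_(ord0) *+ g i) *+ m i)%MM = \sum_i gamma i *+ m i.
  apply/rowP => k; rewrite (ord1 k) mxE summxE mnm_sumE.
  rewrite (big_morph Posz PoszD (erefl 0)) mulr_sumr; apply: eq_bigr => i _.
  rewrite gammaE !mulmnE mnm1E eqxx mul1n mulmxnE mxE PoszM mulrA.
  by rewrite -[in RHS]mulr_natr natz.
have [|T HT] := @subst_exists C n 1 (fun i => cvX (U_(ord0) *+ g i)).
  by move=> i; rewrite cvcX -mdeg_eq0 mdegMn mdeg1 mul1n gtn_eqF.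
have [F F0|theta Htheta] := lrm_factor (psi := T) surj.
  have : kernel phi F by [].
  rewrite kerE; apply: (@ideal_span_min _ _ [set x | T x = 0]) => [|_ [p Hp <-]] /=.
    split=> [|x y /= Tx Ty|x y /= Ty]; first exact: lr0.
      by rewrite lrD Tx Ty addr0.
    by rewrite lrM Ty mulr0.
  exact: lrm_toric_ideal HT wt_inj Hwt Hp.
have model : monomial_model (fun _ => ord0) g phi theta.
  split=> [a|i|//|j].
  - by have : (range phi)%classic a by [rewrite surj]; case=> F _ <-; exists F.
  - by rewrite Htheta HT.
  have [c Hc] := gen (const_mx 1).
  set e := \big[_/_]_(i | _) _.
  have eg i : (e %| g i)%N by apply: (@biggcdn_inf _ i) => //; rewrite (ord1 j).
  apply/eqP; rewrite -dvdn1.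
  have /rowP/(_ ord0) := Hc; rewrite mxE summxE => E1.
  have : (e%:Z %| 1%R)%Z.
    rewrite E1; apply: rpred_sum => i _.
    by rewrite -scaler_int mxE gE; apply/dvdz_mull/dvdz_mull/eg.
  by [].
exists n, g, phi, theta; split=> //.
apply: (model_injective model) => // i j _.
rewrite -!lrXn !cvXn; apply: binomial.
have sumUn l t : \sum_k gamma k *+ (U_(l) *+ t : 'X_{1..n})%MM k = gamma l *+ t.
  rewrite -(sumU l) -sumrMnl; apply: eq_bigr => k _.
  by rewrite mulmnE mulrnA.
rewrite !sumUn; apply/rowP => k; rewrite !mulmxnE !gammaE !mxE.
by rewrite -mulr_natr -[RHS]mulr_natr !natz -!mulrA; congr (_ * _); rewrite mulrC.
Qed.
End ToricCurve.

(** * The Lipschitz saturation of a monomial model *)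

Section Saturation.
Context {d N : nat} (c : 'I_N -> 'I_d) (g : 'I_N -> nat).

Definition gcd_upto (j : 'I_d) (a : nat) : nat :=
  \big[gcdn/0%N]_(i | (c i == j) && (g i <= a)%N) g i.

(** For d = 1 these are the exponents of the saturation, in the sense of
Zariski and of Pham and Teissier, of a monomial curve. *)
Definition saturated_at (j : 'I_d) (a : nat) : bool := (gcd_upto j a %| a)%N.
Definition saturated (m : 'X_{1..d}) : Prop := forall j, saturated_at j (m j).

Lemma gcd_upto_dvd j a i : c i = j -> (g i <= a)%N -> (gcd_upto j a %| g i)%N.
Proof. by move=> ci gi; apply: (@biggcdn_inf _ i); rewrite ?ci ?eqxx. Qed.

Lemma gcd_upto_leq j a b : (a <= b)%N -> (gcd_upto j b %| gcd_upto j a)%N.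
Proof.
move=> ab; apply/dvdn_biggcdP => i /andP[/eqP ci gi].
by apply: gcd_upto_dvd => //; apply: leq_trans ab.
Qed.

Lemma saturated_at0 j : saturated_at j 0. Proof. exact: dvdn0. Qed.

Lemma saturated_atD j a b : saturated_at j a -> saturated_at j b -> saturated_at j (a + b).
Proof.
move=> Sa Sb; apply: dvdn_add.
  by apply: dvdn_trans Sa; apply: gcd_upto_leq; rewrite leq_addr.
by apply: dvdn_trans Sb; apply: gcd_upto_leq; rewrite leq_addl.
Qed.

Lemma saturated_at_gen i : saturated_at (c i) (g i).
Proof. exact: gcd_upto_dvd. Qed.

Lemma saturated0 : saturated 0%MM.
Proof. by move=> j; rewrite mnm0E saturated_at0. Qed.

Lemma saturatedD a b : saturated a -> saturated b -> saturated (a + b)%MM.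
Proof. by move=> Sa Sb j; rewrite mnmDE saturated_atD. Qed.

Hypothesis gcd1 : forall j, \big[gcdn/0%N]_(i | c i == j) g i = 1%N.

Definition conductor : nat := (\sum_i g i)%N.

Lemma gcd_upto_conductor j a : (conductor <= a)%N -> gcd_upto j a = 1%N.
Proof.
move=> ca; rewrite -[RHS](gcd1 j); apply: eq_bigl => i.
rewrite andb_idr // => _; apply: leq_trans ca.
by rewrite /conductor (bigD1 i) //= leq_addr.
Qed.

Lemma saturated_at_conductor j a : (conductor <= a)%N -> saturated_at j a.
Proof. by move=> ca; rewrite /saturated_at gcd_upto_conductor ?dvd1n. Qed.
End Saturation.

(** A primitive root of unity, or 0 if e = 0. *)
Lemma root_detecting_dvdn (R : realType) (e : nat) :
  exists z : R[i]%C, forall a : nat, (z ^+ a == 1) = (e %| a)%N.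
Proof.
have [->|e_gt0] := posnP e.
  by exists 0 => a; rewrite expr0n dvd0n; case: (a == 0)%N; rewrite ?eqxx // eq_sym oner_eq0.
pose p : {poly R[i]%C} := 'X^e - 1; have [r Dp] := closed_field_poly_normal p.
rewrite (monicP _) ?monicXnsubC // scale1r in Dp.
have rn1 : all e.-unity_root r by apply/allP => z; rewrite -root_prod_XsubC -Dp.
have sz_r : (e < (size r).+1)%N.
  by rewrite -(size_prod_XsubC r id) -Dp size_XnsubC.
have [|z _ Hz] := hasP (has_prim_root e_gt0 rn1 _ sz_r).
  by rewrite -separable_prod_XsubC -Dp separable_Xn_sub_1 // pnatr_eq0 -lt0n.
by exists z => a; rewrite (prim_order_dvd Hz).
Qed.

Section LipschitzSaturation.
Context {R : realType} {d N : nat} {A S : comAlgType R[i]%C}.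
Local Notation C := R[i]%C.
Variables (c : 'I_N -> 'I_d) (g : 'I_N -> nat).
Variables (psi : {lrmorphism cvps C N -> A}) (theta : {lrmorphism A -> cvps C d}).
Hypothesis model : monomial_model c g psi theta.
Hypothesis theta_inj : injective theta.
Local Notation sat := (saturated c g).

Lemma model_supp a : supp_in sat (theta a).
Proof.
have [surj Htheta _ _] := model; have [F <-] := surj a.
apply: (@supp_in_lrm C d sat (@saturated0 _ _ c g) (@saturatedD _ _ c g) N (theta \o psi)) => i /=.
rewrite Htheta; apply: supp_inX => j; rewrite mulmnE mnm1E.
case: eqP => [<-|_]; first by rewrite mul1n; apply: saturated_at_gen.
by rewrite mul0n; apply: saturated_at0.
Qed.

Lemma rescaling (j : 'I_d) (z : C) : exists D : {lrmorphism cvps C d -> cvps C d},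
  forall F m, D F m = z ^+ m j * F m.
Proof.
pose w (i : 'I_d) := if i == j then z else 1.
have [|D HD] := @subst_exists C d d (fun i => w i *: cvX U_(i)).
  by move=> i; rewrite cvcZ cvcX mnm1_eq0 mulr0.
exists D => F m; rewrite (lrm_coef _ _ (ltnSn _)).
have E m' : mmap1 (fun i => D (cvX U_(i))) m' = z ^+ m' j *: cvX m'.
  rewrite /mmap1 (eq_bigr (fun i => (w i ^+ m' i)%:A * cvX U_(i) ^+ m' i)).
    rewrite big_split /= -cvXE -mulr_algl; congr (_ * _).
    rewrite (bigD1 j) //= big1 => [|i ij]; first by rewrite /w eqxx mulr1.
    by rewrite /w (negbTE ij) expr1n scale1r.
  by move=> i _; rewrite HD exprZn mulr_algl.
rewrite (bigD1 (BMultinom (ltnSn (mdeg m)))) //= E cvcZ cvcX eqxx mulr1 mulrC.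
rewrite big1 ?addr0 // => m' mm'; rewrite E cvcZ cvcX.
case: (bmnm m' =P m) => [e|_]; last by rewrite !mulr0.
by case/eqP: mm'; apply: val_inj.
Qed.

(** A series with saturated exponents is a combination of finitely many
saturated monomials x^r with coefficients in A, and for each factor x_j^(r j)
integrality is that of X^a - Y^a. Products preserve it because f(x)g(x) -
f(y)g(y) lies in the ideal generated by the differences of f and of g. *)
Theorem lipschitz_saturation_model : is_lipschitz_saturation A S ->
  exists tau : {lrmorphism S -> cvps C d},
    injective tau /\ forall F, (exists s, tau s = F) <-> supp_in sat F.
Proof.
move=> [B [P [Q [nu [p1 [p2 [q [sigma [norm [prod _ kerq] sigma_inj range_sigma]]]]]]]]].
have [surj Htheta g_gt0 gcd1] := model.
have [beta [beta_inj beta_surj beta_nu]] := normalization_of_model model theta_inj norm.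
set I := kernel q in kerq range_sigma.
have genI a : I (p1 (nu a) - p2 (nu a)).
  by rewrite kerq; apply: ideal_span_mem; exists a.
exists (beta \o sigma); split; first by apply: inj_comp.
have rangeE b : (exists s, sigma s = b) <-> integral_closure I (p1 b - p2 b).
  have -> : integral_closure I (p1 b - p2 b) = (range sigma)%classic b by rewrite range_sigma.
  by split=> [[s <-]|[s _ <-]]; exists s.
move=> F; have [b Eb] := beta_surj F.
have -> : (exists s, (beta \o sigma) s = F) <-> (exists s, sigma s = b).
  split=> -[s Hs]; exists s; last by rewrite /= Hs.
  by apply: beta_inj; rewrite Eb -Hs.
rewrite rangeE; split=> [int_b m Fm j|satF]; last first.
  apply: rees_integral_closure.
  pose L x := rees_integral I (p1 x - p2 x).
  have LM x y : L x -> L y -> L (x * y).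
    move=> Lx Ly; rewrite /L !lrM.
    have -> : p1 x * p1 y - p2 x * p2 y = p1 x * (p1 y - p2 y) + p2 y * (p1 x - p2 x) by ring.
    by apply: rees_integralD; apply: rees_integralM.
  have L1 : L 1 by rewrite /L !lr1 subrr; apply: rees_integral0.
  have Lnu a : L (nu a) by apply: rees_integral_mem.
  have /choice[x Hx] j : exists x, beta x = cvX U_(j) by apply: beta_surj.
  have Lx j a : saturated_at c g j a -> L (x j ^+ a).
    move=> sat_a; rewrite /L !lrXn.
    apply: (diff_integral_saturation (P := fun i => c i == j) (g := g)) => // i /eqP ci.
    suff -> : p1 (x j) ^+ g i - p2 (x j) ^+ g i
        = p1 (nu (psi (cvX U_(i)))) - p2 (nu (psi (cvX U_(i)))) by apply: genI.
    rewrite -!lrXn; have -> // : x j ^+ g i = nu (psi (cvX U_(i))).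
    by apply: beta_inj; rewrite lrXn Hx cvXn beta_nu Htheta ci.
  have [M [P' [iota [M_gt0 HP' HiP]]]] := model_power_map model.
  have [G [EG HG]] := cvps_residues (conductor g) M_gt0 F HP'.
  have -> : b = \sum_r (\prod_j x j ^+ residue_exp r j) * nu (iota (G r)).
    apply: beta_inj; rewrite Eb lr_sum [LHS]EG; apply: eq_bigr => r _.
    rewrite lrM beta_nu HiP cvXE lr_prod; congr (_ * _).
    by apply: eq_bigr => j _; rewrite lrXn Hx.
  rewrite !lr_sum -sumrB; apply: rees_integral_sum => r _; rewrite -/(L _).
  have [->|G0] := eqVneq (G r) 0.
    by rewrite !lr0 mulr0 /L !lr0 subrr; apply: rees_integral0.
  apply: (LM) => //; apply: (big_ind L L1 LM) => j _; apply: Lx.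
  have [t [Gt min_t]] := lead_exists G0; have [satrt Hrt] := HG _ _ Gt.
  have [tj|] := Hrt j.
    by have := satF _ satrt j; rewrite mnmDE mulmnE tj mul0n addn0.
  by rewrite mnmE; apply: saturated_at_conductor.
(* chi restricts to the graph of x_j |-> z x_j; it maps I, but not p1 b - p2 b,
   to series divisible by x_j^(m j + 1) *)
apply/negPn/negP => nsat; set e := gcd_upto c g j (m j) in nsat.
have [z Hz] := root_detecting_dvdn R e; have [D HD] := rescaling j z.
have [chi [chi1 chi2]] := germ_product_lift beta (D \o beta) prod.
have chiI x : I x -> ord_ge j (m j).+1 (chi x).
  rewrite kerq.
  apply: (@ideal_span_min _ _ [set x | ord_ge j (m j).+1 (chi x)]) => [|y [a _ <-]] /=.
    have [J0 JD JM] := @ord_ge_ideal C d j (m j).+1.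
    split=> [|u v /= Hu Hv|u v /= Hv]; first by rewrite /= lr0; apply: J0.
      by rewrite lrD; apply: JD.
    by rewrite lrM; apply: JM.
  rewrite lrB chi1 chi2 /= beta_nu => m'; rewrite cvcB HD -{1}[theta a m']mul1r -mulrBl.
  rewrite mulf_eq0 negb_or subr_eq0 eq_sym Hz => /andP[nz /model_supp/(_ j) sat'].
  rewrite ltnNge; apply: contra nz => m'm.
  by apply: dvdn_trans sat'; apply: gcd_upto_leq.
have : ord_ge j (m j).+1 (chi (p1 b - p2 b)).
  exact: (ord_ge_integral_closure (chi := chi)) chiI _ int_b.
rewrite lrB chi1 chi2 /= Eb.
move/(_ m); rewrite cvcB HD -{1}[F m]mul1r -mulrBl mulf_eq0 negb_or Fm andbT subr_eq0 eq_sym Hz.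
by move/(_ nsat); rewrite ltnn.
Qed.
End LipschitzSaturation.

(** * Numerical semigroups of Arf type *)

Section Arf.
Local Open Scope nat_scope.
Variables (G : pred nat) (e cond : nat).

(** Closure under a + b - e is Arf's condition (x + y - z belongs to the
semigroup when x, y >= z do) for the least positive element z = e. *)
Definition arf_semigroup : Prop :=
  [/\ (0 < e)%N, G 0%N /\ G e, forall a, G a -> a = 0%N \/ (e <= a)%N,
      forall a b, G a -> G b -> G (a + b)%N &
      (forall a b, G a -> G b -> (0 < a)%N -> (0 < b)%N -> G (a + b - e)%N) /\
      forall a, (cond <= a)%N -> G a].

Let step (a k : nat) : bool := (k * e < a)%N && G (a - k * e).

(** In such a semigroup, a sum of k + 1 positive elements becomes a positive
element when e is subtracted k times. So this is the largest k such that a is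
a sum of k positive elements. *)
Definition arf_order (a : nat) : nat := find (predC (step a)) (iota 0 a.+1).

Hypothesis arf : arf_semigroup.

Lemma arf_step_down a k l : (l <= k)%N -> step a k -> step a l.
Proof.
have [e_gt0 [_ Ge] _ GD _] := arf => lk /andP[ka Gk].
have lka : (l * e <= k * e)%N by rewrite leq_mul2r lk orbT.
rewrite /step (leq_ltn_trans lka ka) /=.
have -> : (a - l * e = (a - k * e) + (k - l) * e)%N.
  by rewrite mulnBl; move: ka lka; lia.
apply: (GD) => //; elim: (k - l)%N => [|t IH]; first by case: arf => _ [].
by rewrite mulSn; apply: (GD).
Qed.

Lemma arf_orderP a k : (k < arf_order a)%N = step a k.
Proof.
have [e_gt0 _ _ _ _] := arf.
have hasN : has (predC (step a)) (iota 0 a.+1).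
  apply/hasP; exists a; first by rewrite mem_iota add0n ltnSn.
  by rewrite /= /step negb_and -leqNgt leq_pmulr.
have lt_v : (arf_order a < a.+1)%N by rewrite /arf_order -[X in (_ < X)%N](size_iota 0) -has_find.
apply/idP/idP => [kv|].
  have := before_find 0%N kv; rewrite nth_iota ?add0n /=; last exact: ltn_trans lt_v.
  by move/negbFE.
rewrite ltnNge; apply: contraL => vk; have := nth_find 0%N hasN.
rewrite -/(arf_order a) nth_iota //= add0n; apply: contra.
exact: arf_step_down.
Qed.

Lemma arf_order0 : arf_order 0 = 0%N.
Proof. by apply/eqP; rewrite -leqn0 leqNgt arf_orderP /step. Qed.

Lemma arf_order_gt0 a : G a -> (0 < a)%N -> (0 < arf_order a)%N.
Proof. by move=> Ga a_gt0; rewrite arf_orderP /step mul0n a_gt0 subn0. Qed.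

Lemma arf_order_mem a : (0 < arf_order a)%N -> G a.
Proof. by rewrite arf_orderP /step mul0n subn0 => /andP[]. Qed.

Lemma arf_order_eq0 a : G a -> (arf_order a == 0%N) = (a == 0%N).
Proof.
move=> Ga; apply/eqP/eqP => [v0|->]; last exact: arf_order0.
by apply/eqP; rewrite -leqn0 leqNgt; apply/negP => /(arf_order_gt0 Ga); rewrite v0.
Qed.

Lemma arf_orderD a b : G a -> G b ->
  (arf_order a + arf_order b <= arf_order (a + b))%N.
Proof.
have [e_gt0 _ Ge GD [Garf _]] := arf => Ga Gb.
have [->|a_gt0] := posnP a; first by rewrite arf_order0.
have [->|b_gt0] := posnP b; first by rewrite arf_order0 !addn0.
have va := arf_order_gt0 Ga a_gt0; have vb := arf_order_gt0 Gb b_gt0.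
have : step a (arf_order a).-1 by rewrite -arf_orderP prednK.
have : step b (arf_order b).-1 by rewrite -arf_orderP prednK.
move: (arf_order a) (arf_order b) va vb => [//|k] [//|l] _ _ /andP[/= lb Gl] /andP[/= ka Gk].
rewrite addSn addnS arf_orderP /step.
have := Garf _ _ Gk Gl ltac:(by rewrite subn_gt0) ltac:(by rewrite subn_gt0).
have [|ek] := Ge _ Gk; first by move: ka; lia.
have [|el] := Ge _ Gl; first by move: lb; lia.
rewrite mulSn mulnDl; move: (k * e)%N (l * e)%N ka lb ek el => x y ka lb ek el.
have -> : (a - x + (b - y) - e = a + b - (e + (x + y)))%N by lia.
by move=> ->; rewrite andbT; lia.
Qed.

Lemma arf_order_bound a k : (arf_order a <= k)%N -> (a <= cond + k * e)%N.
Proof.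
have [e_gt0 _ _ _ [_ Gcond]] := arf.
rewrite leqNgt arf_orderP /step; apply: contraR; rewrite -ltnNge => ak.
by rewrite Gcond ?andbT; move: ak; move: (k * e)%N => x; lia.
Qed.

Lemma arf_order_split a k : arf_order a = k.+1 -> exists b,
  [/\ G b, (0 < b)%N, (b <= cond + e)%N, (b <= a)%N & G (a - b)%N /\ (k <= arf_order (a - b))%N].
Proof.
have [e_gt0 [G0 Ge] _ _ _] := arf => va.
have Ga : G a by apply: arf_order_mem; rewrite va.
case: k va => [|k] va.
  exists a; split=> //; last by rewrite subnn.
    by case: (a) va => //; rewrite arf_order0.
  by have := arf_order_bound (eq_leq va); rewrite mul1n.
have /andP[] : step a k.+1 by rewrite -arf_orderP va.
rewrite mulSn => ka Gk.
have /andP[e_a Ga'] : step a 1 by apply: (@arf_step_down _ k.+1) => //; rewrite /step mulSn ka.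
rewrite mul1n in e_a Ga'; exists e; split=> //; [exact: leq_addl|exact: ltnW|].
split=> //; rewrite arf_orderP /step -subnDA Gk andbT.
by move: ka; move: (k * e)%N => x; lia.
Qed.

Lemma count_shift (P : pred nat) (B k : nat) : (k <= B)%N ->
  (\sum_(a < B) ((k < a) && P (a - k)) = \sum_(a < B - k) ((0 < a) && P a))%N.
Proof.
move=> kB; rewrite -(big_mkord xpredT (fun a => ((k < a) && P (a - k)%N) : nat)).
rewrite (big_cat_nat (n := k)) //= big_nat_cond big1 ?add0n; last first.
  by move=> i /andP[/andP[_ ik] _]; rewrite ltnNge (ltnW ik).
rewrite -{1}[k]add0n big_addn big_mkord; apply: eq_bigr => i _.
by rewrite addnK -{1}[k]add0n ltn_add2r.
Qed.

Lemma arf_count0 B : (0 < B)%N -> (\sum_(a < B) (G a && (arf_order a == 0)) = 1)%N.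
Proof.
case: B => // B _; have [_ [G0 _] _ _ _] := arf.
rewrite big_ord_recl /= G0 arf_order0 eqxx big1 // => i _.
by case: (boolP (G _)) => // Gi; rewrite arf_order_eq0.
Qed.

(** Subtracting e as often as possible leaves one positive element of order 1
in each residue class modulo e. The proof compares the numbers of elements
below B of orders > k and > k + 1, two truncations of the same semigroup at
bounds that differ by e. *)
Lemma arf_countS B k : (cond + k.+1 * e < B)%N ->
  (\sum_(a < B) (G a && (arf_order a == k.+1)) = e)%N.
Proof.
have [e_gt0 _ _ _ [_ Gcond]] := arf => HB.
pose n l := (\sum_(a < B) (l < arf_order a))%N.
have nE l : (l * e <= B)%N -> n l = (\sum_(a < B - l * e) ((0 < a) && G a))%N.
  move=> lB; rewrite -count_shift //; apply: eq_bigr => a _.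
  by rewrite arf_orderP.
have E : n k = (\sum_(a < B) (G a && (arf_order a == k.+1)) + n k.+1)%N.
  rewrite /n -big_split; apply: eq_bigr => a _ /=.
  case: (ltngtP (arf_order a) k.+1) => [va|va|va].
  - by rewrite andbF.
  - by rewrite andbF.
  - by rewrite arf_order_mem // va.
have HB' := HB; rewrite mulSn in HB'.
have kB : (k * e <= B)%N by move: HB'; move: (k * e)%N => x; lia.
have kB' : (k.+1 * e <= B)%N by move: HB; move: (k.+1 * e)%N => x; lia.
have E2 : n k = (n k.+1 + e)%N.
  rewrite !nE //.
  have -> : (B - k * e = (B - k.+1 * e) + e)%N.
    by rewrite mulSn; move: HB'; move: (k * e)%N => x; lia.
  rewrite big_split_ord /=; congr (_ + _)%N.
  rewrite (eq_bigr (fun=> 1%N)) ?sum1_card ?card_ord // => i _.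
  rewrite Gcond ?andbT; last by move: HB; move: (k.+1 * e)%N => x; lia.
  by rewrite addn_gt0 subn_gt0; move: HB; move: (k.+1 * e)%N => x; lia.
by move: E; rewrite E2 addnC; lia.
Qed.

Lemma arf_count_lt B k : (cond + k * e < B)%N ->
  (\sum_(a < B) (G a && (arf_order a < k.+1)) = 1 + e * k)%N.
Proof.
elim: k => [|k IH] HB.
  rewrite muln0 addn0 -[RHS](@arf_count0 B); last by move: HB; lia.
  by apply: eq_bigr => a _; rewrite ltnS leqn0.
have HB' := HB; rewrite mulSn in HB'.
rewrite mulnS addnCA -IH; last by move: HB'; move: (k * e)%N => x; lia.
rewrite -{1}(arf_countS HB) -big_split; apply: eq_bigr => a _ /=.
by case: (G a) => //=; rewrite ltnS leq_eqVlt; case: eqP => [->|_]; rewrite ?ltnn.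
Qed.
End Arf.

(** * Powers of the maximal ideal of a monomial algebra *)

Section MonomialAlgebra.
Context {K : numFieldType} {d : nat} {S : comAlgType K}.
Variables (G : 'I_d -> pred nat) (e cond : 'I_d -> nat).
Hypothesis arf : forall j, arf_semigroup (G j) (e j) (cond j).
Variable tau : {lrmorphism S -> cvps K d}.
Hypothesis tau_inj : injective tau.

Definition exponents (m : 'X_{1..d}) : Prop := forall j, G j (m j).

Hypothesis tau_range : forall F, (exists s, tau s = F) <-> supp_in exponents F.

Definition total_order (m : 'X_{1..d}) : nat := (\sum_j arf_order (G j) (e j) (m j))%N.

Definition order_ge (k : nat) (m : 'X_{1..d}) : Prop := exponents m /\ (k <= total_order m)%N.

Lemma exponents0 : exponents 0%MM.
Proof. by move=> j; rewrite mnm0E; case: (arf j) => _ []. Qed.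

Lemma exponentsD a b : exponents a -> exponents b -> exponents (a + b)%MM.
Proof. by move=> Ga Gb j; rewrite mnmDE; case: (arf j) => _ _ _ GD _; apply: GD. Qed.

Lemma total_orderD a b : exponents a -> exponents b ->
  (total_order a + total_order b <= total_order (a + b)%MM)%N.
Proof.
move=> Ga Gb; rewrite -big_split; apply: leq_sum => j _ /=.
by rewrite mnmDE; apply: arf_orderD (arf j) _ _ _ _.
Qed.

Lemma order_geD k l a b : order_ge k a -> order_ge l b -> order_ge (k + l) (a + b)%MM.
Proof.
move=> [Ga ka] [Gb lb]; split; first exact: exponentsD.
by apply: leq_trans (total_orderD Ga Gb); apply: leq_add.
Qed.

Lemma total_order_gt0 m : exponents m -> m != 0%MM -> (0 < total_order m)%N.
Proof.
move=> Gm m0; have [j mj] : exists j, (0 < m j)%N.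
  apply: contrapT => none; case/eqP: m0; apply/mnmP => j; rewrite mnm0E.
  by apply/eqP; rewrite -leqn0 leqNgt; apply/negP => mj; apply: none; exists j.
by rewrite /total_order (bigD1 j) //= addn_gt0 (arf_order_gt0 (arf j)).
Qed.

Lemma tau_supp s : supp_in exponents (tau s).
Proof. by apply/tau_range; exists s. Qed.

Lemma order_geM k l F H : supp_in (order_ge k) F -> supp_in (order_ge l) H ->
  supp_in (order_ge (k + l)) (F * H : cvps K d).
Proof.
by move=> HF HH m /cvcM_neq0[a [b [-> /HF Ha /HH Hb]]]; apply: order_geD.
Qed.

Lemma tau_order_ge0 s : supp_in (order_ge 0) (tau s).
Proof. by move=> m /tau_supp. Qed.

(** The inverse of a series with nonzero constant term has its exponents in
the monoid generated by those of the series. *)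
Lemma nonunitsE s : nonunits s <-> supp_in (order_ge 1) (tau s).
Proof.
split=> [nu m Hm|Hs [t st]]; last first.
  have := congr1 (fun F : cvps K d => cvcoef F 0%MM) (congr1 tau st).
  rewrite lrM lr1 cvcM0 cvc1 eqxx.
  have [->|/Hs[_]] := eqVneq (tau s 0%MM) 0; first by rewrite mul0r => /esym/eqP; rewrite oner_eq0.
  by rewrite /total_order big1 // => j _; rewrite mnm0E (arf_order0 (arf j)).
split; first exact: (tau_supp Hm).
apply: total_order_gt0 (tau_supp Hm) _; apply: contraPneq nu => m0 nu; apply: nu.
rewrite m0 in Hm.
have [F sF GF] := cvps_inverse_supp exponents0 exponentsD Hm (@tau_supp s).
have [t Et] : exists t, tau t = F by apply/tau_range.
by exists t; apply: tau_inj; rewrite lrM Et sF lr1.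
Qed.

Lemma order_ge_ideal k : is_ideal [set s | supp_in (order_ge k) (tau s)].
Proof.
split=> [|s t /= Hs Ht|s t /= Ht].
- by rewrite /= lr0; apply: supp_in0.
- by rewrite lrD; apply: supp_inD.
- by rewrite lrM -[k]add0n; apply: order_geM => //; apply: tau_order_ge0.
Qed.

(** The exponents t that are split off are bounded, hence finitely many: this
is the finite generation of the powers of the maximal ideal. *)
Lemma order_ge_split k m : order_ge k.+1 m -> exists j t,
  [/\ G j t, (0 < t)%N, (t <= cond j + e j)%N & exists2 m', m = (U_(j) *+ t + m')%MM & order_ge k m'].
Proof.
move=> [Gm km]; have [j vj] : exists j, (0 < arf_order (G j) (e j) (m j))%N.
  apply: contrapT => none; move: km; rewrite /total_order big1 // => j _.
  by apply/eqP; rewrite -leqn0 leqNgt; apply/negP => vj; apply: none; exists j.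
have [t [Gt t_gt0 tc tm [Gmt vmt]]] := arf_order_split (arf j) (esym (prednK vj)).
exists j, t; split=> //; exists (m - U_(j) *+ t)%MM.
  rewrite addmC submK //; apply/mnm_lepP => i; rewrite mulmnE mnm1E.
  by case: eqP => [<-|_]; rewrite ?mul1n ?mul0n.
have mi i : i != j -> (m - U_(j) *+ t)%MM i = m i.
  by move=> /negbTE ij; rewrite mnmBE mulmnE mnm1E eq_sym ij mul0n subn0.
have mj : (m - U_(j) *+ t)%MM j = (m j - t)%N by rewrite mnmBE mulmnE mnm1E eqxx mul1n.
split=> [i|].
  by have [->|/mi ->] := eqVneq i j; rewrite ?mj.
rewrite /total_order (bigD1 j) //= mj.
move: km; rewrite /total_order (bigD1 j) //= => km.
rewrite (eq_bigr (fun i => arf_order (G i) (e i) (m i))); last by move=> i /mi ->.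
by move: km vj vmt; lia.
Qed.

Theorem ideal_exp_nonunits k s :
  ideal_exp nonunits k s <-> supp_in (order_ge k) (tau s).
Proof.
elim: k s => [|k IH] s; first by split=> // _; apply: tau_order_ge0.
split.
  move: s; apply: ideal_span_min; first exact: order_ge_ideal.
  move=> _ [x /nonunitsE Hx [y /IH Hy <-]] /=.
  by rewrite lrM -add1n; apply: order_geM.
move=> Hs; pose B := (\sum_j (cond j + e j)).+1%N.
pose ex (jt : 'I_d * 'I_B) : 'X_{1..d} := (U_(jt.1) *+ jt.2)%MM.
pose ok (m : 'X_{1..d}) (jt : 'I_d * 'I_B) : Prop :=
  [/\ G jt.1 jt.2, (0 < jt.2)%N & exists2 m', m = (ex jt + m')%MM & order_ge k m'].
pose pk (m : 'X_{1..d}) : option ('I_d * 'I_B) := [pick jt | `[< ok m jt >]].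
have [m Fm|H [EH HH]] := @cvps_split K d _ ex pk (tau s).
  rewrite /pk; case: pickP => [jt /asboolP[_ _ [m' -> _]]|none].
    by exists jt => //; apply: lem_addr.
  have [j [t [Gt t_gt0 tc Hm']]] := order_ge_split (Hs _ Fm).
  have tB : (t < B)%N.
    by rewrite ltnS (leq_trans tc) // (bigD1 j) //= leq_addr.
  by have /asboolP[] := none (j, Ordinal tB); split.
have okH jt q : H jt q != 0 -> [/\ G jt.1 jt.2, (0 < jt.2)%N & order_ge k q].
  rewrite HH; case: (_ =P Some jt) => [+ _|_]; last by rewrite eqxx.
  rewrite /pk; case: pickP => [jt' /asboolP ok' [Ejt]|//].
  by move: ok'; rewrite Ejt => -[Gt t0 [m' /addmI <- Hm']]; split.
have /choice[h Hh] jt : exists h, tau h = H jt.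
  by apply/tau_range => q /okH[_ _ []].
have /choice[y Hy] jt : exists y, H jt = 0 \/ tau y = cvX (ex jt) /\ nonunits y.
  have [->|/lead_exists[q [/okH[Gt t_gt0 _] _]]] := eqVneq (H jt) 0; first by exists 0; left.
  have [y Ey] : exists y, tau y = cvX (ex jt).
    apply/tau_range; apply: supp_inX => i; rewrite mulmnE mnm1E.
    case: eqP => [<-|_]; first by rewrite mul1n.
    by rewrite mul0n; case: (arf i) => _ [].
  exists y; right; split=> //; apply/nonunitsE; rewrite Ey; apply: supp_inX.
  have Gex : exponents (ex jt).
    by have := tau_supp (s := y); rewrite Ey => /(_ (ex jt)); apply; rewrite cvcX eqxx oner_neq0.
  split=> //; apply: total_order_gt0 => //.
  by rewrite -mdeg_eq0 mdegMn mdeg1 mul1n -lt0n.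
have -> : s = \sum_jt y jt * h jt.
  apply: tau_inj; rewrite lr_sum EH; apply: eq_bigr => jt _; rewrite lrM Hh.
  by have [->|[-> _]] := Hy jt; rewrite ?mulr0.
apply: is_ideal_sum => [|jt _]; first exact: ideal_span_is_ideal.
have [H0|[_ ny]] := Hy jt.
  have -> : h jt = 0 by apply: tau_inj; rewrite Hh H0 lr0.
  by rewrite mulr0; case: (@ideal_exp_is_ideal S nonunits k.+1).
apply: ideal_span_mem; exists (y jt) => //; exists (h jt) => //.
by apply/IH; rewrite Hh => q /okH[].
Qed.

(** Coordinates in U/W are coefficients. *)
Lemma monomial_quot_dim (pU pW : 'X_{1..d} -> Prop) (U W : set S) (L : seq 'X_{1..d}) :
  (forall s, U s <-> supp_in pU (tau s)) -> (forall s, W s <-> supp_in pW (tau s)) ->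
  (forall m, pU m -> exponents m) -> uniq L ->
  (forall m, m \in L <-> pU m /\ ~ pW m) ->
  has_quot_dim U W (size L).
Proof.
move=> HU HW pUG uniqL HL; pose el (i : 'I_(size L)) := tnth (in_tuple L) i.
have elL i : el i \in L by apply: mem_tnth.
have el_inj : injective el.
  move=> i j /eqP; rewrite /el !(tnth_nth 0%MM) /= nth_uniq ?ltn_ord // => /eqP.
  exact: val_inj.
have pUel i : pU (el i) by have /HL[] := elL i.
have pWel i : ~ pW (el i) by have /HL[] := elL i.
have /choice[b Hb] i : exists b, tau b = cvX (el i).
  by apply/tau_range; apply: supp_inX; apply: pUG (pUel i).
exists b; split=> [i|x /HU Hx]; first by apply/HU; rewrite Hb; apply: supp_inX.
have sumE (c : {ffun 'I_(size L) -> K}) m :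
    tau (\sum_i c i *: b i) m = \sum_i c i * (el i == m)%:R.
  by rewrite lr_sum cvc_sum; apply: eq_bigr => i _; rewrite lrZ Hb cvcZ cvcX.
have sum_el (c : {ffun 'I_(size L) -> K}) i : tau (\sum_i c i *: b i) (el i) = c i.
  rewrite sumE (bigD1 i) //= eqxx mulr1 big1 ?addr0 // => j ji.
  by rewrite (inj_eq el_inj) (negbTE ji) mulr0.
exists [ffun i => tau x (el i)]; split=> [|c /HW Hc].
  apply/HW => m; rewrite lrB cvcB => nz.
  have [mL|mL] := boolP (m \in L).
    have [i Ei] : exists i, el i = m.
      by have /tnthP[i ->] : m \in in_tuple L by []; exists i.
    by rewrite -Ei sum_el ffunE subrr eqxx in nz.
  have sum0 : tau (\sum_i [ffun i => tau x (el i)] i *: b i) m = 0.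
    rewrite sumE big1 // => i _; case: eqP => [E|_]; last by rewrite mulr0.
    by rewrite -E elL in mL.
  move: nz; rewrite sum0 subr0 => /Hx pUm; apply: contrapT => npW.
  by case/negP: mL; apply/HL.
apply/ffunP => i; rewrite ffunE; apply/eqP; rewrite -subr_eq0 -(sum_el c i) -cvcB -lrB.
by apply/negPn/negP => /Hc/pWel.
Qed.
End MonomialAlgebra.

(** * Embedding dimension and multiplicity *)

Section Counting.

Lemma count_iota (P : pred nat) B : count P (iota 0 B) = (\sum_(a < B) P a)%N.
Proof.
rewrite -sum1_count big_mkcond -(big_mkord xpredT (fun a => P a : nat)) /index_iota subn0.
by apply: eq_bigr => a _; case: (P a).
Qed.

Section Pairs.
Context {G1 G2 : pred nat} {e1 e2 cond1 cond2 : nat}.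
Hypothesis arf1 : arf_semigroup G1 e1 cond1.
Hypothesis arf2 : arf_semigroup G2 e2 cond2.
Local Notation v1 := (arf_order G1 e1).
Local Notation v2 := (arf_order G2 e2).

Lemma pair_count1 B : (cond1 + e1 < B)%N -> (cond2 + e2 < B)%N ->
  (\sum_(a < B) \sum_(b < B) [&& G1 a, G2 b & v1 a + v2 b == 1] = e1 + e2)%N.
Proof.
move=> B1 B2; have B_gt0 : (0 < B)%N by lia.
have n10 := arf_count0 arf1 B_gt0; have n20 := arf_count0 arf2 B_gt0.
have n11 := @arf_countS _ _ _ arf1 B 0 ltac:(by rewrite mul1n).
have n21 := @arf_countS _ _ _ arf2 B 0 ltac:(by rewrite mul1n).
transitivity (\sum_(a < B) \sum_(b < B)
    ((G1 a && (v1 a == 1)) * (G2 b && (v2 b == 0)) +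
     (G1 a && (v1 a == 0)) * (G2 b && (v2 b == 1))))%N.
  apply: eq_bigr => a _; apply: eq_bigr => b _.
  case: (G1 a) => //; case: (G2 b); rewrite ?muln0 //=.
  by case: (v1 a) (v2 b) => [|[|x]] [|[|y]].
under eq_bigr do rewrite big_split -!big_distrr /= n20 n21 muln1.
by rewrite big_split -big_distrl /= n10 n11 mul1n.
Qed.

Lemma pair_count_lt B k : (cond1 + k * e1 < B)%N -> (cond2 + k * e2 < B)%N ->
  (\sum_(a < B) \sum_(b < B) [&& G1 a, G2 b & v1 a + v2 b < k.+1]
   = 1 + (e1 + e2) * k + e1 * e2 * 'C(k, 2))%N.
Proof.
move=> B1 B2; have B_gt0 : (0 < B)%N by lia.
transitivity (\sum_(a < B) \sum_(i < k.+1) (G1 a && (v1 a == i)) * (1 + e2 * (k - i)))%N.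
  apply: eq_bigr => a _; case: (boolP (G1 a)) => Ga; last first.
    by rewrite !big1.
  have [vk|kv] := ltnP (v1 a) k.+1; last first.
    rewrite !big1 // => [i _|b _].
      by case: (v1 a =P i) => // vi; move: (ltn_ord i); rewrite ltnNge -vi kv.
    by rewrite ltnNge (leq_trans kv) ?leq_addr ?andbF.
  rewrite (bigD1 (Ordinal vk)) //= eqxx mul1n [X in _ = (_ + X)%N]big1 ?addn0 => [|i iv]; last first.
    by case: (v1 a =P i) => // vi; move: iv; rewrite -val_eqE /= -vi eqxx.
  rewrite -(@arf_count_lt _ _ _ arf2 B); last first.
    apply: leq_ltn_trans B2; rewrite leq_add2l leq_mul2r leq_subr orbT //.
  apply: eq_bigr => b _; congr (nat_of_bool (_ && _)).
  by rewrite !ltnS leq_subRL.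
rewrite exchange_big /=; under eq_bigr do rewrite -big_distrl /=.
rewrite big_ord_recl (arf_count0 arf1 B_gt0) mul1n subn0.
rewrite (eq_bigr (fun i : 'I_k => e1 + e1 * e2 * (k - i.+1)))%N; last first.
  move=> i _; rewrite lift0 (@arf_countS _ _ _ arf1); first by rewrite mulnDr muln1 mulnA.
  by apply: leq_ltn_trans B1; rewrite leq_add2l leq_mul2r ltn_ord orbT.
rewrite big_split /= sum_nat_const card_ord -big_distrr /=.
have -> : (\sum_(i < k) (k - i.+1) = 'C(k, 2))%N.
  rewrite -bin2_sum big_mkord (reindex_inj rev_ord_inj) /=; apply: eq_bigr => i _.
  by have := ltn_ord i; lia.
lia.
Qed.
End Pairs.

Lemma bin2_rat k : 'C(k, 2)%:R = k%:R * (k%:R - 1) / 2 :> rat.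
Proof.
elim: k => [|k IH]; first by rewrite !mul0r.
by rewrite binS bin1 natrD IH -[k.+1]addn1 natrD; field.
Qed.
End Counting.

Section Invariants.
Context {R : realType} {S : comAlgType R[i]%C}.
Local Notation C := R[i]%C.

Lemma has_edim_monomial d (G : 'I_d -> pred nat) e cond (tau : {lrmorphism S -> cvps C d})
    (L : seq 'X_{1..d}) :
  (forall j, arf_semigroup (G j) (e j) (cond j)) -> injective tau ->
  (forall F, (exists s, tau s = F) <-> supp_in (exponents G) F) ->
  uniq L -> (forall m, m \in L <-> exponents G m /\ total_order G e m = 1%N) ->
  has_edim S (size L).
Proof.
move=> arf tau_inj tau_range uniqL HL.
apply: (monomial_quot_dim tau_range (pU := order_ge G e 1) (pW := order_ge G e 2)) => //.
- exact: (nonunitsE arf tau_inj tau_range).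
- exact: (ideal_exp_nonunits arf tau_inj tau_range).
- by move=> m [].
move=> m; rewrite HL /order_ge; split=> [[Gm ->]|[[Gm m1] m2]]; first by split; [split | case].
split=> //; apply/eqP; rewrite eqn_leq m1 andbT leqNgt; apply/negP => m2'.
exact: m2.
Qed.

Lemma quot_dim_monomial d (G : 'I_d -> pred nat) e cond (tau : {lrmorphism S -> cvps C d})
    (L : seq 'X_{1..d}) k :
  (forall j, arf_semigroup (G j) (e j) (cond j)) -> injective tau ->
  (forall F, (exists s, tau s = F) <-> supp_in (exponents G) F) ->
  uniq L -> (forall m, m \in L <-> exponents G m /\ (total_order G e m < k)%N) ->
  has_quot_dim [set: S]%classic (ideal_exp nonunits k) (size L).
Proof.
move=> arf tau_inj tau_range uniqL HL.
apply: (monomial_quot_dim tau_range (pU := exponents G) (pW := order_ge G e k)) => //.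
- by move=> s; split=> // _; apply: (tau_supp tau_range).
- exact: (ideal_exp_nonunits arf tau_inj tau_range).
move=> m; rewrite HL /order_ge ltnNge; split=> [[Gm /negP mk]|[Gm mk]]; first by split=> // -[].
by split=> //; apply/negP => km; apply: mk.
Qed.

Section OneVariable.
Variables (G : pred nat) (e cond : nat).
Hypothesis arf : arf_semigroup G e cond.
Variable tau : {lrmorphism S -> cvps C 1}.
Hypothesis tau_inj : injective tau.
Hypothesis tau_range : forall F, (exists s, tau s = F) <-> supp_in (exponents (fun _ => G)) F.

Definition mnm_single (a : nat) : 'X_{1..1} := [multinom a | i < 1].

Lemma mnm_singleE a : mnm_single a ord0 = a. Proof. exact: mnmE. Qed.

Lemma mnm_single_inj : injective mnm_single.
Proof. by move=> a b /(congr1 (fun m : 'X_{1..1} => m ord0)); rewrite !mnmE. Qed.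

Lemma mnm_singleK (m : 'X_{1..1}) : mnm_single (m ord0) = m.
Proof. by apply/mnmP => i; rewrite mnmE (ord1 i). Qed.

Definition exponent_list (Q : pred nat) (B : nat) : seq 'X_{1..1} :=
  [seq mnm_single a | a <- iota 0 B & G a && Q (arf_order G e a)].

Lemma exponent_list_uniq Q B : uniq (exponent_list Q B).
Proof. by rewrite map_inj_uniq ?filter_uniq ?iota_uniq //; apply: mnm_single_inj. Qed.

Lemma size_exponent_list Q B :
  size (exponent_list Q B) = (\sum_(a < B) (G a && Q (arf_order G e a)))%N.
Proof. by rewrite size_map size_filter count_iota. Qed.

Lemma mem_exponent_list (Q : pred nat) B m : (forall a, Q (arf_order G e a) -> (a < B)%N) ->
  m \in exponent_list Q B <->
  exponents (fun _ => G) m /\ Q (total_order (fun _ => G) (fun _ => e) m).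
Proof.
move=> HQ; rewrite /total_order big_ord1; split=> [/mapP[a]|[Gm Qm]].
  rewrite mem_filter => /andP[/andP[Ga Qa] _] ->; rewrite mnm_singleE; split=> // j.
  by rewrite (ord1 j) mnm_singleE.
apply/mapP; exists (m ord0); last by rewrite mnm_singleK.
by rewrite mem_filter Gm Qm mem_iota add0n HQ.
Qed.

Lemma has_edim_one : has_edim S e.
Proof.
pose B := (cond + 1 * e).+1.
have HQ a : (arf_order G e a == 1)%N -> (a < B)%N.
  by move=> /eqP va; rewrite ltnS (arf_order_bound arf) // va.
rewrite -[e](@arf_countS _ _ _ arf B 0) // -(size_exponent_list (fun v => v == 1)%N).
apply: (has_edim_monomial (e := fun _ => e) (fun _ => arf) tau_inj tau_range).
  exact: exponent_list_uniq.
move=> m; rewrite mem_exponent_list //.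
by split=> -[Gm /eqP].
Qed.

Lemma has_mult_one : has_mult S e.
Proof.
have [e_gt0 _ _ _ _] := arf.
have e_neq0 : e%:R != 0 :> rat by rewrite pnatr_eq0 -lt0n.
pose s : seq rat := [:: 1 - e%:R; e%:R].
have sE : Poly s = s :> seq rat by apply: (@PolyK _ 0).
exists (Poly s); split; last by rewrite lead_coefE sE /= mul1r.
exists 1%N => -[//|k] _; pose B := (cond + k * e).+1.
exists (1 + e * k)%N; last first.
  by rewrite horner_Poly /= natrD natrM -[k.+1]addn1 natrD; ring.
have HQ a : (arf_order G e a < k.+1)%N -> (a < B)%N.
  by rewrite !ltnS; apply: (arf_order_bound arf).
rewrite -(@arf_count_lt _ _ _ arf B k) // -(size_exponent_list (fun v => v < k.+1)%N).
apply: (quot_dim_monomial (e := fun _ => e) (fun _ => arf) tau_inj tau_range).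
  exact: exponent_list_uniq.
by move=> m; rewrite mem_exponent_list.
Qed.
End OneVariable.

Section TwoVariables.
Variables (G1 G2 : pred nat) (e1 e2 cond1 cond2 : nat).
Hypothesis arf1 : arf_semigroup G1 e1 cond1.
Hypothesis arf2 : arf_semigroup G2 e2 cond2.
Let G (j : 'I_(1 + 1)) : pred nat := match split j with inl _ => G1 | inr _ => G2 end.
Let e (j : 'I_(1 + 1)) : nat := match split j with inl _ => e1 | inr _ => e2 end.
Let cond (j : 'I_(1 + 1)) : nat := match split j with inl _ => cond1 | inr _ => cond2 end.
Variable tau : {lrmorphism S -> cvps C (1 + 1)}.
Hypothesis tau_inj : injective tau.
Hypothesis tau_range : forall F, (exists s, tau s = F) <-> supp_in (exponents G) F.
Local Notation v1 := (arf_order G1 e1).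
Local Notation v2 := (arf_order G2 e2).

Let arf j : arf_semigroup (G j) (e j) (cond j).
Proof. by rewrite /G /e /cond; case: split. Qed.

Definition pair_exponent (p : nat * nat) : 'X_{1..1 + 1} :=
  mnm_join (mnm_single p.1) (mnm_single p.2).

Lemma pair_exponent_inj : injective pair_exponent.
Proof.
move=> [a b] [a' b'] E; have := congr1 mnml E; have := congr1 mnmr E.
by rewrite !mnml_join !mnmr_join => /mnm_single_inj /= -> /mnm_single_inj /= ->.
Qed.

Definition pair_list (Q : pred nat) (B : nat) : seq 'X_{1..1 + 1} :=
  [seq pair_exponent p | p <- [seq (a, b) | a <- iota 0 B, b <- iota 0 B]
    & [&& G1 p.1, G2 p.2 & Q (v1 p.1 + v2 p.2)%N]].

Lemma pair_list_uniq Q B : uniq (pair_list Q B).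
Proof.
rewrite map_inj_uniq; last exact: pair_exponent_inj.
by rewrite filter_uniq // allpairs_uniq ?iota_uniq // => -[a b] [a' b'].
Qed.

Lemma size_pair_list (Q : pred nat) B : size (pair_list Q B) =
  (\sum_(a < B) \sum_(b < B) [&& G1 a, G2 b & Q (v1 a + v2 b)%N])%N.
Proof.
rewrite size_map size_filter -sum1_count big_mkcond big_allpairs.
rewrite -(big_mkord xpredT (fun a => \sum_(b < B) [&& G1 a, G2 b & Q (v1 a + v2 b)%N]))%N.
rewrite /index_iota subn0; apply: eq_bigr => a _.
rewrite -(big_mkord xpredT (fun b => [&& G1 a, G2 b & Q (v1 a + v2 b)%N] : nat)).
by rewrite /index_iota subn0; apply: eq_bigr => b _ /=; case: ifP.
Qed.

Lemma total_order_pair (m : 'X_{1..1 + 1}) :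
  total_order G e m = (v1 (mnml m ord0) + v2 (mnmr m ord0))%N.
Proof.
rewrite /total_order big_split_ord !big_ord1 /G /e /=.
by rewrite (unsplitK (inl ord0)) (unsplitK (inr ord0)) !mnmE.
Qed.

Lemma exponents_pair (m : 'X_{1..1 + 1}) :
  exponents G m <-> G1 (mnml m ord0) /\ G2 (mnmr m ord0).
Proof.
rewrite !mnmE; split=> [Gm|[Gl Gr] j].
  have := Gm (lshift 1 ord0); have := Gm (rshift 1 ord0).
  by rewrite /G (unsplitK (inl ord0)) (unsplitK (inr ord0)).
rewrite -(splitK j) /G unsplitK; case: (split j) => i /=; by rewrite (ord1 i).
Qed.

Lemma mem_pair_list (Q : pred nat) B m :
  (forall a b, Q (v1 a + v2 b)%N -> (a < B)%N && (b < B)%N) ->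
  m \in pair_list Q B <-> exponents G m /\ Q (total_order G e m).
Proof.
move=> HQ; rewrite exponents_pair total_order_pair; split=> [/mapP[[a b]]|[[Gl Gr] Qm]].
  rewrite mem_filter => /andP[/and3P[/= Ga Gb Qab] _] ->.
  by rewrite mnml_join mnmr_join !mnm_singleE.
apply/mapP; exists (mnml m ord0, mnmr m ord0).
  rewrite mem_filter /= Gl Gr Qm; have /andP[aB bB] := HQ _ _ Qm.
  by apply: allpairs_f; rewrite mem_iota.
by rewrite /pair_exponent /= !mnm_singleK -mnm_joinE.
Qed.

Lemma has_edim_two : has_edim S (e1 + e2).
Proof.
pose B := (cond1 + 1 * e1 + (cond2 + 1 * e2)).+1.
have HQ a b : (v1 a + v2 b == 1)%N -> (a < B)%N && (b < B)%N.
  move=> /eqP ab.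
  have := arf_order_bound arf1 (_ : v1 a <= 1)%N; have := arf_order_bound arf2 (_ : v2 b <= 1)%N.
  by move=> /(_ ltac:(lia)) ? /(_ ltac:(lia)) ?; rewrite /B; lia.
rewrite -(@pair_count1 _ _ _ _ _ _ arf1 arf2 B); [|rewrite /B; lia..].
rewrite -(size_pair_list (fun v => v == 1)%N).
apply: (has_edim_monomial arf tau_inj tau_range); first exact: pair_list_uniq.
move=> m; rewrite mem_pair_list //.
by split=> -[Gm /eqP].
Qed.

Lemma has_mult_two : has_mult S (e1 * e2).
Proof.
have [e1_gt0 _ _ _ _] := arf1; have [e2_gt0 _ _ _ _] := arf2.
pose x : rat := e1%:R; pose y : rat := e2%:R.
(* 1 + (x + y)(k - 1) + x y (k - 1)(k - 2)/2, by powers of k *)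
pose s : seq rat := [:: 1 - (x + y) + x * y; x + y - 3 * (x * y / 2); x * y / 2].
have sE : Poly s = s :> seq rat.
  by apply: (@PolyK _ 0); rewrite /= !mulf_neq0 ?invr_eq0 ?pnatr_eq0 -?lt0n.
exists (Poly s); split; last first.
  rewrite lead_coefE sE /= natrM -/x -/y.
  have -> : 2`!%:R = 2 :> rat by [].
  by field.
exists 1%N => -[//|k] _; pose B := (cond1 + k * e1 + (cond2 + k * e2)).+1.
exists (1 + (e1 + e2) * k + e1 * e2 * 'C(k, 2))%N; last first.
  rewrite horner_Poly /= !natrD !natrM natrD bin2_rat -/x -/y -[k.+1]addn1 natrD.
  by field.
have HQ a b : (v1 a + v2 b < k.+1)%N -> (a < B)%N && (b < B)%N.
  rewrite ltnS => ab.
  have := arf_order_bound arf1 (leq_trans (leq_addr _ _) ab).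
  have := arf_order_bound arf2 (leq_trans (leq_addl _ _) ab).
  by rewrite /B; move: (k * e1)%N (k * e2)%N => ? ? ? ?; lia.
rewrite -(@pair_count_lt _ _ _ _ _ _ arf1 arf2 B);
  [|by rewrite /B; move: (k * e1)%N (k * e2)%N => ? ?; lia..].
rewrite -(size_pair_list (fun v => v < k.+1)%N).
apply: (quot_dim_monomial arf tau_inj tau_range); first exact: pair_list_uniq.
by move=> m; rewrite mem_pair_list.
Qed.
End TwoVariables.
End Invariants.

(** The gcd attached to a + b - e divides those attached to a, b and e, which
divide a, b and e. *)
Lemma arf_saturated d N (c : 'I_N -> 'I_d) (g : 'I_N -> nat) j :
  (forall i, (0 < g i)%N) -> (forall j, \big[gcdn/0%N]_(i | c i == j) g i = 1%N) ->
  exists e, arf_semigroup (saturated_at c g j) e (conductor g).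
Proof.
move=> g_gt0 gcd1; pose P x := [exists i, (c i == j) && (g i == x)].
have exP : exists x, P x.
  case: (pickP (fun i => c i == j)) => [i ci|none].
    by exists (g i); apply/existsP; exists i; rewrite ci eqxx.
  by have := gcd1 j; rewrite big_pred0.
have [e /existsP[i0 /andP[/eqP ci0 /eqP gi0]] mine] := ex_minnP exP.
have Ge : saturated_at c g j e by rewrite -ci0 -gi0 saturated_at_gen.
exists e; split=> [| |a Sa|a b|].
- by rewrite -gi0 g_gt0.
- by split=> //; apply: saturated_at0.
- have [ae|] := ltnP a e; [left|by right].
  move: Sa; rewrite /saturated_at /gcd_upto big_pred0 ?dvd0n => [/eqP //|i].
  apply/negbTE; rewrite negb_and orbC -implybE; apply/implyP => ga.
  apply: contraTN ae => ci; rewrite -leqNgt; apply: leq_trans ga.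
  by apply: mine; apply/existsP; exists i; rewrite ci eqxx.
- exact: saturated_atD.
split=> [a b Sa Sb a_gt0 b_gt0|a]; last exact: saturated_at_conductor.
have le x : saturated_at c g j x -> (0 < x)%N -> (e <= x)%N.
  move=> Sx x_gt0; rewrite leqNgt; apply/negP => xe.
  move: Sx; rewrite /saturated_at /gcd_upto big_pred0 ?dvd0n => [/eqP x0|i].
    by rewrite x0 in x_gt0.
  apply/negbTE; rewrite negb_and orbC -implybE; apply/implyP => gx.
  apply: contraTN xe => ci; rewrite -leqNgt; apply: leq_trans gx.
  by apply: mine; apply/existsP; exists i; rewrite ci eqxx.
have ea := le _ Sa a_gt0; have eb := le _ Sb b_gt0.
rewrite /saturated_at; apply: dvdn_sub; first apply: dvdn_add.
- by apply: dvdn_trans Sa; apply: gcd_upto_leq; lia.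
- by apply: dvdn_trans Sb; apply: gcd_upto_leq; lia.
by apply: dvdn_trans Ge; apply: gcd_upto_leq; lia.
Qed.

Lemma saturated_at_sum d1 d2 N1 N2 (c1 : 'I_N1 -> 'I_d1) (g1 : 'I_N1 -> nat)
    (c2 : 'I_N2 -> 'I_d2) (g2 : 'I_N2 -> nat) (j : 'I_(d1 + d2)) a :
  saturated_at (sum_color c1 c2) (sum_exponent g1 g2) j a =
  match split j with inl i => saturated_at c1 g1 i a | inr i => saturated_at c2 g2 i a end.
Proof.
rewrite /saturated_at /gcd_upto big_split_ord /=; have := splitK j; case: (split j) => i /= <-.
  rewrite [X in gcdn _ X]big_pred0 => [|k]; last by rewrite sum_color_r eq_rlshift.
  rewrite gcdn0; congr (_ %| _)%N; apply: eq_big => k; last by rewrite sum_exponent_l.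
  by rewrite sum_color_l sum_exponent_l eq_lshift.
rewrite [X in gcdn X _]big_pred0 => [|k]; last by rewrite sum_color_l eq_lrshift.
rewrite gcd0n; congr (_ %| _)%N; apply: eq_big => k; last by rewrite sum_exponent_r.
by rewrite sum_color_r sum_exponent_r eq_rshift.
Qed.

(** The normalization is contained in a field. *)
Lemma lipschitz_saturation_domain (R : realType) (A S : comAlgType R[i]%C) :
  is_lipschitz_saturation A S -> forall a b : A, a * b = 0 -> a = 0 \/ b = 0.
Proof.
move=> [B [P [Q [nu [p1 [p2 [q [sigma [norm _ _ _]]]]]]]]] a b /(congr1 nu).
rewrite lrM lr0 => /(normalization_domain norm)[] E; [left|right];
  by apply: (normalization_nu_inj norm); rewrite E lr0.
Qed.

Theorem corollary4p2 (R : realType) (A1 A2 A S1 S2 S : comAlgType R[i]%C)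
    (pr1 : {lrmorphism A1 -> A}%R) (pr2 : {lrmorphism A2 -> A}%R) :
  toric_germ 1 A1 -> toric_germ 1 A2 -> germ_product pr1 pr2 ->
  is_lipschitz_saturation A1 S1 ->
  is_lipschitz_saturation A2 S2 ->
  is_lipschitz_saturation A S ->
  (exists d1 d2 : nat,
     [/\ has_edim S1 d1, has_edim S2 d2 & has_edim S (d1 + d2)%N]) /\
  (exists e1 e2 : nat,
     [/\ has_mult S1 e1, has_mult S2 e2 & has_mult S (e1 * e2)%N]).
Proof.
move=> toric1 toric2 prod sat1 sat2 sat.
have [n1 [g1 [psi1 [theta1 [model1 inj1]]]]] :=
  toric_curve_model (lipschitz_saturation_domain sat1) toric1.
have [n2 [g2 [psi2 [theta2 [model2 inj2]]]]] :=
  toric_curve_model (lipschitz_saturation_domain sat2) toric2.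
have [psi [theta [model inj]]] :=
  product_model model1 model2 inj1 inj2 prod (lipschitz_saturation_domain sat).
have [tau1 [tinj1 range1]] := lipschitz_saturation_model model1 inj1 sat1.
have [tau2 [tinj2 range2]] := lipschitz_saturation_model model2 inj2 sat2.
have [tau [tinj range]] := lipschitz_saturation_model model inj sat.
have [_ _ pos1 gcd1] := model1; have [_ _ pos2 gcd2] := model2.
have [e1 arf1] := arf_saturated ord0 pos1 gcd1.
have [e2 arf2] := arf_saturated ord0 pos2 gcd2.
have expE n (g : 'I_n -> nat) m : saturated (fun _ => ord0 : 'I_1) g m <->
    exponents (fun _ => saturated_at (fun _ => ord0 : 'I_1) g ord0) m.
  by split=> H j; have := H j; rewrite (ord1 j).
have {}range1 F : (exists s, tau1 s = F) <->
    supp_in (exponents (fun _ => saturated_at (fun _ => ord0 : 'I_1) g1 ord0)) F.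
  by rewrite range1; split=> H m /H /expE.
have {}range2 F : (exists s, tau2 s = F) <->
    supp_in (exponents (fun _ => saturated_at (fun _ => ord0 : 'I_1) g2 ord0)) F.
  by rewrite range2; split=> H m /H /expE.
have {}range F : (exists s, tau s = F) <->
    supp_in (exponents (fun j : 'I_(1 + 1) => match split j with
      inl _ => saturated_at (fun _ => ord0 : 'I_1) g1 ord0
    | inr _ => saturated_at (fun _ => ord0 : 'I_1) g2 ord0 end)) F.
  rewrite range; split=> H m /H Hm j; have := Hm j; rewrite saturated_at_sum;
    by case: (split j) => i; rewrite (ord1 i).
split.
  exists e1, e2; split.
  - exact: has_edim_one arf1 _ tinj1 range1.
  - exact: has_edim_one arf2 _ tinj2 range2.
  - exact: has_edim_two arf1 arf2 _ tinj range.
exists e1, e2; split.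
- exact: has_mult_one arf1 _ tinj1 range1.
- exact: has_mult_one arf2 _ tinj2 range2.
- exact: has_mult_two arf1 arf2 _ tinj range.
Qed.
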